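(* The $q$-Berezin transform $B_{q,\alpha}:\mathcal D(U_n)_q\to\mathcal D(U_n)'_q$, $f\mapsto\sigma(T_f)$, is a morphism of $U_q\mathfrak{su}_{n,1}$-modules.
   Context: **Notation.** Fix an integer $n\ge1$, $q\in(0,1)$ and a real number $\alpha>0$. $(a;q)_m=\prod_{j=0}^{m-1}(1-aq^j)$. For $\underline i,\underline j\in\mathbb Z_{\ge0}^n$: $|\underline i|=i_1+\dots+i_n$, $\underline i\times\underline j=(i_1j_1,\dots,i_nj_n)$; $P(n)=\{\underline k\in\mathbb Z^n_{\ge0}: k_1\ge\dots\ge k_n\}$; $\mathbf z^{\underline i}=z_n^{i_n}\cdots z_1^{i_1}$, $\mathbf z^{*\underline i}=z_1^{*i_1}\cdots z_n^{*i_n}$. **Quantum group.** $U_q\mathfrak{sl}_{n+1}$ is the unital algebra with generators $E_i,F_i,K_i^{\pm1}$ ($1\le i\le n$) and the standard Drinfeld–Jimbo relations: the $K_i$ commute and are invertible, $K_iE_j=q^{a_{ij}}E_jK_i$, $K_iF_j=q^{-a_{ij}}F_jK_i$, $E_iF_j-F_jE_i=\delta_{ij}\frac{K_i-K_i^{-1}}{q-q^{-1}}$, $E_i^2E_j-(q+q^{-1})E_iE_jE_i+E_jE_i^2=0$ and the same for $F$ when $|i-j|=1$, $[E_i,E_j]=[F_i,F_j]=0$ when $|i-j|\ne1$; $(a_{ij})$ is the Cartan matrix of type $A_n$. Hopf structure: $\Delta E_i=E_i\otimes1+K_i\otimes E_i$, $\Delta F_i=F_i\otimes K_i^{-1}+1\otimes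 F_i$, $\Delta K_i=K_i\otimes K_i$, $S(E_i)=-K_i^{-1}E_i$, $S(F_i)=-F_iK_i$, $S(K_i)=K_i^{-1}$, $\varepsilon(E_i)=\varepsilon(F_i)=0$, $\varepsilon(K_i)=1$. $U_q\mathfrak{su}_{n,1}$ is this Hopf algebra with the involution $E_n^*=-K_nF_n$, $F_n^*=-E_nK_n^{-1}$, $E_j^*=K_jF_j$, $F_j^*=E_jK_j^{-1}$ ($j\ne n$), $(K_j^{\pm1})^*=K_j^{\pm1}$. A unital $*$-algebra $F$ is a module algebra over a $*$-Hopf algebra $A$ if it is an $A$-module, multiplication $F\otimes F\to F$ is an $A$-morphism, $\xi(1)=\varepsilon(\xi)1$, and $(\xi(f))^*=S(\xi)^*(f^* )$. **Algebras.** $\mathcal P(\mathbb C^n)_q$ is the unital $*$-algebra with generators $z_1,\dots,z_n$ and relations $z_iz_j=qz_jz_i$ ($i<j$), $z_i^*z_j=qz_jz_i^*$ ($i\ne j$), $z_j^*z_j=q^2z_jz_j^*+(1-q^2)(1-\sum_{k>j}z_kz_k^* )$. $\mathbb C[\mathbb C^n]_q$ is the subalgebra generated by $z_1,\dots,z_n$; the monomials $\mathbf z^{\underline m}$ are its basis. $\mathcal F(U_n)_q$ is obtained from $\mathcal P(\mathbb C^n)_q$ by adding a generator $f_0$ with $f_0^*=f_0^2=f_0$, $z_i^*f_0=f_0z_i=0$; $\mathcal D(U_n)_q=\mathcal F(U_n)_qf_0\mathcal F(U_n)_q$ is the ideal of finite functions. $\mathcal F(U_n)_q$ acts faithfully on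 the space $H$ with basis $\mathbf z^{\underline m}e_0$, where $z_i^*e_0=0$ and $f_0$ is the projection onto $\mathbb Ce_0$; under this action $\mathcal D(U_n)_q$ is the algebra of operators with finitely many nonzero matrix entries. **Module structure.** $\mathcal F(U_n)_q$ is a $U_q\mathfrak{su}_{n,1}$-module algebra (with invariant subalgebra $\mathcal D(U_n)_q$) with: for $k\ne n$: $K_kz_k=qz_k$, $K_kz_{k+1}=q^{-1}z_{k+1}$, $K_kz_i=z_i$ otherwise; $F_kz_k=q^{1/2}z_{k+1}$, $F_kz_i=0$ otherwise; $E_kz_{k+1}=q^{-1/2}z_k$, $E_kz_i=0$ otherwise; $K_nz_n=q^2z_n$, $K_nz_i=qz_i$ ($i<n$); $F_nz_n=q^{1/2}$, $F_nz_i=0$ ($i<n$); $E_nz_i=-q^{1/2}z_nz_i$ for all $i$; $K_jf_0=f_0$ for all $j$, $E_kf_0=F_kf_0=0$ ($k\ne n$), $F_nf_0=-\frac{q^{1/2}}{q^{-2}-1}f_0z_n^*$, $E_nf_0=-\frac{q^{1/2}}{1-q^2}z_nf_0$. **Distributions and invariant integral.** Put $y_i=1-z_iz_i^*-\dots-z_nz_n^*$; in $H$, $y_j\mathbf z^{\underline m}e_0=q^{2(m_j+\dots+m_n)}\mathbf z^{\underline m}e_0$, so functions on $\mathfrak M=\{(q^{2k_1},\dots,q^{2k_n}):\underline k\in P(n)\}$ can be evaluated on $(y_1,\dots,y_n)$. Each $f\in\mathcal F(U_n)_q$ is uniquely a finite sum $\sum_{\underline i\times\underline j=\underline0}\mathbf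 z^{\underline i}f_{\underline i,\underline j}(y_1,\dots,y_n)\mathbf z^{*\underline j}$ with $f_{\underline i,\underline j}$ functions on $\mathfrak M$ (finitely supported when $f\in\mathcal D(U_n)_q$). $\mathcal D(U_n)'_q$ is the space of infinite formal sums of this form with arbitrary functions $f_{\underline i,\underline j}$ on $\mathfrak M$, with the topology of pointwise convergence of coefficients; it is the completion of $\mathcal D(U_n)_q$; the right multiplication by elements of $\mathcal D(U_n)_q$ and the $U_q\mathfrak{su}_{n,1}$-action extend to it by continuity. $\int_{U_n}f\,d\nu_q=(q^2;q^2)_n\sum_{\underline k\in P(n)}f_{\underline 0,\underline 0}(q^{2k_1},\dots,q^{2k_n})q^{-2nk_1}q^{2k_2}\cdots q^{2k_n}$ for $f\in\mathcal D(U_n)_q$; it gives by continuity a nondegenerate pairing $(\psi,\varphi)\mapsto\int_{U_n}\psi\varphi\,d\nu_q$ of $\mathcal D(U_n)'_q$ with $\mathcal D(U_n)_q$. **Toeplitz operators.** $\int_{U_n}f\,dm_{\alpha,q}=(q^{2\alpha+2};q^2)_n\sum_{\underline k\in P(n)}f_{\underline 0,\underline 0}(q^{2k_1},\dots,q^{2k_n})q^{2k_1(\alpha+1)}q^{2k_2}\cdots q^{2k_n}$, $(f,g)_{\alpha,q}=\int_{U_n}g^*f\,dm_{\alpha,q}$; $L^2(dm_{\alpha,q})$ is the completion of $\mathcal D(U_n)_q$ (it contains $\mathcal P(\mathbb C^n)_q$), $P_{\alpha,q}$ the orthogonal projection onto the closure of $\mathbb C[\mathbb C^n]_q$. $\mathbb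 C[\mathbb C^n]_{q,\alpha}$ is $\mathbb C[\mathbb C^n]_q$ with this scalar product. For $f\in\mathcal D(U_n)_q$, $T_f\in\mathrm{End}(\mathbb C[\mathbb C^n]_{q,\alpha})$, $T_f(\psi)=P_{\alpha,q}(f\psi)$; its matrix in the basis $\mathbf z^{\underline m}$ has finitely many nonzero entries. **Covariant symbols.** For an operator with finitely many nonzero matrix entries, $A\mathbf z^{\underline m}=\sum_{\underline k}A^{\underline m}_{\underline k}\mathbf z^{\underline k}$, set $\mathrm{Tr}_q(A)=\frac{(q^2;q^2)_n}{(q^{2+2\alpha};q^2)_n}\sum_{\underline m}A^{\underline m}_{\underline m}q^{-2n|\underline m|}q^{2(m_2+\dots+m_n)}q^{2(m_3+\dots+m_n)}\cdots q^{2m_n}$. The covariant symbol of $T\in\mathrm{End}(\mathbb C[\mathbb C^n]_{q,\alpha})$ is the unique $\sigma(T)\in\mathcal D(U_n)'_q$ with $\int_{U_n}\sigma(T)f\,d\nu_q=\mathrm{Tr}_q(T\,T_f)$ for all $f\in\mathcal D(U_n)_q$. *)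

(* Defs.v *)
From HB Require Import structures.
From mathcomp Require Import all_boot all_order all_algebra.
From mathcomp Require Import finmap.
From mathcomp Require Import all_classical all_reals all_analysis.
From mathcomp Require Import complex.
From mathcomp.analysis Require Import showcase.summability.

Set Implicit Arguments.
Unset Strict Implicit.
Unset Printing Implicit Defensive.

Import Order.TTheory GRing.Theory Num.Theory.
Import numFieldNormedType.Exports.

Local Open Scope classical_set_scope.
Local Open Scope ring_scope.
Local Open Scope quotient_scope.

(* Unital associative algebras given by generators and relations.             *)
(* [ncpoly K X] is the set of noncommutative polynomial expressions over K in *)
(* the generators X, and [presAlg rel] is its quotient by the smallest        *)
(* congruence containing [rel] and the axioms of unital K-algebras.  Only a   *)
(* pzRingType and an lmodType are declared on the quotient, because           *)
(* mathcomp's algType requires 1 != 0, which may fail for an arbitrary        *)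
(* presentation.                                                              *)

Inductive ncpoly (K X : Type) : Type :=
| TGen of X
| TCst of K
| TAdd of ncpoly K X & ncpoly K X
| TMul of ncpoly K X & ncpoly K X.

Arguments TGen {K X} _.
Arguments TCst {K X} _.

Declare Scope ncpoly_scope.
Delimit Scope ncpoly_scope with NC.
Bind Scope ncpoly_scope with ncpoly.
Notation "a + b" := (TAdd a b) : ncpoly_scope.
Notation "a * b" := (TMul a b) : ncpoly_scope.
Notation "c *: a" := (TMul (TCst c%R) a) : ncpoly_scope.
Notation "a - b" := (TAdd a (TMul (TCst (- 1)%R) b)) : ncpoly_scope.

HB.instance Definition _ K X := gen_eqMixin (ncpoly K X).
HB.instance Definition _ K X := gen_choiceMixin (ncpoly K X).

Section PresentedAlgebra.
Variables (K : comNzRingType) (X : Type).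
Variable rel : ncpoly K X -> ncpoly K X -> Prop.

Inductive cong : ncpoly K X -> ncpoly K X -> Prop :=
| cong_rel a b : rel a b -> cong a b
| cong_refl a : cong a a
| cong_sym a b : cong a b -> cong b a
| cong_trans a b c : cong a b -> cong b c -> cong a c
| cong_add a a' b b' : cong a a' -> cong b b' -> cong (a + b)%NC (a' + b')%NC
| cong_mul a a' b b' : cong a a' -> cong b b' -> cong (a * b)%NC (a' * b')%NC
| cong_addA a b c : cong (a + (b + c))%NC (a + b + c)%NC
| cong_addC a b : cong (a + b)%NC (b + a)%NC
| cong_add0 a : cong (TCst 0 + a)%NC a
| cong_addN a : cong ((-1) *: a + a)%NC (TCst 0)
| cong_mulA a b c : cong (a * (b * c))%NC (a * b * c)%NC
| cong_mul1 a : cong (TCst 1 * a)%NC a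
| cong_mulDl a b c : cong ((a + b) * c)%NC (a * c + b * c)%NC
| cong_mulDr a b c : cong (a * (b + c))%NC (a * b + a * c)%NC
| cong_cstD x y : cong (TCst (x + y)%R) (TCst x + TCst y)%NC
| cong_cstM x y : cong (TCst (x * y)%R) (TCst x * TCst y)%NC
| cong_cstC x a : cong (TCst x * a)%NC (a * TCst x)%NC.

Definition congb a b := `[< cong a b >].

Lemma congb_refl : reflexive congb.
Proof. by move=> a; apply/asboolP; exact: cong_refl. Qed.

Lemma congb_sym : symmetric congb.
Proof. by move=> a b; apply/asboolP/asboolP; exact: cong_sym. Qed.

Lemma congb_trans : transitive congb.
Proof.
move=> b a c /asboolP ab /asboolP bc.
by apply/asboolP; exact: cong_trans ab bc.
Qed.

Canonical cong_equiv := EquivRel congb congb_refl congb_sym congb_trans.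

Definition presAlg := {eq_quot congb}.

HB.instance Definition _ := Choice.on presAlg.

Definition cls (a : ncpoly K X) : presAlg := \pi_{eq_quot congb} a.
Definition rep (x : presAlg) : ncpoly K X := repr (x : {eq_quot congb}).

Implicit Types x y : presAlg.

Lemma repK : cancel rep cls.
Proof. exact: reprK. Qed.

Lemma pi_cong (a b : ncpoly K X) : cong a b -> cls a = cls b.
Proof. by move=> ab; apply/eqmodP/asboolP. Qed.

Lemma piK (a b : ncpoly K X) : cls a = cls b -> cong a b.
Proof. by move=> /eqmodP/asboolP. Qed.

Lemma rep_cong (a : ncpoly K X) : cong (rep (cls a)) a.
Proof. by apply: piK; rewrite repK. Qed.

Definition pres_zero : presAlg := cls (TCst 0).
Definition pres_one : presAlg := cls (TCst 1).
Definition pres_add x y : presAlg := cls (rep x + rep y)%NC.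
Definition pres_mul x y : presAlg := cls (rep x * rep y)%NC.
Definition pres_scale (c : K) x : presAlg := cls (c *: rep x)%NC.
Definition pres_opp x : presAlg := pres_scale (-1) x.

Lemma pi_add a b : pres_add (cls a) (cls b) = cls (a + b)%NC.
Proof. by apply: pi_cong; apply: cong_add; exact: rep_cong. Qed.

Lemma pi_mul a b : pres_mul (cls a) (cls b) = cls (a * b)%NC.
Proof. by apply: pi_cong; apply: cong_mul; exact: rep_cong. Qed.

Lemma pi_scale c a : pres_scale c (cls a) = cls (c *: a)%NC.
Proof.
by apply: pi_cong; apply: cong_mul; [exact: cong_refl|exact: rep_cong].
Qed.

Lemma presAlg_ind (P : presAlg -> Prop) : (forall a, P (cls a)) -> forall x, P x.
Proof. by move=> Pp x; rewrite -[x]repK. Qed.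

Lemma pres_addA : associative pres_add.
Proof.
elim/presAlg_ind=> a; elim/presAlg_ind=> b; elim/presAlg_ind=> c.
by rewrite !pi_add; apply: pi_cong; exact: cong_addA.
Qed.

Lemma pres_addC : commutative pres_add.
Proof.
elim/presAlg_ind=> a; elim/presAlg_ind=> b.
by rewrite !pi_add; apply: pi_cong; exact: cong_addC.
Qed.

Lemma pres_add0 : left_id pres_zero pres_add.
Proof.
by elim/presAlg_ind=> a; rewrite pi_add; apply: pi_cong; exact: cong_add0.
Qed.

Lemma pres_addN : left_inverse pres_zero pres_opp pres_add.
Proof.
elim/presAlg_ind=> a; rewrite /pres_opp pi_scale pi_add.
by apply: pi_cong; exact: cong_addN.
Qed.

HB.instance Definition _ := GRing.isZmodule.Build presAlg
  pres_addA pres_addC pres_add0 pres_addN.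

Lemma pres_mulA : associative pres_mul.
Proof.
elim/presAlg_ind=> a; elim/presAlg_ind=> b; elim/presAlg_ind=> c.
by rewrite !pi_mul; apply: pi_cong; exact: cong_mulA.
Qed.

Lemma pres_mul1 : left_id pres_one pres_mul.
Proof.
by elim/presAlg_ind=> a; rewrite pi_mul; apply: pi_cong; exact: cong_mul1.
Qed.

Lemma pres_mulr1 : right_id pres_one pres_mul.
Proof.
elim/presAlg_ind=> a; rewrite pi_mul; apply: pi_cong.
by apply: cong_trans (cong_sym (cong_cstC _ _)) _; exact: cong_mul1.
Qed.

Lemma pres_mulDl : left_distributive pres_mul +%R.
Proof.
elim/presAlg_ind=> a; elim/presAlg_ind=> b; elim/presAlg_ind=> c.
by rewrite /GRing.add /= pi_add !pi_mul pi_add; apply: pi_cong;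
   exact: cong_mulDl.
Qed.

Lemma pres_mulDr : right_distributive pres_mul +%R.
Proof.
elim/presAlg_ind=> a; elim/presAlg_ind=> b; elim/presAlg_ind=> c.
by rewrite /GRing.add /= pi_add !pi_mul pi_add; apply: pi_cong;
   exact: cong_mulDr.
Qed.

HB.instance Definition _ := GRing.Zmodule_isPzRing.Build presAlg
  pres_mulA pres_mul1 pres_mulr1 pres_mulDl pres_mulDr.

Lemma pres_scaleA (c d : K) x :
  pres_scale c (pres_scale d x) = pres_scale (c * d) x.
Proof.
elim/presAlg_ind: x => a; rewrite !pi_scale; apply: pi_cong.
apply: cong_trans (cong_mulA _ _ _) _.
by apply: cong_mul; [exact: cong_sym (cong_cstM _ _)|exact: cong_refl].
Qed.

Lemma pres_scale1 : left_id 1 pres_scale.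
Proof.
by elim/presAlg_ind=> a; rewrite pi_scale; apply: pi_cong; exact: cong_mul1.
Qed.

Lemma pres_scaleDr : right_distributive pres_scale +%R.
Proof.
move=> c; elim/presAlg_ind=> a; elim/presAlg_ind=> b.
by rewrite /GRing.add /= pi_add !pi_scale pi_add; apply: pi_cong;
   exact: cong_mulDr.
Qed.

Lemma pres_scaleDl x : {morph pres_scale^~ x : c d / c + d}.
Proof.
elim/presAlg_ind: x => a c d.
rewrite [in RHS]/GRing.add /= !pi_scale pi_add; apply: pi_cong.
apply: cong_trans (cong_mulDl _ _ _).
by apply: cong_mul; [exact: cong_cstD|exact: cong_refl].
Qed.

HB.instance Definition _ := GRing.Zmodule_isLmodule.Build K presAlg
  pres_scaleA pres_scale1 pres_scaleDr pres_scaleDl.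

Lemma piD a b : cls (a + b)%NC = cls a + cls b.
Proof. by rewrite -pi_add. Qed.

Lemma piM a b : cls (a * b)%NC = cls a * cls b.
Proof. by rewrite -pi_mul. Qed.

Lemma pi1 : cls (TCst 1) = 1.
Proof. by []. Qed.

Lemma pi0 : cls (TCst 0) = 0.
Proof. by []. Qed.

Lemma piZ c a : cls (c *: a)%NC = c *: cls a.
Proof. by rewrite -pi_scale. Qed.

Lemma pi_cst c : cls (TCst c) = c *: (1 : presAlg).
Proof.
rewrite -pi1 -piZ; apply: pi_cong; apply: cong_trans (cong_cstC _ _).
exact: cong_sym (cong_mul1 _).
Qed.

Lemma pres_scalerAl c x y : c *: (x * y) = (c *: x) * y.
Proof.
elim/presAlg_ind: x => a; elim/presAlg_ind: y => b.
by rewrite -piM -!piZ -piM; apply: pi_cong; exact: cong_mulA.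
Qed.

Lemma pres_scalerAr c x y : c *: (x * y) = x * (c *: y).
Proof.
elim/presAlg_ind: x => a; elim/presAlg_ind: y => b.
rewrite -piM -!piZ -piM; apply: pi_cong.
apply: cong_trans (cong_mulA _ _ _) _.
apply: cong_trans (cong_sym (cong_mulA _ _ _)).
by apply: cong_mul; [exact: cong_cstC|exact: cong_refl].
Qed.

End PresentedAlgebra.

Arguments cls {K X} rel a.

(* The antimultiplicative, additive extension to expressions of a map g on    *)
(* generators and a map s on scalars (s = id for linear extensions and        *)
(* s = conjugation for antilinear ones).                                      *)
Fixpoint anti (K X : Type) (s : K -> K) (g : X -> ncpoly K X) (t : ncpoly K X)
    : ncpoly K X :=
  match t with
  | TGen x => g x
  | TCst c => TCst (s c)
  | TAdd a b => TAdd (anti s g a) (anti s g b)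
  | TMul a b => TMul (anti s g b) (anti s g a)
  end.

Lemma anti_cong (K : comNzRingType) (X : Type)
    (rel : ncpoly K X -> ncpoly K X -> Prop)
    (s : {rmorphism K -> K}) (g : X -> ncpoly K X) :
  (forall a b, rel a b -> cong rel (anti s g a) (anti s g b)) ->
  forall a b, cong rel a b -> cong rel (anti s g a) (anti s g b).
Proof.
move=> Hrel a b; elim=> {a b} /=.
- exact: Hrel.
- by move=> a; exact: cong_refl.
- by move=> a b _ H; exact: cong_sym.
- by move=> a b c _ H1 _ H2; exact: cong_trans H1 H2.
- by move=> *; exact: cong_add.
- by move=> *; exact: cong_mul.
- by move=> *; exact: cong_addA.
- by move=> *; exact: cong_addC.
- by move=> a; rewrite rmorph0; exact: cong_add0.
- move=> a; rewrite rmorphN1 rmorph0.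
  apply: cong_trans (cong_addN _ (anti s g a)).
  by apply: cong_add; [exact/cong_sym/cong_cstC|exact: cong_refl].
- by move=> *; exact/cong_sym/cong_mulA.
- move=> a; rewrite rmorph1.
  exact: cong_trans (cong_sym (cong_cstC _ _ _)) (cong_mul1 _ _).
- by move=> *; exact: cong_mulDr.
- by move=> *; exact: cong_mulDl.
- by move=> x y; rewrite rmorphD; exact: cong_cstD.
- by move=> x y; rewrite rmorphM mulrC; exact: cong_cstM.
- by move=> x a; exact/cong_sym/cong_cstC.
Qed.

Section QuantumBall.
Variables (R : realType) (n : nat) (q : R).

Local Notation C := (R[i])%C.

Definition cq : C := (q%:C)%C.

(* q^(1/2), and real powers q^x *)
Definition hq : C := ((Num.sqrt q)%:C)%C.
Definition rq (x : R) : C := ((q `^ x)%:C)%C.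

(* (a;q^2)_m *)
Definition qpoch2 (a : C) (m : nat) : C :=
  \prod_(j < m) (1 - a * (cq ^+ 2) ^+ j).

(* Indices are shifted by one: i : 'I_n stands for i + 1 in {1, ..., n}, and  *)
(* isLast i says that this index is n.                                        *)
Definition isLast (i : 'I_n) : bool := i.+1 == n.

Inductive Ugen := UE of 'I_n | UF of 'I_n | UK of 'I_n | UKV of 'I_n.

Local Notation E i := (TGen (UE i)).
Local Notation F i := (TGen (UF i)).
Local Notation "'K' i" := (TGen (UK i)) (at level 9, i at level 8).
Local Notation "'K^-1' i" := (TGen (UKV i)) (at level 9, i at level 8).

Definition adjI (i j : 'I_n) : bool := (i.+1 == j) || (j.+1 == i).

Definition cartan (i j : 'I_n) : int :=
  if i == j then 2 else if adjI i j then -1 else 0.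

Inductive Urel : ncpoly C Ugen -> ncpoly C Ugen -> Prop :=
| Urel_KK i j : Urel (K i * K j) (K j * K i)
| Urel_KKV i : Urel (K i * K^-1 i) (TCst 1)
| Urel_KVK i : Urel (K^-1 i * K i) (TCst 1)
| Urel_KE i j : Urel (K i * E j) (cq ^ cartan i j *: (E j * K i))
| Urel_KF i j : Urel (K i * F j) (cq ^ (- cartan i j) *: (F j * K i))
| Urel_EF i : Urel (E i * F i - F i * E i)
                   ((cq - cq^-1)^-1 *: (K i - K^-1 i))
| Urel_EF0 (i j : 'I_n) : i != j -> Urel (E i * F j - F j * E i) (TCst 0)
| Urel_serreE (i j : 'I_n) : adjI i j ->
    Urel (E i * E i * E j - (cq + cq^-1) *: (E i * E j * E i) + E j * E i * E i)
         (TCst 0)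
| Urel_serreF (i j : 'I_n) : adjI i j ->
    Urel (F i * F i * F j - (cq + cq^-1) *: (F i * F j * F i) + F j * F i * F i)
         (TCst 0)
| Urel_EE (i j : 'I_n) : ~~ adjI i j -> Urel (E i * E j - E j * E i) (TCst 0)
| Urel_FF (i j : 'I_n) : ~~ adjI i j -> Urel (F i * F j - F j * F i) (TCst 0).

Definition Uq := presAlg Urel.
HB.instance Definition _ := GRing.PzRing.on Uq.
HB.instance Definition _ := GRing.Lmodule.on Uq.

Definition Ucls : ncpoly C Ugen -> Uq := @cls _ _ Urel.

(* The structure maps of the Hopf *-algebra are given on representatives, by  *)
(* multiplicative or antimultiplicative extension from the generators.  A     *)
(* list of pairs [:: (a1, b1); ...] stands for a1 (x) b1 + ... in the tensor  *)
(* square.                                                                    *)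
Fixpoint coprod (t : ncpoly C Ugen) : seq (ncpoly C Ugen * ncpoly C Ugen) :=
  match t with
  | TGen (UE i) => [:: (E i, TCst 1); (K i, E i)]
  | TGen (UF i) => [:: (F i, K^-1 i); (TCst 1, F i)]
  | TGen (UK i) => [:: (K i, K i)]
  | TGen (UKV i) => [:: (K^-1 i, K^-1 i)]
  | TCst c => [:: (TCst c, TCst 1)]
  | TAdd a b => coprod a ++ coprod b
  | TMul a b =>
      [seq ((x.1 * y.1)%NC, (x.2 * y.2)%NC) | x <- coprod a, y <- coprod b]
  end.

Fixpoint counit (t : ncpoly C Ugen) : C :=
  match t with
  | TGen (UE _) | TGen (UF _) => 0
  | TGen (UK _) | TGen (UKV _) => 1
  | TCst c => c
  | TAdd a b => counit a + counit b
  | TMul a b => counit a * counit b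
  end.

Definition antipode : ncpoly C Ugen -> ncpoly C Ugen :=
  anti id (fun x => match x with
    | UE i => ((-1) *: (K^-1 i * E i))%NC
    | UF i => ((-1) *: (F i * K i))%NC
    | UK i => K^-1 i
    | UKV i => K i
    end).

Definition Ustar : ncpoly C Ugen -> ncpoly C Ugen :=
  anti Num.conj (fun x => match x with
    | UE i => if isLast i then ((-1) *: (K i * F i))%NC else (K i * F i)%NC
    | UF i => if isLast i then ((-1) *: (E i * K^-1 i))%NC else (E i * K^-1 i)%NC
    | UK i => K i
    | UKV i => K^-1 i
    end).

Inductive Fgen := FZ of 'I_n | FZs of 'I_n | Ff0.

Local Notation tz i := (TGen (FZ i)).
Local Notation tzs i := (TGen (FZs i)).
Local Notation tf0 := (TGen Ff0).

(* Relations of a *-algebra: each one is listed together with its adjoint,    *)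
(* unless the adjoint is in the same family.                                  *)
Inductive Frel : ncpoly C Fgen -> ncpoly C Fgen -> Prop :=
| Frel_zz (i j : 'I_n) : (i < j)%N -> Frel (tz i * tz j) (cq *: (tz j * tz i))
| Frel_zszs (i j : 'I_n) : (i < j)%N -> Frel (tzs j * tzs i) (cq *: (tzs i * tzs j))
| Frel_zsz (i j : 'I_n) : i != j -> Frel (tzs i * tz j) (cq *: (tz j * tzs i))
| Frel_diag j : Frel (tzs j * tz j)
    (cq ^+ 2 *: (tz j * tzs j) +
     (1 - cq ^+ 2) *:
       (TCst 1 - \big[@TAdd _ _/TCst 0]_(k < n | (j < k)%N) (tz k * tzs k)%NC))
| Frel_ff : Frel (tf0 * tf0) tf0
| Frel_zsf i : Frel (tzs i * tf0) (TCst 0)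
| Frel_fz i : Frel (tf0 * tz i) (TCst 0).

Definition FUn := presAlg Frel.
HB.instance Definition _ := GRing.PzRing.on FUn.
HB.instance Definition _ := GRing.Lmodule.on FUn.

Definition z (i : 'I_n) : FUn := cls Frel (tz i).
Definition zs (i : 'I_n) : FUn := cls Frel (tzs i).
Definition f0 : FUn := cls Frel (tf0).

Definition tstar : ncpoly C Fgen -> ncpoly C Fgen :=
  anti Num.conj (fun x => match x with
    | FZ i => tzs i
    | FZs i => tz i
    | Ff0 => tf0
    end).

Definition star (f : FUn) : FUn :=
  cls Frel (tstar (rep f)).


Lemma conj_cq : (cq)^* = cq.
Proof. by apply: conj_Creal; rewrite complex_real. Qed.

Lemma tstarD (a b : ncpoly C Fgen) : tstar (a + b)%NC = (tstar a + tstar b)%NC.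
Proof. by []. Qed.

Lemma tstarM (a b : ncpoly C Fgen) : tstar (a * b)%NC = (tstar b * tstar a)%NC.
Proof. by []. Qed.

Lemma tstar_cst c : tstar (TCst c) = TCst c^*.
Proof. by []. Qed.

Lemma tstar_scale (c : C) t u :
  c^* = c -> cong Frel u (c *: tstar t) -> cong Frel u (tstar (c *: t)).
Proof.
move=> cc H; apply: cong_trans H _; by rewrite tstarM tstar_cst cc; exact: cong_cstC.
Qed.

Lemma star_cls (t : ncpoly C Fgen) : star (cls Frel t) = cls Frel (tstar t).
Proof.
apply: pi_cong; apply: anti_cong (rep_cong _ _) => a b; rewrite -/tstar.
case=> {a b} [i j ij|i j ij|i j ij|j| |i|i].
- by apply: tstar_scale conj_cq _; apply: cong_rel; exact: Frel_zszs.
- by apply: tstar_scale conj_cq _; apply: cong_rel; exact: Frel_zz.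
- apply: tstar_scale conj_cq _; apply: cong_rel; apply: Frel_zsz.
  by rewrite eq_sym.
- have cq2 : (cq ^+ 2)^* = cq ^+ 2 by rewrite rmorphXn /= conj_cq.
  have c1q2 : (1 - cq ^+ 2)^* = 1 - cq ^+ 2.
    by rewrite rmorphB rmorph1 rmorphXn /= conj_cq.
  apply: cong_trans (cong_rel (Frel_diag j)) _.
  rewrite tstarD.
  apply: cong_add.
    apply: tstar_scale; [exact: cq2|exact: cong_refl].
  apply: tstar_scale c1q2 _; apply: cong_mul; first exact: cong_refl.
  rewrite tstarD tstarM !tstar_cst rmorph1 rmorphN1.
  apply: cong_add; first exact: cong_refl.
  apply: cong_trans (cong_cstC _ _ _) _; apply: cong_mul; last exact: cong_refl.
  apply: (big_ind2 (fun u v => cong Frel u (tstar v))).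
  + by rewrite tstar_cst rmorph0; exact: cong_refl.
  + by move=> *; rewrite tstarD; exact: cong_add.
  + by move=> k _; exact: cong_refl.
- by apply: cong_rel; exact: Frel_ff.
- by rewrite tstar_cst rmorph0; apply: cong_rel; exact: Frel_fz.
- by rewrite tstar_cst rmorph0; apply: cong_rel; exact: Frel_zsf.
Qed.

Definition mi := {ffun 'I_n -> nat}.
Definition mi0 : mi := [ffun=> 0%N].
Definition midisj (i j : mi) : bool := [forall l, i l * j l == 0]%N.
Definition misize (m : mi) : nat := \sum_(l < n) m l.

(* k \in P(n) *)
Definition inP (k : mi) : bool :=
  [forall i : 'I_n, forall j : 'I_n, (i <= j)%N ==> (k j <= k i)%N].

(* (m_1 + ... + m_n, m_2 + ... + m_n, ..., m_n) *)
Definition tails (m : mi) : mi :=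
  [ffun i : 'I_n => (\sum_(l < n | i <= l) m l)%N].

(* z^m = z_n^(m_n) ... z_1^(m_1) and z^*m = z_1^*(m_1) ... z_n^*(m_n) *)
Definition zmon (m : mi) : FUn :=
  \prod_(l < n) z (rev_ord l) ^+ m (rev_ord l).
Definition zsmon (m : mi) : FUn := \prod_(l < n) zs l ^+ m l.

(* Coordinates of x in a linearly independent family b. *)
Definition coord_in (b : mi -> FUn) (x : FUn) : mi -> C :=
  xget (fun=> 0) [set c : mi -> C | finite_set [set m | c m != 0] /\
                                    x = \sum_(m \in setT) c m *: b m].

Definition Dfin : set FUn :=
  [set f | exists (N : nat) (a b : 'I_N -> FUn),
             f = \sum_(k < N) a k * f0 * b k].

Inductive holo : FUn -> Prop :=
| holo1 : holo 1
| holo_z i : holo (z i)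
| holoD f g : holo f -> holo g -> holo (f + g)
| holoZ c f : holo f -> holo (c *: f)
| holoM f g : holo f -> holo g -> holo (f * g).

Record module_algebra (act : Uq -> FUn -> FUn) : Prop := ModuleAlgebra {
  act_linear_l : forall (c : C) (u v : Uq) f,
    act (c *: u + v) f = c *: act u f + act v f;
  act_linear_r : forall (c : C) u f g,
    act u (c *: f + g) = c *: act u f + act u g;
  act_1 : forall f, act 1 f = f;
  act_M : forall u v f, act (u * v) f = act u (act v f);
  act_mul : forall t f g, act (Ucls t) (f * g) =
    \sum_(p <- coprod t) act (Ucls p.1) f * act (Ucls p.2) g;
  act_unit : forall t, act (Ucls t) 1 = counit t *: (1 : FUn);
  act_star : forall t f,
    star (act (Ucls t) f) = act (Ucls (Ustar (antipode t))) (star f)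
}.

(* The existence of l : 'I_n with l = k.+1 forces k to be different from the  *)
(* last index.                                                                *)
Record module_generators (act : Uq -> FUn -> FUn) : Prop := ModuleGenerators {
  act_Kz k : ~~ isLast k -> act (Ucls (K k)) (z k) = cq *: z k;
  act_Kz1 (k l : 'I_n) : l = k.+1 :> nat ->
    act (Ucls (K k)) (z l) = cq^-1 *: z l;
  act_Kz0 (k i : 'I_n) : ~~ isLast k -> i != k -> i != k.+1 :> nat ->
    act (Ucls (K k)) (z i) = z i;
  act_Fz (k l : 'I_n) : l = k.+1 :> nat -> act (Ucls (F k)) (z k) = hq *: z l;
  act_Fz0 (k i : 'I_n) : ~~ isLast k -> i != k -> act (Ucls (F k)) (z i) = 0;
  act_Ez (k l : 'I_n) : l = k.+1 :> nat ->
    act (Ucls (E k)) (z l) = hq^-1 *: z k;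
  act_Ez0 (k i : 'I_n) : ~~ isLast k -> i != k.+1 :> nat ->
    act (Ucls (E k)) (z i) = 0;
  act_Knz k : isLast k -> act (Ucls (K k)) (z k) = cq ^+ 2 *: z k;
  act_Knz0 (k i : 'I_n) : isLast k -> i != k ->
    act (Ucls (K k)) (z i) = cq *: z i;
  act_Fnz k : isLast k -> act (Ucls (F k)) (z k) = hq *: (1 : FUn);
  act_Fnz0 (k i : 'I_n) : isLast k -> i != k -> act (Ucls (F k)) (z i) = 0;
  act_Enz (k i : 'I_n) : isLast k ->
    act (Ucls (E k)) (z i) = - (hq *: (z k * z i));
  act_Kf0 k : act (Ucls (K k)) f0 = f0;
  act_Ef0 k : ~~ isLast k -> act (Ucls (E k)) f0 = 0;
  act_Ff0 k : ~~ isLast k -> act (Ucls (F k)) f0 = 0;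
  act_Fnf0 k : isLast k ->
    act (Ucls (F k)) f0 = - (hq / (cq ^- 2 - 1)) *: (f0 * zs k);
  act_Enf0 k : isLast k ->
    act (Ucls (E k)) f0 = - (hq / (1 - cq ^+ 2)) *: (z k * f0)
}.

(* The coefficient index (i, j, k) stands for the value                       *)
(* f_{i,j}(q^(2k_1), ..., q^(2k_n)).                                          *)
Definition didx := {x : mi * mi * mi | midisj x.1.1 x.1.2 && inP x.2}.

Definition dist : Type := didx -> C.

HB.instance Definition _ := GRing.Lmodule.copy dist (didx -> C).
HB.instance Definition _ :=
  Topological.copy dist {ptws didx -> (C : numFieldType)}.
HB.instance Definition _ := isPointed.Build dist (0 : dist).

Definition dcoef (psi : dist) (i j k : mi) : C :=
  if insub (i, j, k) is Some x then psi x else 0.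

(* The Fock space H is realized as the left ideal F(U_n)_q f_0, with vacuum   *)
(* vector e_0 = f_0 and basis z^m f_0; F(U_n)_q acts by left multiplication.  *)
Definition Hbasis (m : mi) : FUn := zmon m * f0.

(* The operator phi(y_1, ..., y_n) on H, with phi a function of k.            *)
Definition fun_y (phi : mi -> C) (h : FUn) : FUn :=
  \sum_(m \in setT) (phi (tails m) * coord_in Hbasis h m) *: Hbasis m.

(* f = sum of the z^i psi_{i,j}(y_1, ..., y_n) z^*j, a finite sum, as         *)
(* operators on H.                                                            *)
Definition is_expansion (f : FUn) (psi : dist) : Prop :=
  finite_set [set ij : mi * mi | exists k, dcoef psi ij.1 ij.2 k != 0] /\
  forall m, f * Hbasis m =
    \sum_(ij \in setT)
      zmon ij.1 * fun_y (dcoef psi ij.1 ij.2) (zsmon ij.2 * Hbasis m).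

(* The coefficients of f, which give the embedding of D(U_n)_q in D(U_n)'_q.  *)
Definition expansion (f : FUn) : dist := xget 0 [set psi | is_expansion f psi].

(* Extension by continuity to D(U_n)'_q of a map defined on D(U_n)_q.         *)
Definition extend (g : FUn -> dist) (psi : dist) : dist :=
  lim (g @ filter_from (nbhs psi) (fun B => Dfin `&` expansion @^-1` B)).

Definition dact (act : Uq -> FUn -> FUn) (u : Uq) : dist -> dist :=
  extend (fun f => expansion (act u f)).

Definition dmulr (psi : dist) (phi : FUn) : dist :=
  extend (fun f => expansion (f * phi)) psi.

Definition int_nu (psi : dist) : C :=
  qpoch2 (cq ^+ 2) n *
  \sum_(k \in [set: mi]) dcoef psi mi0 mi0 k *
    \prod_(l < n) (if l == 0%N :> nat then cq ^- (2 * n * k l)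
                   else cq ^+ (2 * k l)).

Definition pairing (psi : dist) (phi : FUn) : C := int_nu (dmulr psi phi).

Variable alpha : R.

(* On F(U_n)_q, which contains P(C^n)_q, the sum is infinite; it is the limit *)
(* of the finite partial sums along the net of finite sets of indices k.      *)
Definition int_m (f : FUn) : C :=
  qpoch2 (rq (2 * alpha + 2)) n *
  @sum mi C C^o (fun k => dcoef (expansion f) mi0 mi0 k *
    \prod_(l < n) (if l == 0%N :> nat then rq (2 * (k l)%:R * (alpha + 1))
                   else cq ^+ (2 * k l))).

Definition ip_m (f g : FUn) : C := int_m (star g * f).

(* L^2(dm_{alpha,q}): a Hilbert space that is a completion of D(U_n)_q for    *)
(* the scalar product ip_m, and in which P(C^n)_q is embedded compatibly      *)
(* with ip_m.                                                                 *)
Record L2space := L2Space {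
  L2_sort :> completeNormedModType C;
  dot : L2_sort -> L2_sort -> C;
  emb : FUn -> L2_sort;
  dot_linear : forall (c : C) x y w,
    dot (c *: x + y) w = c * dot x w + dot y w;
  dot_conj : forall x y, dot y x = (dot x y)^*;
  dot_norm : forall x, `|x| ^+ 2 = dot x x;
  emb_linear : forall (c : C) f g, emb (c *: f + g) = c *: emb f + emb g;
  emb_dot : forall f g, dot (emb f) (emb g) = ip_m f g;
  emb_dense : closure (emb @` Dfin) = setT
}.

Section Toeplitz.
Variable L : L2space.

Definition orth_proj (V : set L) (x : L) : L :=
  xget 0 [set p | V p /\ forall v, V v -> dot (x - p) v = 0].

Definition P_alpha : L -> L := orth_proj (closure (@emb L @` holo)).

(* Operators on C[C^n]_q are functions on F(U_n)_q of which only the values   *)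
(* on C[C^n]_q matter.                                                        *)
Definition toeplitz (f psi : FUn) : FUn :=
  xget 0 [set p | holo p /\ emb L p = P_alpha (emb L (f * psi))].

(* The matrix entry T^m_k, where T z^m is the sum of the T^m_k z^k.           *)
Definition entry (T : FUn -> FUn) (m k : mi) : C :=
  coord_in zmon (T (zmon m)) k.

Definition Trq (T : FUn -> FUn) : C :=
  qpoch2 (cq ^+ 2) n / qpoch2 (rq (2 + 2 * alpha)) n *
  \sum_(m \in [set: mi]) entry T m m * cq ^- (2 * n * misize m) *
    \prod_(l < n | (0 < l)%N) cq ^+ (2 * tails m l).

Definition cov_symbol (T : FUn -> FUn) : dist :=
  xget 0 [set s : dist | forall f, Dfin f ->
    pairing s f = Trq (T \o toeplitz f)].

Definition berezin (f : FUn) : dist := cov_symbol (toeplitz f).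

End Toeplitz.
End QuantumBall.

(* Main.v *)
Require Import Defs.
From mathcomp Require Import all_boot all_order all_algebra.
From mathcomp Require Import finmap.
From mathcomp Require Import all_classical all_reals all_analysis.
From mathcomp Require Import complex.
From mathcomp Require Import ring zify.
From mathcomp.analysis Require Import showcase.summability.

(** Let H be the Fock space, with vacuum e_0 and basis z^m e_0.  The statement
    reduces to the invariance of two bilinear forms on finite functions: the
    pairing (f, g) -> int f g dnu_q and the trace form
    beta(g, f) = Tr_q(T_g T_f).  By definition of the covariant symbol,
    <B g, f> = beta(g, f), where <psi, f> is the integral of psi f against
    nu_q.  If moving a quantum group element xi to the other argument replaces
    it by S(xi), for both forms, then

      <B(xi g), f> = beta(xi g, f) = beta(g, S(xi) f)
                   = <B g, S(xi) f> = <xi (B g), f>,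

    and B(xi g) = xi (B g) because the pairing is nondegenerate
    ([berezin_act], [mpair_inj]).

    Only the K_j and the E_j have to be examined: both forms are hermitian,
    and (xi f)^* = S(xi)^* f^* exchanges E_j and F_j up to scalars
    ([form_invariance]).  The K_j act on monomials by scalars.  For the E_j
    the starting point is an integration by parts on weighted traces of
    operators on H, [wtrace_aE]: the trace of E_j f is a multiple of the trace
    of f z_j, and the multiple vanishes exactly for the weight of nu_q.  This
    is the invariance of nu_q, hence that of the pairing
    ([wtrace_form_invariance]).

    For the trace form, the matrix entries of T_f in the monomial basis are,
    up to the squared norms N(k) of the monomials z^k, the numbers
    int z^{*m} f z^k dm_{alpha,q} ([tcoef], [toeplitzP]).  The Leibniz rule
    and the integration by parts, now with the weight of dm_{alpha,q}, express
    the coefficients of E_j f through shifted coefficients of f ([tcoef_aE]).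
    Moving the shifts from one factor of the trace to the other costs a ratio
    N(k + e_j - e_{j+1}) / N(k) and a ratio of weights of Tr_q, and these are
    exactly the ratios between the structure constants of the action
    ([Nx_rec], [wx_xnu_up], [tform_aE]).

    The closed formula N(k) = const * prod_i (q^2;q^2)_{k_i} / (x;q^2)_{n+|k|},
    x = q^(2 alpha + 2), is the one place where infinite sums occur
    ([norm_sum], [int_m_norm]); the sum factorizes into one-dimensional
    q-binomial series ([cvg_series1]).

    The algebra is given by generators and relations and its elements are
    handled through their matrices on H: [rho] is this representation, [ent]
    are its matrix entries.  A distribution is then an arbitrary matrix
    ([mat], [mat_expansion]), so that extension by continuity means
    extending formulas in which every entry of the result involves finitely
    many entries of the argument ([extend_local]). *)

Set Implicit Arguments.
Unset Strict Implicit.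
Unset Printing Implicit Defensive.

Import Order.TTheory GRing.Theory Num.Theory.
Import numFieldNormedType.Exports.

Local Open Scope classical_set_scope.
Local Open Scope ring_scope.

(** * Sums with finite support and linear spans *)

Lemma fsumE (V : nmodType) (I : choiceType) (r : seq I) (F : I -> V) :
  uniq r -> (forall i, i \notin r -> F i = 0) ->
  \sum_(i \in [set: I]) F i = \sum_(i <- r) F i.
Proof.
move=> ur F0; rewrite (fsbigE r)// => [|i _ /F0]//.
by apply: eq_bigl => i; rewrite in_setT.
Qed.

(** Change of variables along a bijection between two sub-domains P and Q, of
    which h and h' are total extensions; it reindexes sums by shifts of
    multi-indices, which are bijective only where no truncated subtraction
    occurs. *)
Lemma fsum_reindex (V : nmodType) (I : choiceType) (P Q : pred I) (h h' : I -> I)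
    (F : I -> V) :
  (forall x, P x -> Q (h x) /\ h' (h x) = x) ->
  (forall y, Q y -> P (h' y) /\ h (h' y) = y) ->
  (forall y, ~~ Q y -> F y = 0) ->
  \sum_(y \in [set: I]) F y = \sum_(x \in [set: I]) (if P x then F (h x) else 0).
Proof.
move=> PQ QP F0.
transitivity (\sum_(y \in [set` Q]) F y).
  symmetry; apply: fsbig_widen => // y [_ /= /negP Qy]; exact: F0.
transitivity (\sum_(x \in [set` P]) F (h x)).
  apply: reindex_fsbig; split.
  - by move=> x /PQ[].
  - move=> x y; rewrite !inE => Px Py hxy.
    by rewrite -(PQ _ Px).2 hxy (PQ _ Py).2.
  - by move=> y /QP[Py hy]; exists (h' y).
rewrite fsbig_mkcond; apply: eq_fsbigr => x _; rewrite /patch.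
by rewrite mem_setE.
Qed.

Section Span.
Context (K : nzRingType) (M : lmodType K) (I : choiceType) (b : I -> M).

Definition lspan (x : M) := exists s : seq (K * I), x = \sum_(p <- s) p.1 *: b p.2.

Lemma lspan_gen i : lspan (b i).
Proof. by exists [:: (1, i)]; rewrite big_seq1 /= scale1r. Qed.

Lemma lspan0 : lspan 0.
Proof. by exists [::]; rewrite big_nil. Qed.

Lemma lspanD x y : lspan x -> lspan y -> lspan (x + y).
Proof. by move=> [s ->] [t ->]; exists (s ++ t); rewrite big_cat. Qed.

Lemma lspanZ c x : lspan x -> lspan (c *: x).
Proof.
move=> [s ->]; exists [seq (c * p.1, p.2) | p <- s].
by rewrite big_map scaler_sumr; apply: eq_bigr => p _; rewrite /= scalerA.
Qed.

Lemma lspan_sum (J : Type) (r : seq J) (P : pred J) (F : J -> M) :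
  (forall j, P j -> lspan (F j)) -> lspan (\sum_(j <- r | P j) F j).
Proof. by move=> H; elim/big_ind: _ => //; [exact: lspan0|exact: lspanD]. Qed.

Lemma lspan_ind (P : M -> Prop) :
  P 0 -> (forall c i x, P x -> P (c *: b i + x)) -> forall x, lspan x -> P x.
Proof.
move=> P0 PS x [s ->]; elim: s => [|p s IH]; first by rewrite big_nil.
by rewrite big_cons; exact: PS.
Qed.

Section Dual.
Context (co : M -> I -> K).
Hypothesis co_lin : forall c x y i, co (c *: x + y) i = c * co x i + co y i.
Hypothesis co_b : forall i j, co (b i) j = (j == i)%:R.

(** A single family of functionals, dual to b, serves both to prove that b is
    linearly independent and to compute coordinates. *)
Lemma lspanE x : lspan x ->
  exists r : seq I, [/\ uniq r, forall i, i \notin r -> co x i = 0 &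
    x = \sum_(i <- r) co x i *: b i].
Proof.
elim/lspan_ind => [|c j {}x [r [ur r0 xE]]].
  have co0 i : co 0 i = 0.
    by have := co_lin (-1) 0 0 i; rewrite scaler0 addr0 mulN1r addNr.
  by exists [::]; split => //; rewrite big_nil.
set s := undup (j :: r).
have us : uniq s by exact: undup_uniq.
have sE i : (i \in s) = (i == j) || (i \in r) by rewrite mem_undup inE.
exists s; split => //.
  move=> i; rewrite sE negb_or => /andP[ij ir].
  by rewrite co_lin co_b (negbTE ij) mulr0 add0r r0.
under eq_bigr do rewrite co_lin scalerDl.
rewrite big_split /=; congr (_ + _).
  rewrite (bigD1_seq j) ?sE ?eqxx//= co_b eqxx mulr1.
  by rewrite big1 ?addr0// => i ij; rewrite co_b (negbTE ij) mulr0 scale0r.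
rewrite {1}xE -(fsumE ur) => [|i /r0 ->]; last by rewrite scale0r.
by rewrite -(fsumE us)// => i; rewrite sE negb_or => /andP[_ /r0 ->]; rewrite scale0r.
Qed.

Lemma lspan_eq x y : lspan x -> lspan y -> co x =1 co y -> x = y.
Proof.
move=> /lspanE[r [ur r0 xE]] /lspanE[s [us s0 yE]] xy; rewrite xE yE.
rewrite -(fsumE ur) => [|i /r0 ->]; last by rewrite scale0r.
rewrite -(fsumE us) => [|i /s0 ->]; last by rewrite scale0r.
by apply: eq_fsbigr => i _; rewrite xy.
Qed.

End Dual.
End Span.

(** * Multi-indices *)

Section MultiIndex.
Context (n : nat).
Local Notation mi := (mi n).
Implicit Types (m p : mi) (i j : 'I_n).

Definition inc i m : mi := [ffun l => (m l + (l == i))%N].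
Definition dec i m : mi := [ffun l => (m l - (l == i))%N].
Definition addm m p : mi := [ffun l => (m l + p l)%N].
Definition subm m p : mi := [ffun l => (m l - p l)%N].
Definition lemi m p : bool := [forall l, (m l <= p l)%N].

(** The bound t ranges over nat rather than 'I_n, so that t = l.+1 makes
    sense for every index l. *)
Definition tailsum (t : nat) m : nat := (\sum_(l < n | t <= l) m l)%N.

Lemma lemiP m p : reflect (forall l, (m l <= p l)%N) (lemi m p).
Proof. exact: forallP. Qed.

Lemma incC i j m : inc i (inc j m) = inc j (inc i m).
Proof. by apply/ffunP => l; rewrite !ffunE addnAC. Qed.

Lemma decC i j m : dec i (dec j m) = dec j (dec i m).
Proof. by apply/ffunP => l; rewrite !ffunE subnAC. Qed.

Lemma incK i : cancel (inc i) (dec i).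
Proof. by move=> m; apply/ffunP => l; rewrite !ffunE addnK. Qed.

Lemma decK i m : (0 < m i)%N -> inc i (dec i m) = m.
Proof.
move=> mi; apply/ffunP => l; rewrite !ffunE.
by case: eqP => [->|_]; rewrite ?subn0 ?addn0// subnK.
Qed.

Lemma dec_inc i j m : i != j -> dec i (inc j m) = inc j (dec i m).
Proof.
move=> ij; apply/ffunP => l; rewrite !ffunE.
case: (eqVneq l i) => [->|_]; last by rewrite !subn0.
by rewrite (negbTE ij) !addn0.
Qed.

Lemma addm0 m : addm m (mi0 n) = m.
Proof. by apply/ffunP => l; rewrite !ffunE addn0. Qed.

Lemma addmC m p : addm m p = addm p m.
Proof. by apply/ffunP => l; rewrite !ffunE addnC. Qed.

Lemma add_inc i m p : addm (inc i m) p = inc i (addm m p).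
Proof. by apply/ffunP => l; rewrite !ffunE addnAC. Qed.

Lemma submK m p : lemi p m -> addm p (subm m p) = m.
Proof. by move=> /lemiP pm; apply/ffunP => l; rewrite !ffunE subnKC. Qed.

Lemma addmK m p : subm (addm m p) m = p.
Proof. by apply/ffunP => l; rewrite !ffunE addKn. Qed.

Lemma lem_addm m p : lemi m (addm m p).
Proof. by apply/lemiP => l; rewrite !ffunE leq_addr. Qed.

Lemma tailsum_addm t m p : tailsum t (addm m p) = (tailsum t m + tailsum t p)%N.
Proof. by rewrite /tailsum -big_split /=; apply: eq_bigr => l _; rewrite ffunE. Qed.

Lemma tailsum_inc t i m : tailsum t (inc i m) = (tailsum t m + (t <= i))%N.
Proof.
rewrite /tailsum; under eq_bigr do rewrite ffunE.
rewrite big_split /=; congr addn.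
case: (leqP t i) => ti; last first.
  rewrite big1// => l tl'; case: eqP => // li; move: tl'.
  by rewrite li leqNgt ti.
rewrite (bigD1 i)//= eqxx big1// => l /andP[_ li].
by rewrite (negbTE li).
Qed.

Lemma tailsumS i m : tailsum i m = (m i + tailsum i.+1 m)%N.
Proof.
rewrite /tailsum (bigD1 i)//=; congr addn; apply: eq_bigl => l.
by rewrite ltn_neqAle eq_sym andbC.
Qed.

Lemma tailsum_ge t m : (n <= t)%N -> tailsum t m = 0%N.
Proof.
move=> nt; rewrite /tailsum big_pred0// => l.
by apply/negbTE; rewrite -ltnNge (leq_trans (ltn_ord l)).
Qed.

Lemma tailsE i m : tails m i = tailsum i m. Proof. by rewrite ffunE. Qed.

Lemma tailsum0 t : tailsum t (mi0 n) = 0%N.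
Proof. by rewrite /tailsum big1// => l _; rewrite ffunE. Qed.

Lemma tailsum_eq0 (i : nat) m : (forall l : 'I_n, (i <= l)%N -> m l = 0%N) -> tailsum i m = 0%N.
Proof. by move=> H; rewrite /tailsum big1. Qed.

Lemma misize_tailsum m : misize m = tailsum 0 m.
Proof. by []. Qed.

(** As z^m = z_n^{m_n} ... z_1^{m_1}, multiplying z^m on the left by z_j merely
    increments m_j when m vanishes above j.  Every z^m arises from 1 in this way,
    the generators being used by increasing index; formulas for monomials are
    proved by this induction. *)
Lemma mi_ind (P : mi -> Prop) :
  P (mi0 n) ->
  (forall j m, (forall l : 'I_n, (j < l)%N -> m l = 0%N) -> P m -> P (inc j m)) ->
  forall m, P m.
Proof.
move=> P0 PS m; have [s] := ubnP (misize m); elim: s m => // s IH m ms.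
have [->//|m0] := eqVneq m (mi0 n).
have [i mi] : exists i, (0 < m i)%N.
  apply/existsP; apply: contraR m0; rewrite negb_exists => /forallP H.
  by apply/eqP/ffunP => i; rewrite ffunE; apply/eqP; move: (H i); rewrite -eqn0Ngt.
case: (@arg_maxnP _ i (fun i => (0 < m i)%N) (fun i => i : nat) mi) => j mj jmax.
have jmax' (l : 'I_n) : (j < l)%N -> m l = 0%N.
  by move=> jl; apply/eqP; rewrite eqn0Ngt; apply: contraL jl => /jmax; rewrite -leqNgt.
rewrite -(decK mj); apply: PS => [l jl|].
  by rewrite !ffunE jmax'.
apply: IH; rewrite ltnS in ms; apply: leq_trans ms.
rewrite /misize (bigD1 j)//= [X in (_ < X)%N](bigD1 j)//= !ffunE eqxx.
rewrite -addSn; apply: leq_add; first by rewrite subn1 prednK.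
by apply: leq_sum => l lj; rewrite ffunE (negbTE lj) subn0.
Qed.

(** In H the element y_{k+1} multiplies z^m e_0 by q^(2 tailsum k.+1 m), and
    z_k z_k^* is y_{k+1} - y_k.  For x = q^2 this is the sum of the z_k z_k^* for
    k >= t. *)
Lemma telescope_tailsum (K : comNzRingType) (x : K) (t : nat) m :
  \sum_(k < n | (t <= k)%N) x ^+ tailsum k.+1 m * (1 - x ^+ m k) = 1 - x ^+ tailsum t m.
Proof.
have -> : \sum_(k < n | (t <= k)%N) x ^+ tailsum k.+1 m * (1 - x ^+ m k) =
    \sum_(k < n | (t <= k)%N) (x ^+ tailsum k.+1 m - x ^+ tailsum k m).
  by apply: eq_bigr => k _; rewrite tailsumS exprD; ring.
have [tn|nt] := leqP t n; last first.
  rewrite tailsum_ge ?(ltnW nt)// expr0 subrr big_pred0// => k.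
  by apply/negbTE; rewrite -ltnNge (ltn_trans (ltn_ord k)).
rewrite -(big_mkord (fun k => (t <= k)%N) (fun k => x ^+ tailsum k.+1 m - x ^+ tailsum k m)).
rewrite -(big_nat_widenl t 0 n xpredT)//= telescope_sumr ?(ltnW tn)//.
by rewrite tailsum_ge// expr0.
Qed.

Definition box (N : nat) : seq mi :=
  undup [seq [ffun x => nat_of_ord (h x)] | h : {ffun 'I_n -> 'I_N.+1}].

Lemma mem_box N m : (m \in box N) = [forall x, (m x <= N)%N].
Proof.
rewrite mem_undup; apply/mapP/forallP => [[h _ ->] x|mN].
  by rewrite ffunE -ltnS.
exists [ffun x => Ordinal (mN x : m x < N.+1)%N]; first by rewrite mem_enum.
by apply/ffunP => x; rewrite !ffunE.
Qed.

Lemma uniq_box N : uniq (box N). Proof. exact: undup_uniq. Qed.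

End MultiIndex.

(** * The Fock representation *)

(** Powers with symbolic exponents are treated as indeterminates. *)
Ltac gring := repeat match goal with |- context [@GRing.exp ?T ?x ?k] =>
  generalize (@GRing.exp T x k); intro end;
  try match goal with |- context [@cq ?R ?q] => generalize (@cq R q); intro end; ring.

Section Algebra.
Context (R : realType) (n : nat) (q : R).
Local Notation C := (R[i])%C.
Local Notation Q := (cq q).
Local Notation mi := (mi n).
Local Notation A := (FUn n q).
Local Notation z := (z q).
Local Notation zs := (zs q).
Local Notation f0 := (f0 n q).
Local Notation zmon := (zmon q).
Local Notation zsmon := (zsmon q).
Local Notation H := (Hbasis q).

Lemma FsAl (c : C) (x y : A) : c *: (x * y) = (c *: x) * y.
Proof. exact: pres_scalerAl. Qed.

Lemma FsAr (c : C) (x y : A) : c *: (x * y) = x * (c *: y).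
Proof. exact: pres_scalerAr. Qed.

Lemma FUn_ind (P : A -> Prop) :
  (forall i, P (z i)) -> (forall i, P (zs i)) -> P f0 -> P 1 ->
  (forall c x, P x -> P (c *: x)) -> (forall x y, P x -> P y -> P (x + y)) ->
  (forall x y, P x -> P y -> P (x * y)) -> forall x, P x.
Proof.
move=> Pz Pzs Pf P1 Pc PD PM; elim/presAlg_ind; elim => [[i|i|]|c|a Pa b Pb|a Pa b Pb].
- exact: Pz.
- exact: Pzs.
- exact: Pf.
- by rewrite pi_cst; exact: Pc.
- by rewrite piD; exact: PD.
- by rewrite piM; exact: PM.
Qed.

Lemma zz (i j : 'I_n) : (i < j)%N -> z i * z j = Q *: (z j * z i).
Proof. by move=> ij; rewrite /Defs.z -!piM -piZ; apply/pi_cong/cong_rel/Frel_zz. Qed.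

Lemma zsz (i j : 'I_n) : i != j -> zs i * z j = Q *: (z j * zs i).
Proof.
by move=> ij; rewrite /Defs.z /Defs.zs -!piM -piZ; apply/pi_cong/cong_rel/Frel_zsz.
Qed.

Lemma zsz_diag j : zs j * z j = Q ^+ 2 *: (z j * zs j) +
  (1 - Q ^+ 2) *: (1 - \sum_(k < n | (j < k)%N) z k * zs k).
Proof.
rewrite /Defs.z /Defs.zs -!piM (pi_cong (cong_rel (Frel_diag q j))) piD !piZ piD.
rewrite piM pi1 piZ scaleN1r; congr (_ + _ *: (_ - _)).
rewrite (big_morph (cls (@Frel R n q)) (@piD _ _ _) (@pi0 _ _ _)).
by apply: eq_bigr => k _; rewrite piM.
Qed.

Lemma f0f0 : f0 * f0 = f0.
Proof. by rewrite /Defs.f0 -piM; apply/pi_cong/cong_rel/Frel_ff. Qed.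

Lemma zsf0 i : zs i * f0 = 0.
Proof. by rewrite /Defs.f0 /Defs.zs -piM; apply/pi_cong/cong_rel/Frel_zsf. Qed.

Lemma f0z i : f0 * z i = 0.
Proof. by rewrite /Defs.f0 /Defs.z -piM; apply/pi_cong/cong_rel/Frel_fz. Qed.

Local Notation V := (mi -> C).

(** The operators z_i, z_i^* and f_0 on H, in coordinates: v m is the
    coefficient of z^m e_0 in v.  They act on all functions v, finitely supported
    or not. *)
Definition fock_z (i : 'I_n) (v : V) : V := fun m =>
  if (0 < m i)%N then Q ^+ tailsum i.+1 m * v (dec i m) else 0.
Definition fock_zs (i : 'I_n) (v : V) : V := fun m =>
  Q ^+ tailsum i.+1 m * (1 - Q ^+ 2 ^+ (m i).+1) * v (inc i m).
Definition fock_f0 (v : V) : V := fun m => (m == mi0 n)%:R * v (mi0 n).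

Fixpoint fock (t : ncpoly C (Fgen n)) (v : V) : V :=
  match t with
  | TGen (FZ i) => fock_z i v
  | TGen (FZs i) => fock_zs i v
  | TGen Ff0 => fock_f0 v
  | TCst c => fun m => c * v m
  | TAdd a b => fun m => fock a v m + fock b v m
  | TMul a b => fock a (fock b v)
  end.

Lemma fock_lin t (c : C) v w :
  fock t (fun m => c * v m + w m) = fun m => c * fock t v m + fock t w m.
Proof.
elim: t v w => [[i|i|]|d|a Ha b Hb|a Ha b Hb] v w; apply/funext => m /=.
- by rewrite /fock_z; case: ifP => _; ring.
- by rewrite /fock_zs; ring.
- by rewrite /fock_f0; ring.
- by ring.
- by rewrite Ha Hb; ring.
- by rewrite Hb Ha.
Qed.

Lemma fock0 t : fock t (fun=> 0) = fun=> 0.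
Proof.
have := fock_lin t (-1) (fun=> 0) (fun=> 0).
have -> : (fun m : mi => -1 * 0 + 0 : C) = fun=> 0.
  by apply/funext => m; rewrite mulr0 addr0.
move=> ->.
by apply/funext => m; ring.
Qed.

Lemma fockZ t (c : C) v : fock t (fun m => c * v m) = fun m => c * fock t v m.
Proof.
have := fock_lin t c v (fun=> 0); rewrite fock0.
have -> : (fun m : mi => c * v m + 0) = fun m => c * v m.
  by apply/funext => m; rewrite addr0.
by move=> ->; apply/funext => m; rewrite addr0.
Qed.

Lemma fockD t v w : fock t (fun m => v m + w m) = fun m => fock t v m + fock t w m.
Proof.
have := fock_lin t 1 v w.
have -> : (fun m : mi => 1 * v m + w m) = fun m => v m + w m.
  by apply/funext => m; rewrite mul1r.
by move=> ->; apply/funext => m; rewrite mul1r.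
Qed.

Lemma tailsum_dec t (i : 'I_n) (m : mi) : (0 < m i)%N -> tailsum t m = (tailsum t (dec i m) + (t <= i))%N.
Proof. by move=> mi0; rewrite -{1}(decK mi0) tailsum_inc. Qed.

Lemma tailsum_dec_id (i : 'I_n) (m : mi) : (0 < m i)%N -> tailsum i.+1 (dec i m) = tailsum i.+1 m.
Proof. by move=> mi0; rewrite (tailsum_dec _ mi0) ltnn addn0. Qed.

Lemma fock_sum (r : seq 'I_n) (P : pred 'I_n) (F : 'I_n -> ncpoly C (Fgen n)) v m :
  fock (\big[@TAdd _ _/TCst 0]_(k <- r | P k) F k) v m =
  \sum_(k <- r | P k) fock (F k) v m.
Proof.
elim: r => [|k r IH]; first by rewrite !big_nil /= mul0r.
by rewrite !big_cons; case: (P k); rewrite //= IH.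
Qed.

(** The only relation that is not a comparison of powers of q is that of z_j^*
    with z_j: the sum of the z_k z_k^*, k > j, telescopes to 1 - y_{j+1}. *)
Lemma fock_rel a b : Frel q a b -> fock a = fock b.
Proof.
move=> ab; apply/funext => v; apply/funext => m; case: ab => {a b}.
- move=> i j ij /=; rewrite /fock_z.
  have ji : (j == i) = false by apply/eqP => e; move: ij; rewrite e ltnn.
  have ij' : (i == j) = false by rewrite eq_sym.
  rewrite !ffunE ji ij' !subn0; case: ifP => mi; case: ifP => mj; rewrite ?mulr0//.
  rewrite decC (tailsum_dec _ mj) (tailsum_dec j.+1 mi) ij (ltnNge j i) (ltnW ij) /=.
  by rewrite /= addn0 exprD expr1; gring.
- move=> i j ij /=; rewrite /fock_zs.
  have ji : (j == i) = false by apply/eqP => e; move: ij; rewrite e ltnn.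
  have ij' : (i == j) = false by rewrite eq_sym.
  rewrite !ffunE ji ij' !addn0 incC !tailsum_inc ij (ltnNge j i) (ltnW ij) /=.
  by rewrite /= addn0 exprD expr1; gring.
- move=> i j ij /=; rewrite /fock_zs /fock_z !ffunE eq_sym (negbTE ij) addn0.
  rewrite subn0 tailsum_inc; case: ifP => mj; last by rewrite !mulr0.
  rewrite (tailsum_dec i.+1 mj) dec_inc 1?eq_sym//.
  case: (ltngtP i j) => [ij'|ji|/val_inj ij']; last by rewrite ij' eqxx in ij.
    by rewrite /= addn0 exprD expr1; gring.
  by rewrite /= addn0 exprD expr1; gring.
- move=> j /=; rewrite /fock_zs /fock_z !ffunE eqxx addn1 /= incK tailsum_inc ltnn addn0.
  have sq k : (Q ^+ 2) ^+ k = Q ^+ k * Q ^+ k by rewrite exprAC expr2.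
  have tj : \sum_(k < n | (j < k)%N) Q ^+ 2 ^+ tailsum k.+1 m * (1 - Q ^+ 2 ^+ m k) =
    1 - Q ^+ 2 ^+ tailsum j.+1 m := telescope_tailsum (Q ^+ 2) j.+1 m.
  rewrite fock_sum /=.
  have -> : \sum_(k < n | (j < k)%N) fock_z k (fock_zs k v) m = (1 - Q ^+ 2 ^+ tailsum j.+1 m) * v m.
    rewrite -tj mulr_suml; apply: eq_bigr => k _; rewrite /fock_z /fock_zs.
    case: (posnP (m k)) => [->|mk]; first by rewrite expr0 subrr mulr0 mul0r.
    by rewrite decK// ffunE eqxx subn1 prednK// tailsum_dec_id// (sq (tailsum k.+1 m)) /=; gring.
  case: (posnP (m j)) => [->|mj].
    by rewrite [in LHS]expr1 (sq (tailsum j.+1 m)); gring.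
  by rewrite decK// subn1 prednK// tailsum_dec_id// (sq (tailsum j.+1 m)) exprS; gring.
- by rewrite /= /fock_f0 eqxx mul1r.
- move=> i /=; rewrite /fock_zs /fock_f0 mul0r.
  have -> : (inc i m == mi0 n) = false.
    by apply/eqP => /ffunP/(_ i); rewrite !ffunE eqxx addn1.
  by rewrite mul0r mulr0.
- by move=> i /=; rewrite /fock_f0 /fock_z ffunE mulr0 mul0r.
Qed.

Lemma fock_cong a b : cong (@Frel R n q) a b -> fock a = fock b.
Proof.
elim=> {a b} /=.
- exact: fock_rel.
- by [].
- by move=> a b _ ->.
- by move=> a b c _ -> _ ->.
- by move=> a a' b b' _ -> _ ->.
- by move=> a a' b b' _ -> _ ->.
- by move=> a b c; apply/funext => v; apply/funext => m; rewrite addrA.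
- by move=> a b; apply/funext => v; apply/funext => m; rewrite addrC.
- by move=> a; apply/funext => v; apply/funext => m; rewrite mul0r add0r.
- by move=> a; apply/funext => v; apply/funext => m; rewrite mul0r mulN1r addNr.
- by [].
- by move=> a; apply/funext => v; apply/funext => m; rewrite mul1r.
- by [].
- by move=> a b c; apply/funext => v; rewrite fockD.
- by move=> x y; apply/funext => v; apply/funext => m; rewrite mulrDl.
- by move=> x y; apply/funext => v; apply/funext => m; rewrite mulrA.
- by move=> x a; apply/funext => v; rewrite fockZ.
Qed.

Definition rho (f : A) : V -> V := fock (rep f).

Lemma rho_cls t : rho (cls (@Frel R n q) t) = fock t.
Proof. by apply: fock_cong; exact: rep_cong. Qed.

Lemma rhoM f g v : rho (f * g) v = rho f (rho g v).
Proof. by elim/presAlg_ind: f => a; elim/presAlg_ind: g => b; rewrite -piM !rho_cls. Qed.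

Lemma rhoD f g v m : rho (f + g) v m = rho f v m + rho g v m.
Proof. by elim/presAlg_ind: f => a; elim/presAlg_ind: g => b; rewrite -piD !rho_cls. Qed.

Lemma rho_scale c f v m : rho (c *: f) v m = c * rho f v m.
Proof. by elim/presAlg_ind: f => a; rewrite -piZ !rho_cls. Qed.

Lemma rho1 v : rho 1 v = v.
Proof. by apply/funext => m; rewrite -pi1 rho_cls /= mul1r. Qed.

Lemma rho0 v m : rho 0 v m = 0.
Proof. by rewrite -pi0 rho_cls /= mul0r. Qed.

Lemma rhoZ f c v : rho f (fun m => c * v m) = fun m => c * rho f v m.
Proof. exact: fockZ. Qed.

Lemma rho_z i v : rho (z i) v = fock_z i v. Proof. by rewrite rho_cls. Qed.
Lemma rho_zs i v : rho (zs i) v = fock_zs i v. Proof. by rewrite rho_cls. Qed.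
Lemma rho_f0 v : rho f0 v = fock_f0 v. Proof. by rewrite rho_cls. Qed.

End Algebra.

(** * The involution and products of monomials *)

Section Star.
Context (R : realType) (n : nat) (q : R).
Local Notation C := (R[i])%C.
Local Notation Q := (cq q).
Local Notation mi := (mi n).
Local Notation A := (FUn n q).
Local Notation z := (z q).
Local Notation zs := (zs q).
Local Notation f0 := (f0 n q).
Local Notation zmon := (zmon q).
Local Notation zsmon := (zsmon q).
Local Notation H := (Hbasis q).
Implicit Types (m p k : mi) (i j l : 'I_n) (f g : A).

Lemma starM f g : star (f * g) = star g * star f.
Proof.
by elim/presAlg_ind: f => a; elim/presAlg_ind: g => b; rewrite -piM !star_cls tstarM piM.
Qed.

Lemma starD f g : star (f + g) = star f + star g.
Proof.
by elim/presAlg_ind: f => a; elim/presAlg_ind: g => b; rewrite -piD !star_cls tstarD piD.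
Qed.

Lemma starZ (c : C) f : star (c *: f) = c^* *: star f.
Proof.
elim/presAlg_ind: f => a; rewrite -piZ !star_cls tstarM tstar_cst piM pi_cst.
by rewrite -FsAr mulr1.
Qed.

Lemma starK : involutive (@star R n q).
Proof.
elim/presAlg_ind => a; rewrite !star_cls; congr cls.
elim: a => [[i|i|]|c|a Ha b Hb|a Ha b Hb] //=.
- by rewrite /tstar /= conjCK.
- by rewrite !tstarD Ha Hb.
- by rewrite !tstarM Ha Hb.
Qed.

Lemma star_z i : star (z i) = zs i. Proof. by rewrite star_cls. Qed.
Lemma star_f0 : star f0 = f0. Proof. by rewrite star_cls. Qed.

Lemma star1 : star (1 : A) = 1.
Proof. by rewrite -pi1 star_cls /tstar /= rmorph1. Qed.

Lemma starX f (k : nat) : star (f ^+ k) = star f ^+ k.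
Proof. by elim: k => [|k IH]; rewrite ?star1// exprS exprSr starM IH. Qed.

Lemma star0 : star (0 : A) = 0.
Proof. by rewrite -(scale0r (0 : A)) starZ rmorph0 !scale0r. Qed.

Lemma star_sum (J : Type) (r : seq J) (P : pred J) (F : J -> A) :
  star (\sum_(j <- r | P j) F j) = \sum_(j <- r | P j) star (F j).
Proof. by rewrite (big_morph _ starD star0). Qed.

(** Reversing the product absorbs the reversed order of indices in zmon, so
    that the adjoint of z^m is z^{*m}. *)
Lemma star_prod_rev N (F : 'I_N -> A) :
  star (\prod_(l < N) F (rev_ord l)) = \prod_(l < N) star (F l).
Proof.
elim: N F => [|N IH] F; first by rewrite !big_ord0 star1.
rewrite big_ord_recl [RHS]big_ord_recr /= starM.
have -> : rev_ord (@ord0 N) = ord_max by apply: val_inj; rewrite /= subn1.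
congr (_ * _); rewrite -(IH (fun l : 'I_N => F (widen_ord (leqnSn N) l))).
congr star; apply: eq_bigr => l _; congr F.
by apply: val_inj; rewrite /= /bump add1n subSS.
Qed.

Lemma star_zmon m : star (zmon m) = zsmon m.
Proof.
rewrite /zmon (star_prod_rev (fun l => z l ^+ m l)) /zsmon.
by apply: eq_bigr => l _; rewrite starX star_z.
Qed.

Lemma star_zsmon m : star (zsmon m) = zmon m.
Proof. by rewrite -star_zmon starK. Qed.

Lemma zmon0 : zmon (mi0 n) = 1.
Proof. by rewrite /zmon big1// => l _; rewrite ffunE. Qed.

Lemma zsmon0 : zsmon (mi0 n) = 1.
Proof. by rewrite -star_zmon zmon0 star1. Qed.

(** This gives z_j z^m = z^{m + e_j} when m vanishes above j: the factors of
    z^m that precede the power of z_j are then equal to 1. *)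
Lemma prod_absorb (S : pzSemiRingType) N (F G : 'I_N -> S) (p : 'I_N) (x : S) :
  (forall l : 'I_N, (l < p)%N -> F l = 1) -> (forall l : 'I_N, (l < p)%N -> G l = 1) ->
  (forall l : 'I_N, (p < l)%N -> F l = G l) -> G p = x * F p ->
  x * \prod_(l < N) F l = \prod_(l < N) G l.
Proof.
elim: N F G p => [|N IH] F G p; first by case: p.
move=> F1 G1 FG Gp; rewrite !big_ord_recl.
case: (unliftP ord0 p) Gp F1 G1 FG => [p'|] -> Gp F1 G1 FG.
  rewrite F1// G1// !mul1r; apply: (IH _ _ p') => // l lp.
  - by apply: F1.
  - by apply: G1.
  - by apply: FG.
by rewrite mulrA -Gp; congr (_ * _); apply: eq_bigr => l _; apply: FG.
Qed.

Lemma z_zmon_top j m : (forall l, (j < l)%N -> m l = 0%N) -> z j * zmon m = zmon (inc j m).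
Proof.
move=> mj.
have rev_gt l : (l < rev_ord j)%N -> (j < rev_ord l)%N.
  by rewrite /=; have := ltn_ord j; have := ltn_ord l; lia.
apply: (@prod_absorb _ _ _ _ (rev_ord j)).
- by move=> l lj; rewrite mj ?rev_gt.
- move=> l /rev_gt jl; rewrite ffunE mj//.
  by case: eqP jl => [->|//]; rewrite ltnn.
- move=> l jl; rewrite ffunE; case: eqP => [e|]; last by rewrite addn0.
  by move: jl; rewrite -e rev_ordK ltnn.
- by rewrite rev_ordK ffunE eqxx addn1 exprS.
Qed.

Lemma zsmon_zs_top j m : (forall l, (j < l)%N -> m l = 0%N) -> zsmon m * zs j = zsmon (inc j m).
Proof. by move=> mj; rewrite -!star_zmon -z_zmon_top// starM star_z. Qed.

(** Moving z_i to the right across the generators of larger index produces one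
    factor q for each of them. *)
Lemma z_zmon i m : z i * zmon m = Q ^+ tailsum i.+1 m *: zmon (inc i m).
Proof.
elim/mi_ind: m i => [|j m mj IH] i.
  by rewrite tailsum0 scale1r; apply: z_zmon_top => l _; rewrite ffunE.
have [ji|ij] := leqP j i.
  have top l : (i < l)%N -> inc j m l = 0%N.
    move=> il; have jl := leq_ltn_trans ji il.
    by rewrite ffunE mj//; case: eqP jl => [->|//]; rewrite ltnn.
  by rewrite tailsum_eq0 ?scale1r// z_zmon_top.
rewrite -z_zmon_top// mulrA zz// -FsAl -mulrA IH -FsAr scalerA tailsum_inc ij addn1 exprS.
rewrite z_zmon_top 1?incC// => l jl; rewrite ffunE mj//.
by case: eqP jl => [->|//]; rewrite ltnNge (ltnW ij).
Qed.

(** z_n crosses all the other generators, |m| - m_n in number.  The product arises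
    from E_n f_0, a multiple of z_n f_0, and from the boundary term of the
    integration by parts. *)
Lemma zmon_z l m : isLast l -> zmon m * z l = Q ^+ (misize m - m l) *: zmon (inc l m).
Proof.
move=> /eqP ln; elim/mi_ind: m => [|j m mj IH].
  rewrite misize_tailsum tailsum0 sub0n expr0 scale1r zmon0 mul1r -z_zmon_top ?zmon0 ?mulr1//.
  by move=> i _; rewrite ffunE.
rewrite -z_zmon_top// -mulrA IH -FsAr z_zmon scalerA incC -exprD; congr (_ ^+ _ *: _).
have ml : (m l <= tailsum 0 m)%N by rewrite -misize_tailsum /misize (bigD1 l)//= leq_addr.
rewrite !misize_tailsum !tailsum_inc (@tailsum_eq0 _ j.+1 m)// ffunE leq0n.
have jl : (j <= l)%N by have := ltn_ord j; lia.
have -> : (j < l)%N = (l != j) by rewrite ltn_neqAle jl andbT eq_sym.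
by case: (l == j) => /=; lia.
Qed.

End Star.

(** * Matrix entries, matrix units and finite functions *)

Section Fock.
Context (R : realType) (n : nat) (q : R).
Local Notation C := (R[i])%C.
Local Notation Q := (cq q).
Local Notation mi := (mi n).
Local Notation A := (FUn n q).
Local Notation z := (z q).
Local Notation zs := (zs q).
Local Notation f0 := (f0 n q).
Local Notation zmon := (zmon q).
Local Notation zsmon := (zsmon q).
Local Notation H := (Hbasis q).
Implicit Types (m p k a b : mi) (i j l : 'I_n) (f g : A).

Definition delta m : mi -> C := fun k => (k == m)%:R.

(** The coefficient of z^k e_0 in f z^m e_0. *)
Definition ent f k m : C := rho f (delta m) k.

(** The coordinates of f e_0.  As z^m and z^m f_0 both send e_0 to z^m e_0,
    these functionals are dual to both families, hence prove their independence
    and compute coordinates with respect to them. *)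
Definition co f k : C := ent f k (mi0 n).

(** The structure constants of monomials on H:
    z^k z^p e_0 = Ccoef k p z^{k+p} e_0, a power of q, and
    z^{*k} z^{k+p} e_0 = Dcoef k p z^p e_0, in which [qrise a s] is the
    q-shifted factorial (q^{2(a+1)};q^2)_s.  [N0 k] = Dcoef k 0 is the squared
    norm of z^k e_0 for the scalar product of H with e_0 of norm 1. *)
Definition cexp k p : nat := (\sum_(i < n) k i * tailsum i.+1 p)%N.
Definition qrise (a s : nat) : C := \prod_(t < s) (1 - Q ^+ 2 ^+ (a + t).+1).
Definition Ccoef k p : C := Q ^+ cexp k p.
Definition Dcoef k p : C := Q ^+ cexp k p * \prod_(i < n) qrise (p i) (k i).
Definition N0 k : C := \prod_(i < n) qrise 0 (k i).

Lemma ent_lin (c : C) f g k m : ent (c *: f + g) k m = c * ent f k m + ent g k m.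
Proof. by rewrite /ent rhoD rho_scale. Qed.

Lemma ent0 k m : ent 0 k m = 0. Proof. exact: rho0. Qed.

Lemma ent_sum (J : Type) (r : seq J) (P : pred J) (F : J -> A) k m :
  ent (\sum_(j <- r | P j) F j) k m = \sum_(j <- r | P j) ent (F j) k m.
Proof.
apply: (big_morph (fun f => ent f k m)); last exact: ent0.
by move=> f g; rewrite /ent rhoD.
Qed.

Lemma entZ (c : C) f k m : ent (c *: f) k m = c * ent f k m.
Proof. exact: rho_scale. Qed.

Lemma cexp0 p : cexp (mi0 n) p = 0%N.
Proof. by rewrite /cexp big1// => i _; rewrite ffunE. Qed.

Lemma cexp_0 k : cexp k (mi0 n) = 0%N.
Proof. by rewrite /cexp big1// => i _; rewrite tailsum0 muln0. Qed.

Lemma cexp_inc j k p : cexp (inc j k) p = (tailsum j.+1 p + cexp k p)%N.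
Proof.
rewrite /cexp; under eq_bigr do rewrite ffunE mulnDl addnC.
rewrite big_split /= (bigD1 j)//= eqxx mul1n big1 ?addn0// => i ij.
by rewrite (negbTE ij).
Qed.

Lemma Ccoef0 p : Ccoef (mi0 n) p = 1. Proof. by rewrite /Ccoef cexp0. Qed.

Lemma Dcoef0 p : Dcoef (mi0 n) p = 1.
Proof.
by rewrite /Dcoef cexp0 mul1r big1// => i _; rewrite ffunE /qrise big_ord0.
Qed.

Lemma Dcoef_0 k : Dcoef k (mi0 n) = N0 k.
Proof. by rewrite /Dcoef cexp_0 mul1r; apply: eq_bigr => i _; rewrite ffunE. Qed.

Lemma prod_inc (F : 'I_n -> nat -> C) j k (x : C) : F j (k j).+1 = x * F j (k j) ->
  \prod_(i < n) F i (inc j k i) = x * \prod_(i < n) F i (k i).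
Proof.
move=> Fx; rewrite (bigD1 j)//= [in RHS](bigD1 j)//= ffunE eqxx addn1 Fx mulrA.
by congr (_ * _); apply: eq_bigr => i ij; rewrite ffunE (negbTE ij) addn0.
Qed.

Lemma qriseS (a s : nat) : qrise a s.+1 = (1 - Q ^+ 2 ^+ (a + s).+1) * qrise a s.
Proof. by rewrite /qrise big_ord_recr mulrC. Qed.

Lemma N0_inc j k : N0 (inc j k) = (1 - Q ^+ 2 ^+ (k j).+1) * N0 k.
Proof. by apply: (@prod_inc (fun=> qrise 0)); rewrite qriseS. Qed.

Lemma rho_z_delta i p : rho (z i) (delta p) =
  fun m => Q ^+ tailsum i.+1 p * delta (inc i p) m.
Proof.
apply/funext => m; rewrite rho_z /fock_z /delta.
case: (posnP (m i)) => [m0|mi0].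
  case: eqP => [mE|_]; last by rewrite mulr0.
  by move: m0; rewrite mE ffunE eqxx addn1.
have -> : (dec i m == p) = (m == inc i p).
  by apply/eqP/eqP => [<-|->]; rewrite ?decK// incK.
by case: eqP => [->|_]; rewrite ?mulr0// tailsum_inc ltnn addn0.
Qed.

Lemma rho_zmon_delta k p : rho (zmon k) (delta p) =
  fun m => Ccoef k p * delta (addm k p) m.
Proof.
elim/mi_ind: k => [|j k kj IH].
  by rewrite zmon0 rho1 Ccoef0 addmC addm0; apply/funext => m; rewrite mul1r.
rewrite -z_zmon_top// rhoM IH rhoZ rho_z_delta; apply/funext => m.
rewrite add_inc tailsum_addm (@tailsum_eq0 _ j.+1 k)// add0n mulrA.
by rewrite /Ccoef cexp_inc exprD [_ * Q ^+ tailsum _ _]mulrC.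
Qed.

Lemma rho_zsmon k v p : rho (zsmon k) v p = Dcoef k p * v (addm k p).
Proof.
elim/mi_ind: k v => [|j k kj IH] v.
  by rewrite zsmon0 rho1 Dcoef0 addmC addm0 mul1r.
rewrite -zsmon_zs_top// rhoM IH rho_zs /fock_zs add_inc.
rewrite tailsum_addm (@tailsum_eq0 _ j.+1 k)// add0n.
rewrite /Dcoef cexp_inc exprD (@prod_inc (fun i => qrise (p i)) _ _ (1 - Q ^+ 2 ^+ (p j + k j).+1)).
  by rewrite ffunE (addnC (p j)); ring.
by rewrite qriseS.
Qed.

Lemma co_zmon k m : co (zmon k) m = delta k m.
Proof. by rewrite /co /ent rho_zmon_delta /Ccoef cexp_0 mul1r addm0. Qed.

Lemma co_H k m : co (H k) m = delta k m.
Proof.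
rewrite /co /ent rhoM rho_f0.
have -> : fock_f0 (delta (mi0 n)) = delta (mi0 n) :> (mi -> C).
  by apply/funext => p; rewrite /fock_f0 /delta eqxx mulr1.
exact: co_zmon.
Qed.

(** The operator z^a f_0 z^{*b} has a single nonzero matrix entry, N0 b in
    position (a, b): these are the matrix units of D(U_n)_q, up to scalars. *)
Definition munit a b : A := zmon a * f0 * zsmon b.

Lemma ent_munit a b k m : ent (munit a b) k m = (k == a)%:R * (m == b)%:R * N0 b.
Proof.
rewrite /ent /munit !rhoM rho_f0.
have -> : fock_f0 (rho (zsmon b) (delta m)) =
    (fun k => ((m == b)%:R * N0 b) * delta (mi0 n) k) :> (mi -> C).
  apply/funext => p; rewrite /fock_f0 rho_zsmon Dcoef_0 /delta addm0.
  by rewrite mulrC (eq_sym m b) [N0 b * _]mulrC.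
rewrite rhoZ rho_zmon_delta /Ccoef cexp_0 mul1r addm0 /delta.
by rewrite mulrC mulrA.
Qed.

Lemma star_munit a b : star (munit a b) = munit b a.
Proof. by rewrite /munit !starM star_zmon star_zsmon star_f0 mulrA. Qed.

Lemma lspan_map (I J : choiceType) (u : I -> A) (v : J -> A) (T : A -> A) :
  (forall (c : C) x y, T (c *: x + y) = c *: T x + T y) -> T 0 = 0 ->
  (forall i : I, lspan v (T (u i))) -> forall x, lspan u x -> lspan v (T x).
Proof.
move=> Tl T0 Tu; apply: lspan_ind; first by rewrite T0; exact: lspan0.
by move=> c i x IH; rewrite Tl; apply: lspanD => //; apply: lspanZ.
Qed.

Lemma lspan_mull (I J : choiceType) (u : I -> A) (v : J -> A) f :
  (forall i : I, lspan v (f * u i)) -> forall x, lspan u x -> lspan v (f * x).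
Proof.
apply: lspan_map; last exact: mulr0.
by move=> c x y; rewrite mulrDr -FsAr.
Qed.

Lemma lspan_mulr (I J : choiceType) (u : I -> A) (v : J -> A) f :
  (forall i : I, lspan v (u i * f)) -> forall x, lspan u x -> lspan v (x * f).
Proof.
apply: (@lspan_map _ _ _ _ (fun x => x * f)); last exact: mul0r.
by move=> c x y; rewrite mulrDl -FsAl.
Qed.

Lemma z_lspan_H i x : lspan H x -> lspan H (z i * x).
Proof.
apply: lspan_mull => m; rewrite /Hbasis mulrA z_zmon -FsAl; apply: lspanZ.
exact: (lspan_gen H).
Qed.

(** Moving z_i^* to the right until it meets e_0.  The induction also carries
    the vanishing for m_i = 0: when z_j^* passes z_j, it kills the terms
    z_k z_k^*, k > j, of the commutation relation. *)
Lemma zs_H i m : lspan H (zs i * H m) /\ (m i = 0%N -> zs i * H m = 0).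
Proof.
elim/mi_ind: m i => [|j m mj IH] i.
  by rewrite /Hbasis zmon0 mul1r zsf0; split=> [|//]; exact: lspan0.
have HS : H (inc j m) = z j * H m by rewrite /Hbasis mulrA z_zmon_top.
have [ij|ij] := eqVneq i j; last first.
  split=> [|]; rewrite HS mulrA zsz// -FsAl -mulrA.
    by apply: lspanZ; apply: z_lspan_H; exact: (IH i).1.
  by rewrite ffunE (negbTE ij) addn0 => /(IH i).2 ->; rewrite mulr0 scaler0.
split; last by rewrite ij ffunE eqxx addn1.
rewrite HS ij mulrA zsz_diag mulrDl -!FsAl -mulrA; apply: lspanD; apply: lspanZ.
  by apply: z_lspan_H; exact: (IH j).1.
rewrite mulrBl mul1r mulr_suml -sumrN big1 ?addr0; first exact: (lspan_gen H).
by move=> l jl; rewrite -mulrA (IH l).2 ?mj// mulr0 oppr0.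
Qed.

Lemma f0_H m : f0 * H m = (m == mi0 n)%:R *: f0.
Proof.
elim/mi_ind: m => [|j m mj _]; first by rewrite eqxx scale1r /Hbasis zmon0 mul1r f0f0.
rewrite /Hbasis -z_zmon_top// !mulrA f0z !mul0r.
have -> : (inc j m == mi0 n) = false.
  by apply/eqP => /ffunP/(_ j); rewrite !ffunE eqxx addn1.
by rewrite scale0r.
Qed.

Lemma H0 : H (mi0 n) = f0. Proof. by rewrite /Hbasis zmon0 mul1r. Qed.

(** The left ideal F(U_n)_q f_0 is no larger than H, since it is spanned by the
    z^m f_0. *)
Lemma lspan_H_mul f x : lspan H x -> lspan H (f * x).
Proof.
elim/FUn_ind: f x => [i|i|||c f IH|f g IHf IHg|f g IHf IHg] x Hx.
- exact: z_lspan_H.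
- by apply: lspan_mull Hx => m; exact: (zs_H i m).1.
- apply: lspan_mull Hx => m; rewrite f0_H -H0; apply: lspanZ; exact: (lspan_gen H).
- by rewrite mul1r.
- by rewrite -FsAl; apply: lspanZ; exact: IH.
- by rewrite mulrDl; apply: lspanD; [exact: IHf|exact: IHg].
- by rewrite -mulrA; apply: IHf; exact: IHg.
Qed.

Lemma co_lin (c : C) f g k : co (c *: f + g) k = c * co f k + co g k.
Proof. exact: ent_lin. Qed.

Lemma H_eq x y : lspan H x -> lspan H y -> co x =1 co y -> x = y.
Proof. by apply: lspan_eq => [|k m]; [exact: co_lin|rewrite co_H]. Qed.

Lemma zmon_eq x y : lspan zmon x -> lspan zmon y -> co x =1 co y -> x = y.
Proof. by apply: lspan_eq => [|k m]; [exact: co_lin|rewrite co_zmon]. Qed.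

Lemma co_mulH f m k : co (f * H m) k = ent f k m.
Proof.
rewrite /co /ent rhoM; congr (rho f _ k); apply/funext => p.
exact: co_H.
Qed.

Lemma coord_inE (u : mi -> A) : (forall k m, co (u k) m = delta k m) ->
  forall x, lspan u x -> coord_in u x = co x.
Proof.
move=> cu x ux; rewrite /coord_in.
have cu' (i j : mi) : co (u i) j = (j == i)%:R by rewrite cu.
have [r [ur r0 xE]] := @lspanE _ _ _ _ _ co_lin cu' x ux.
apply: xget_unique => [|c [cfin ->]].
  split; first by apply: (sub_finite_set _ (finite_seq r)) => m /=; apply: contra_neqP => /negP/r0.
  by rewrite {1}xE (fsumE ur)// => i /r0 ->; rewrite scale0r.
have [X cX] := (finite_seqP _).1 cfin.
have cX' (i : mi) : c i != 0 -> i \in X by move=> ci; have : [set m | c m != 0] i by []; rewrite cX.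
have urX := undup_uniq X.
rewrite (fsumE urX) => [|i]; last first.
  rewrite mem_undup => iX; have [->|c0] := eqVneq (c i) 0; first by rewrite scale0r.
  by rewrite (cX' _ c0) in iX.
apply/funext => m.
have -> : co (\sum_(i <- undup X) c i *: u i) m = \sum_(i <- undup X) c i * co (u i) m.
  by rewrite /co ent_sum; apply: eq_bigr => i _; rewrite entZ.
have [mX|mX] := boolP (m \in undup X).
  rewrite (bigD1_seq m)//= cu' eqxx mulr1 big1 ?addr0// => i im.
  by rewrite cu' eq_sym (negbTE im) mulr0.
rewrite big1_seq => [|i /= iX]; last first.
  by rewrite cu'; case: eqP iX mX => [->->|]; rewrite ?mulr0.
apply: contraNeq mX => cm; rewrite mem_undup; exact: cX'.
Qed.

(** Any product of the z_i can be reordered. *)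
Lemma holo_lspan f : holo f <-> lspan zmon f.
Proof.
split.
  have zmM i x : lspan zmon x -> lspan zmon (z i * x).
    by apply: lspan_mull => m; rewrite z_zmon; apply: lspanZ; exact: (lspan_gen zmon).
  have mM k x : lspan zmon x -> lspan zmon (zmon k * x).
    elim/mi_ind: k x => [|j k kj IH] x xs; first by rewrite zmon0 mul1r.
    by rewrite -z_zmon_top// -mulrA; apply: zmM; apply: IH.
  elim=> [|i|{}f g _ Hf _ Hg|c {}f _ Hf|{}f g _ Hf _ Hg].
  - by rewrite -zmon0; exact: (lspan_gen zmon).
  - by rewrite -[z i]mulr1; apply: zmM; rewrite -zmon0; exact: (lspan_gen zmon).
  - exact: lspanD.
  - exact: lspanZ.
  - apply: (@lspan_mulr _ _ zmon zmon g _ _ Hf) => k; exact: mM.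
have hz m : holo (zmon m).
  elim/mi_ind: m => [|j m mj IH]; first by rewrite zmon0; exact: holo1.
  by rewrite -z_zmon_top//; apply: holoM => //; exact: holo_z.
move: f; apply: lspan_ind => [|c i x Hx].
  by rewrite -(scale0r (1 : A)); apply: holoZ; exact: holo1.
by apply: holoD => //; apply: holoZ.
Qed.

Definition epair (ab : mi * mi) : A := munit ab.1 ab.2.

Lemma Dfin_munit a b : Dfin (munit a b).
Proof.
exists 1%N, (fun=> zmon a), (fun=> zsmon b); by rewrite big_ord1.
Qed.

Lemma lspan_f0l f : lspan H (f * f0).
Proof. by rewrite -H0; apply: lspan_H_mul; exact: (lspan_gen H (mi0 n)). Qed.

Lemma lspan_f0r f : lspan (fun b => f0 * zsmon b) (f0 * f).
Proof.
have -> : f0 * f = star (star f * f0) by rewrite starM starK star_f0.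
move: (_ * f0) (lspan_f0l (star f)); apply: lspan_ind; first by rewrite star0; exact: lspan0.
move=> c m x IH; rewrite starD starZ; apply: lspanD => //; apply: lspanZ.
by rewrite /Hbasis starM star_zmon star_f0; exact: (lspan_gen (fun b => f0 * zsmon b) m).
Qed.

Lemma Dfin0 : Dfin (0 : A).
Proof. by exists 0%N, (fun=> 0), (fun=> 0); rewrite big_ord0. Qed.

Lemma DfinD f g : Dfin f -> Dfin g -> Dfin (f + g).
Proof.
move=> [N [a [b ->]]] [M [c [d ->]]].
exists (N + M)%N,
  (fun x => match fintype.split x with inl y => a y | inr y => c y end),
  (fun x => match fintype.split x with inl y => b y | inr y => d y end).
rewrite big_split_ord; congr (_ + _); apply: eq_bigr => i _.
  by rewrite (unsplitK (inl i : 'I_N + 'I_M)).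
by rewrite (unsplitK (inr i : 'I_N + 'I_M)).
Qed.

Lemma Dfin_mull f g : Dfin g -> Dfin (f * g).
Proof.
move=> [N [a [b ->]]]; exists N, (fun x => f * a x), b.
by rewrite mulr_sumr; apply: eq_bigr => i _; rewrite !mulrA.
Qed.

Lemma Dfin_mulr f g : Dfin g -> Dfin (g * f).
Proof.
move=> [N [a [b ->]]]; exists N, a, (fun x => b x * f).
by rewrite mulr_suml; apply: eq_bigr => i _; rewrite !mulrA.
Qed.

Lemma DfinZ (c : C) f : Dfin f -> Dfin (c *: f).
Proof. by move=> Df; rewrite -[f]mul1r FsAl; apply: Dfin_mull. Qed.

(** f_0 is idempotent, so a f_0 b = (a f_0) (f_0 b); the left factor is in the
    span of the z^k f_0 and the right one, by taking adjoints, in that of the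
    f_0 z^{*m}. *)
Lemma Dfin_lspan f : Dfin f <-> lspan epair f.
Proof.
split=> [[N [a [b ->]]]|]; last first.
  apply: lspan_ind; first exact: Dfin0.
  by move=> c i x Dx; apply: DfinD => //; apply: DfinZ; exact: Dfin_munit.
apply: lspan_sum => i _; rewrite -mulrA.
have -> : a i * (f0 * b i) = a i * f0 * (f0 * b i) by rewrite -!mulrA [f0 * (f0 * _)]mulrA f0f0.
move: (lspan_f0r (b i)); apply: lspan_mull => m.
move: (lspan_f0l (a i)); apply: (@lspan_mulr _ _ _ _ (f0 * zsmon m)) => k.
have -> : H k * (f0 * zsmon m) = epair (k, m).
  by rewrite /Hbasis /epair /munit -!mulrA [f0 * (f0 * _)]mulrA f0f0.
exact: (lspan_gen epair).
Qed.

Lemma Dfin_ind (P : A -> Prop) :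
  P 0 -> (forall (c : C) a b f, Dfin f -> P f -> P (c *: munit a b + f)) ->
  forall f, Dfin f -> P f.
Proof.
move=> P0 PS f /Dfin_lspan Hf; suff [] : Dfin f /\ P f by [].
move: f Hf; apply: lspan_ind => [|c [a b] f [Df Pf]]; first by split=> //; exact: Dfin0.
by split; [apply: DfinD => //; apply: DfinZ; exact: Dfin_munit|exact: PS].
Qed.

End Fock.

(** * The quantum group action on monomials *)

Section Action.
Context (R : realType) (n : nat) (q : R).
Hypothesis (q_gt0 : 0 < q) (q_lt1 : q < 1).
Context (act : Uq n q -> FUn n q -> FUn n q).
Hypothesis (Hact : module_algebra act) (Hgen : module_generators act).
Local Notation C := (R[i])%C.
Local Notation Q := (cq q).
Local Notation h := (hq q).
Local Notation mi := (mi n).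
Local Notation A := (FUn n q).
Local Notation z := (z q).
Local Notation zs := (zs q).
Local Notation f0 := (f0 n q).
Local Notation zmon := (zmon q).
Local Notation zsmon := (zsmon q).
Implicit Types (m p k a b : mi) (i j l : 'I_n) (f g : A).

Lemma Q_gt0 : 0 < Q. Proof. by rewrite /cq ltcR. Qed.
Lemma Q_lt1 : Q < 1. Proof. by rewrite /cq (ltcR q 1). Qed.
Lemma Q_neq0 : Q != 0. Proof. by rewrite gt_eqF// Q_gt0. Qed.
Lemma h_gt0 : 0 < h. Proof. by rewrite /hq ltcR sqrtr_gt0. Qed.
Lemma h_neq0 : h != 0. Proof. by rewrite gt_eqF// h_gt0. Qed.

Lemma Q2_lt1 (k : nat) : (0 < k)%N -> Q ^+ 2 ^+ k < 1.
Proof.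
move=> k0; rewrite -exprM exprn_ilt1 ?Q_lt1 ?muln_eq0 -?lt0n ?k0//; exact: ltW Q_gt0.
Qed.

Lemma subQ2_neq0 (k : nat) : (0 < k)%N -> 1 - Q ^+ 2 ^+ k != 0.
Proof. by move=> k0; rewrite gt_eqF// subr_gt0 Q2_lt1. Qed.

Lemma qrise_gt0 (s t : nat) : 0 < qrise q s t.
Proof. by apply: prodr_gt0 => u _; rewrite subr_gt0 Q2_lt1. Qed.

Lemma N0_gt0 k : 0 < N0 q k.
Proof. by apply: prodr_gt0 => u _; exact: qrise_gt0. Qed.

Lemma N0_neq0 k : N0 q k != 0. Proof. by rewrite gt_eqF// N0_gt0. Qed.

Lemma Ccoef_neq0 k p : Ccoef q k p != 0. Proof. by rewrite expf_neq0// Q_neq0. Qed.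

Lemma Dcoef_neq0 k p : Dcoef q k p != 0.
Proof.
rewrite mulf_neq0 ?expf_neq0 ?Q_neq0// gt_eqF//.
by apply: prodr_gt0 => u _; exact: qrise_gt0.
Qed.

Definition aE j f := act (Ucls q (TGen (UE j))) f.
Definition aF j f := act (Ucls q (TGen (UF j))) f.
Definition aK j f := act (Ucls q (TGen (UK j))) f.
Definition aKV j f := act (Ucls q (TGen (UKV j))) f.

Lemma act_lin u (c : C) f g : act u (c *: f + g) = c *: act u f + act u g.
Proof. exact: (act_linear_r Hact). Qed.

Lemma act_lin0 u : act u 0 = 0.
Proof.
have := act_lin u (-1) 0 0; rewrite scaler0 addr0 => ->.
by rewrite scaleN1r addNr.
Qed.

Lemma actZ u (c : C) f : act u (c *: f) = c *: act u f.
Proof. by have := act_lin u c f 0; rewrite act_lin0 !addr0. Qed.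

Lemma act_cst (c : C) f : act (Ucls q (TCst c)) f = c *: f.
Proof.
rewrite /Ucls pi_cst -[X in act X _]addr0 (act_linear_l Hact) (act_1 Hact).
have := act_linear_l Hact (-1) 1 1 f; rewrite scaleN1r addNr => ->.
by rewrite (act_1 Hact) scaleN1r addNr addr0.
Qed.

Lemma act_tM s t f : act (Ucls q (TMul s t)) f = act (Ucls q s) (act (Ucls q t) f).
Proof. by rewrite /Ucls piM (act_M Hact). Qed.

Lemma act_tD s t f : act (Ucls q (TAdd s t)) f = act (Ucls q s) f + act (Ucls q t) f.
Proof.
rewrite /Ucls piD -[cls _ s](scale1r) (act_linear_l Hact) scale1r.
by rewrite scale1r.
Qed.

Lemma act_eq s t f : Urel q s t -> act (Ucls q s) f = act (Ucls q t) f.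
Proof. by move=> st; rewrite /Ucls (pi_cong (cong_rel st)). Qed.

Lemma aE_mul j f g : aE j (f * g) = aE j f * g + aK j f * aE j g.
Proof.
rewrite /aE (act_mul Hact) /= big_cons big_seq1 /=.
by rewrite act_cst scale1r.
Qed.

Lemma aF_mul j f g : aF j (f * g) = aF j f * aKV j g + f * aF j g.
Proof.
rewrite /aF (act_mul Hact) /= big_cons big_seq1 /=.
by rewrite act_cst scale1r.
Qed.

Lemma aK_mul j f g : aK j (f * g) = aK j f * aK j g.
Proof. by rewrite /aK (act_mul Hact) /= big_seq1. Qed.

Lemma aKK j : cancel (aK j) (aKV j).
Proof.
move=> f; have := act_eq f (Urel_KVK q j); rewrite act_tM act_cst scale1r.
by [].
Qed.

Lemma aKVK j : cancel (aKV j) (aK j).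
Proof. by move=> f; have := act_eq f (Urel_KKV q j); rewrite act_tM act_cst scale1r. Qed.

Lemma aKE j f : aK j (aE j f) = Q ^+ 2 *: aE j (aK j f).
Proof.
have := act_eq f (Urel_KE q j j); rewrite act_tM act_tM act_cst act_tM.
by rewrite /cartan eqxx.
Qed.

Lemma aKF j f : aK j (aF j f) = Q ^- 2 *: aF j (aK j f).
Proof.
have := act_eq f (Urel_KF q j j); rewrite act_tM act_tM act_cst act_tM.
by rewrite /cartan eqxx.
Qed.

Lemma aK1 j : aK j 1 = 1. Proof. by rewrite /aK (act_unit Hact) /= scale1r. Qed.
Lemma aE1 j : aE j 1 = 0. Proof. by rewrite /aE (act_unit Hact) /= scale0r. Qed.
Lemma aF1 j : aF j 1 = 0. Proof. by rewrite /aF (act_unit Hact) /= scale0r. Qed.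

Lemma aEZ j (c : C) f : aE j (c *: f) = c *: aE j f. Proof. exact: actZ. Qed.
Lemma aFZ j (c : C) f : aF j (c *: f) = c *: aF j f. Proof. exact: actZ. Qed.
Lemma aKZ j (c : C) f : aK j (c *: f) = c *: aK j f. Proof. exact: actZ. Qed.
Lemma aKVZ j (c : C) f : aKV j (c *: f) = c *: aKV j f. Proof. exact: actZ. Qed.

(** The sign by which the real form U_q su_{n,1} differs from the compact one. *)
Definition sg j : C := if isLast j then -1 else 1.

Lemma star_aK j f : star (aK j f) = aKV j (star f).
Proof. by rewrite /aK (act_star Hact). Qed.

Lemma star_aKV j f : star (aKV j f) = aK j (star f).
Proof. by rewrite /aKV (act_star Hact). Qed.

Lemma conjCN1 : ((-1 : C)^* = -1)%R. Proof. by rewrite rmorphN rmorph1. Qed.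

(** The rule (xi f)^* = S(xi)^* f^*, evaluated on F_j, turns F_j into a multiple
    of E_j; thus formulas for z^{*m} follow from those for z^m, and those for F_j
    from those for E_j. *)
Lemma star_aF j f : star (aF j f) = - (sg j * Q ^+ 2) *: aE j (star f).
Proof.
rewrite /aF (act_star Hact) /antipode /Ustar /= -/(Ustar _).
rewrite !act_tM act_cst conjCN1 -/(aK j _) /sg.
have KE x : aK j (aE j (aKV j x)) = Q ^+ 2 *: aE j x by rewrite aKE aKVK.
case: ifP => _; rewrite !act_tM ?act_cst ?conjCN1 -/(aK j _) -/(aE j _) -/(aKV j _).
  by rewrite aKVZ aEZ !aKZ KE !scalerA; congr (_ *: _); gring.
by rewrite aKVZ aEZ !aKZ KE !scalerA; congr (_ *: _); gring.
Qed.

Lemma star_aE j f : star (aE j f) = - (sg j * Q ^- 2) *: aF j (star f).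
Proof.
rewrite /aE (act_star Hact) /antipode /Ustar /= -/(Ustar _).
rewrite !act_tM act_cst conjCN1 /sg.
have KF x : aK j (aF j (aKV j x)) = Q ^- 2 *: aF j x by rewrite aKF aKVK.
case: ifP => _; rewrite !act_tM ?act_cst ?conjCN1 -/(aKV j _) -/(aF j _) -/(aK j _).
  by rewrite aKVZ aFZ !aKZ KF !scalerA; congr (_ *: _); ring.
by rewrite aKVZ aFZ !aKZ KF !scalerA; congr (_ *: _); ring.
Qed.

(** K_j multiplies z_i by [wt j i], hence z^m by [chi j m]. *)
Definition wt j i : C :=
  if isLast j then (if i == j then Q ^+ 2 else Q)
  else if i == j then Q else if i == j.+1 :> nat then Q^-1 else 1.
Definition chi j m : C := \prod_(i < n) wt j i ^+ m i.

Lemma chi0 j : chi j (mi0 n) = 1.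
Proof. by rewrite /chi big1// => i _; rewrite ffunE. Qed.

Lemma chi_inc j i m : chi j (inc i m) = wt j i * chi j m.
Proof. exact: (@prod_inc R n (fun i s => wt j i ^+ s) i m (wt j i) (exprS _ _)). Qed.

Lemma conj_Q : Q^* = Q. Proof. exact: conj_cq. Qed.
Lemma conj_QX (k : nat) : (Q ^+ k)^* = Q ^+ k. Proof. by rewrite rmorphXn /= conj_Q. Qed.
Lemma wt_gt0 j i : 0 < wt j i.
Proof.
rewrite /wt; case: ifP => _; case: ifP => _; rewrite ?exprn_gt0 ?Q_gt0//.
by case: ifP => _; rewrite ?invr_gt0 ?Q_gt0.
Qed.

Lemma chi_gt0 j m : 0 < chi j m.
Proof. by apply: prodr_gt0 => i _; rewrite exprn_gt0// wt_gt0. Qed.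

Lemma chi_neq0 j m : chi j m != 0. Proof. by rewrite gt_eqF// chi_gt0. Qed.

Lemma conj_chiV j m : ((chi j m)^-1)^* = (chi j m)^-1.
Proof. by apply: conj_Creal; rewrite ger0_real// invr_ge0 ltW// chi_gt0. Qed.

Lemma aK_z j i : aK j (z i) = wt j i *: z i.
Proof.
rewrite /wt; case: ifPn => jn; case: eqP => [->|/eqP ij].
- exact: (act_Knz Hgen).
- exact: (act_Knz0 Hgen).
- exact: (act_Kz Hgen).
case: eqP => [e|/eqP e]; first exact: (act_Kz1 Hgen).
by rewrite scale1r; exact: (act_Kz0 Hgen).
Qed.

Lemma aK_zmon j m : aK j (zmon m) = chi j m *: zmon m.
Proof.
elim/mi_ind: m => [|i m mi IH]; first by rewrite zmon0 aK1 chi0 scale1r.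
rewrite -z_zmon_top// aK_mul aK_z IH chi_inc -FsAl -FsAr scalerA.
by [].
Qed.

Lemma aKV_zmon j m : aKV j (zmon m) = (chi j m)^-1 *: zmon m.
Proof.
rewrite -[RHS](aKK j) aKZ aK_zmon scalerA mulVf ?chi_neq0// scale1r.
by [].
Qed.

Lemma aK_zsmon j m : aK j (zsmon m) = (chi j m)^-1 *: zsmon m.
Proof. by rewrite -star_zmon -star_aKV aKV_zmon starZ conj_chiV. Qed.

Lemma aK_f0 j : aK j f0 = f0. Proof. exact: (act_Kf0 Hgen). Qed.
Lemma wt1 j i : ~~ isLast j -> i != j -> i != j.+1 :> nat -> wt j i = 1.
Proof. by rewrite /wt => /negbTE -> /negbTE -> /negbTE ->. Qed.

(** The monomials on which E_j and F_j shift z^m: m + e_j - e_{j+1} and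
    m - e_j + e_{j+1}, where e_{j+1} is absent for the last j.  Subtraction is
    truncated; [can_up] says that the first shift does not truncate, and
    0 < m j that the second one does not. *)
Definition up j m : mi := [ffun x : 'I_n => (m x - (x == j.+1 :> nat) + (x == j))%N].
Definition dn j m : mi := [ffun x : 'I_n => (m x - (x == j) + (x == j.+1 :> nat))%N].

(** The exponent m_{j+1}, or 0 when j is the last index. *)
Definition nx j m : nat := (\sum_(x < n | x == j.+1 :> nat) m x)%N.
Definition can_up j m : bool := isLast j || (0 < nx j m)%N.
Definition qnum (r : nat) : C := (Q ^+ r - Q ^- r) / (Q - Q^-1).
Definition cE : C := - (h / (1 - Q ^+ 2)).

(** E_j z^m = Ecoef j m z^{up j m} and F_j z^m = Fcoef j m z^{dn j m}.  For j
    not last the algebra generated by z_j and z_{j+1} is the quantum plane, whose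
    coefficients are q-integers; for the last j, E_n raises the degree by
    one and F_n lowers it by one.  Both
    coefficients vanish where the shift truncates. *)
Definition Ecoef j m : C :=
  if isLast j then - h * (1 - Q ^+ 2 ^+ misize m) / (1 - Q ^+ 2)
  else h^-1 * qnum (nx j m).
Definition Fcoef j m : C :=
  if isLast j then h * Q ^- (misize m - m j) * (1 - Q ^- 2 ^+ m j) / (1 - Q ^- 2)
  else h * qnum (m j).

Lemma nxE j l m : l = j.+1 :> nat -> nx j m = m l.
Proof.
move=> lj; rewrite /nx (bigD1 l) ?lj//= big1 ?addn0// => x /andP[/eqP xj].
by rewrite -val_eqE /= xj lj eqxx.
Qed.

Lemma last_next j : isLast j -> forall x : 'I_n, (x == j.+1 :> nat) = false.
Proof. by move=> /eqP jn x; apply/eqP => e; have := ltn_ord x; rewrite e; lia. Qed.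

Lemma nlast_next j : ~~ isLast j -> exists l : 'I_n, l = j.+1 :> nat.
Proof.
move=> jn; have jn' : (j.+1 < n)%N by rewrite ltn_neqAle jn ltn_ord.
by exists (Ordinal jn').
Qed.

Lemma up_last j m : isLast j -> up j m = inc j m.
Proof. by move=> jn; apply/ffunP => x; rewrite !ffunE last_next// subn0. Qed.

Lemma dn_last j m : isLast j -> dn j m = dec j m.
Proof. by move=> jn; apply/ffunP => x; rewrite !ffunE last_next// addn0. Qed.

Lemma up_next j l m : l = j.+1 :> nat -> up j m = inc j (dec l m).
Proof. by move=> lj; apply/ffunP => x; rewrite !ffunE -[x == l]val_eqE /= lj. Qed.

Lemma dn_next j l m : l = j.+1 :> nat -> dn j m = inc l (dec j m).
Proof.
by move=> lj; apply/ffunP => x; rewrite !ffunE -[x == l]val_eqE /= lj.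
Qed.

Lemma nextF j l : l = j.+1 :> nat -> (l == j) = false.
Proof. by move=> lj; apply/eqP => e; move: lj; rewrite e; lia. Qed.

Lemma updnK j m : (0 < m j)%N -> up j (dn j m) = m.
Proof.
move=> mj; have [jn|jn] := boolP (isLast j); first by rewrite dn_last// up_last// decK.
have [l lj] := nlast_next jn.
by rewrite (up_next _ lj) (dn_next _ lj) incK decK.
Qed.

Lemma dnupK j m : can_up j m -> dn j (up j m) = m.
Proof.
have [jn _|jn] := boolP (isLast j); first by rewrite up_last// dn_last// incK.
have [l lj] := nlast_next jn.
rewrite /can_up (negbTE jn) (nxE _ lj) (up_next _ lj) (dn_next _ lj) => ml.
by rewrite incK decK.
Qed.

Lemma can_up_dn j m : can_up j (dn j m).
Proof.
rewrite /can_up; have [//|jn] := boolP (isLast j); have [l lj] := nlast_next jn.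
by rewrite (nxE _ lj) (dn_next _ lj) ffunE eqxx addn1.
Qed.

Lemma up_gt0 j m : (0 < up j m j)%N. Proof. by rewrite ffunE eqxx addn1. Qed.

Lemma qnum0 : qnum 0 = 0. Proof. by rewrite /qnum expr0 invr1 subrr mul0r. Qed.

Lemma QQ1 : Q * Q - 1 != 0.
Proof. by rewrite -oppr_eq0 opprB -expr2 -[Q ^+ 2]expr1 subQ2_neq0. Qed.

Lemma qnumS (r : nat) : qnum r.+1 = Q ^+ r + Q^-1 * qnum r.
Proof.
rewrite /qnum exprS; have := expf_neq0 r Q_neq0; move: (Q ^+ r) => X.
by move: Q_neq0 QQ1; move: Q => y y0 y1 X0; field; rewrite y0 y1 X0.
Qed.

Lemma qnumS' (r : nat) : qnum r.+1 = Q ^- r + Q * qnum r.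
Proof.
rewrite /qnum exprS; have := expf_neq0 r Q_neq0; move: (Q ^+ r) => X.
by move: Q_neq0 QQ1; move: Q => y y0 y1 X0; field; rewrite y0 y1 X0.
Qed.

Lemma Ecoef_eq0 j m : ~~ can_up j m -> Ecoef j m = 0.
Proof.
by rewrite /can_up /Ecoef negb_or -eqn0Ngt => /andP[/negbTE -> /eqP ->]; rewrite qnum0 mulr0.
Qed.

Lemma Fcoef_eq0 j m : m j = 0%N -> Fcoef j m = 0.
Proof. by rewrite /Fcoef => ->; case: ifP => _; rewrite ?expr0 ?subrr ?qnum0 ?mulr0 ?mul0r. Qed.

Lemma tailsum_last j m : isLast j -> tailsum j.+1 m = 0%N.
Proof. by move=> /eqP jn; rewrite tailsum_ge// jn. Qed.

Lemma Q21 : 1 - Q ^+ 2 != 0. Proof. by have := @subQ2_neq0 1 isT; rewrite expr1. Qed.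

Lemma le_last i j : isLast j -> (i <= j)%N.
Proof. by move=> /eqP jn; have := ltn_ord i; lia. Qed.

Lemma misize_inc i m : misize (inc i m) = (misize m).+1.
Proof. by rewrite !misize_tailsum tailsum_inc leq0n addn1. Qed.

Lemma aE_z_last j i : isLast j -> aE j (z i) = - (h *: (z j * z i)).
Proof. exact: (act_Enz Hgen). Qed.

Lemma aE_z_next j l : l = j.+1 :> nat -> aE j (z l) = h^-1 *: z j.
Proof. exact: (act_Ez Hgen). Qed.

Lemma aE_z_other j i : ~~ isLast j -> i != j.+1 :> nat -> aE j (z i) = 0.
Proof. exact: (act_Ez0 Hgen). Qed.

Lemma aF_z_last j : isLast j -> aF j (z j) = h *: (1 : A).
Proof. exact: (act_Fnz Hgen). Qed.

Lemma aF_z_next j l : l = j.+1 :> nat -> aF j (z j) = h *: z l.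
Proof. exact: (act_Fz Hgen). Qed.

Lemma aF_z_other j i : i != j -> aF j (z i) = 0.
Proof.
have [jn|jn] := boolP (isLast j); first exact: (act_Fnz0 Hgen).
exact: (act_Fz0 Hgen).
Qed.

(** Leibniz rule on z_t z^m, with m vanishing above t.  For j not last, only
    the case t = j+1 changes the coefficient, by the recursion of q-integers. *)
Lemma aE_zmon j m : aE j (zmon m) = Ecoef j m *: zmon (up j m).
Proof.
elim/mi_ind: m => [|t m mt IH].
  rewrite zmon0 aE1 /Ecoef /nx big1 => [|x _]; last by rewrite ffunE.
  by rewrite qnum0 mulr0 misize_tailsum tailsum0 expr0 subrr mulr0 mul0r; case: ifP => _; rewrite scale0r.
rewrite -z_zmon_top// aE_mul IH aK_z -FsAl -FsAr z_zmon.
have [jn|jn] := boolP (isLast j).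
  rewrite aE_z_last// !up_last// mulNr -FsAl -mulrA z_zmon_top// z_zmon (@tailsum_last j _ jn) scale1r.
  have -> : tailsum t.+1 (inc j m) = (t != j) :> nat.
    rewrite tailsum_inc (@tailsum_eq0 _ t.+1 m)// add0n ltn_neqAle le_last// andbT.
    by rewrite -val_eqE.
  rewrite incC !scalerA -scaleNr -scalerDl; congr (_ *: _).
  rewrite /Ecoef jn /wt jn misize_inc (exprS _ (misize m)).
  move: (Q ^+ 2 ^+ misize m) => X; case: eqP => _ /=; rewrite ?expr0 ?expr1;
    by move: Q21 h; move: Q => y y1 x; field.
have [l lj] := nlast_next jn.
have lj' := nextF lj.
rewrite !(up_next _ lj) /Ecoef (negbTE jn) !(nxE _ lj) ffunE.
have [e|tl'] := eqVneq t l.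
  subst t; rewrite addn1 incK (aE_z_next lj) -FsAl z_zmon.
  have tlm : tailsum j.+1 m = m l by rewrite -lj tailsumS (@tailsum_eq0 _ l.+1 m)// addn0.
  rewrite tlm.
  have wl : wt j l = Q^-1 by rewrite /wt (negbTE jn) lj' lj eqxx.
  rewrite wl !scalerA qnumS mulrDr.
  case: (posnP (m l)) => [m0|ml].
    by rewrite m0 qnum0 !(mulr0, mul0r) scale0r !addr0.
  rewrite tailsum_inc (@tailsum_eq0 _ l.+1 (dec l m)); last first.
    by move=> x lx; rewrite ffunE mt.
  have -> : (l < j)%N = false by lia.
  rewrite expr0 mulr1 incC decK// -scalerDl; congr (_ *: _).
  by rewrite mulrCA.
rewrite aE_z_other//; last first.
  by apply: contra_neqN tl'; rewrite -lj => /eqP/val_inj.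
rewrite mul0r add0r addn0.
case: (posnP (m l)) => [m0|ml].
  by rewrite m0 qnum0 !(mulr0, mul0r) !scale0r scaler0.
have lt : (l < t)%N.
  by rewrite ltnNge leq_eqVlt negb_or val_eqE tl' /=; apply: contraTN ml => /mt ->.
have tj : t != j by apply: contraTneq lt => ->; rewrite lj; lia.
rewrite wt1// ?scale1r; last by apply: contraTneq lt => ->; rewrite lj; lia.
rewrite scalerA tailsum_eq0 ?expr0 ?mulr1; last first.
  move=> x tx; rewrite !ffunE mt//.
  by have -> : (x == j) = false by apply/eqP => e; move: tx; rewrite e; lia.
by rewrite incC dec_inc// eq_sym.
Qed.

Lemma chi_last j m : isLast j -> chi j m = Q ^+ (misize m + m j).
Proof.
move=> jn; elim/mi_ind: m => [|i m mi IH].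
  by rewrite chi0 misize_tailsum tailsum0 ffunE expr0.
rewrite chi_inc IH misize_inc ffunE /wt jn eq_sym.
by case: eqP => _; rewrite -?exprS -?exprD; congr (_ ^+ _); lia.
Qed.

Lemma chi_next j l m : l = j.+1 :> nat -> chi j m = Q ^+ m j * Q ^- m l.
Proof.
move=> lj; have lj' := nextF lj.
have jn : isLast j = false.
  by apply/negbTE/negP => jn; have := last_next jn l; rewrite lj eqxx.
elim/mi_ind: m => [|i m mi IH].
  by rewrite chi0 !ffunE expr0 invr1 mulr1.
have Q0 := Q_neq0.
rewrite chi_inc IH !ffunE /wt jn !(eq_sym _ i).
case: (eqVneq i j) => [->|ij].
  rewrite (eq_sym j) lj' addn1 addn0 exprS; gring.
rewrite -lj val_eqE.
case: (eqVneq i l) => _; last by rewrite !addn0 mul1r.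
rewrite addn0 addn1 exprSr invfM; gring.
Qed.

(** As for E_j, with the roles of j and j+1 exchanged: only t = j changes the
    coefficient. *)
Lemma aF_zmon j m : aF j (zmon m) = Fcoef j m *: zmon (dn j m).
Proof.
have Q0 := Q_neq0.
elim/mi_ind: m => [|t m mt IH].
  by rewrite zmon0 aF1 Fcoef_eq0 ?ffunE ?scale0r.
rewrite -z_zmon_top// aF_mul IH aKV_zmon -FsAr -FsAr z_zmon scalerA.
have [tj|tj] := eqVneq t j; last first.
  rewrite aF_z_other// mul0r scaler0 add0r.
  case: (posnP (m j)) => [m0|mj].
    by rewrite !Fcoef_eq0 ?ffunE 1?(eq_sym j) ?(negbTE tj) ?addn0// mul0r !scale0r.
  have jt : (j < t)%N.
    by rewrite ltnNge leq_eqVlt negb_or val_eqE tj /=; apply: contraTN mj => /mt ->.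
  have jn : isLast j = false by apply/negbTE/negP => /(le_last t); lia.
  have [l lj] := nlast_next (negbT jn).
  rewrite /Fcoef jn ffunE eq_sym (negbTE tj) addn0 !(dn_next _ lj).
  rewrite tailsum_eq0 ?expr0 ?mulr1; last first.
    move=> x tx; rewrite !ffunE mt// sub0n.
    by have -> : (x == l) = false by apply/eqP => e; move: tx; rewrite e lj; lia.
  by rewrite incC dec_inc// eq_sym.
subst t; have [jn|jn] := boolP (isLast j).
  rewrite aF_z_last// !dn_last// incK (@tailsum_last j _ jn) expr0 mulr1 -FsAl mul1r.
  case: (posnP (m j)) => [m0|mj].
    rewrite (Fcoef_eq0 m0) scale0r addr0 scalerA; congr (_ *: _).
    rewrite /Fcoef jn chi_last// misize_inc ffunE eqxx m0 /= add0n addn0 subn1 /=.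
    have Q2 := Q21; have : 1 - Q ^- 2 != 0.
      by have -> : 1 - Q ^- 2 = - (1 - Q ^+ 2) / Q ^+ 2;
        [field|rewrite mulf_neq0 ?oppr_eq0 ?invr_neq0 ?expf_neq0].
    by move=> Q2'; rewrite expr1 mulfK// mulrC.
  rewrite decK// scalerA -scalerDl; congr (_ *: _).
  rewrite /Fcoef jn chi_last// misize_inc ffunE eqxx.
  have jM : (m j <= misize m)%N by rewrite /misize (bigD1 j)//= leq_addr.
  rewrite addn1 subSS (exprSr _ (m j)) exprD -(subnKC jM).
  move: (misize m - m j)%N => s; rewrite addKn exprD.
  rewrite [_ ^- 2 ^+ m j]exprVn -exprM mulnC exprM expr2.
  move: (expf_neq0 s Q0) (expf_neq0 (m j) Q0) h (Q0) QQ1; move: (Q ^+ s) (Q ^+ m j).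
  by move: Q Q0 => y _ X Y X0 Y0 x y0 y1; field; rewrite y1 y0 X0 Y0.
have [l lj] := nlast_next jn.
rewrite (aF_z_next lj) -FsAl z_zmon /Fcoef (negbTE jn) ffunE eqxx addn1.
rewrite !(dn_next _ lj) incK (@tailsum_eq0 _ l.+1 m) ?expr0 ?scale1r; last first.
  by move=> x lx; rewrite mt//; lia.
rewrite (chi_next _ lj) (mt l) ?lj// expr0 invr1 mulr1 qnumS' scalerA.
case: (posnP (m j)) => [m0|mj].
  by rewrite m0 qnum0 !(mulr0, mul0r) scale0r !addr0 mulrC.
rewrite tailsum_inc lj ltnSn (@tailsum_eq0 _ j.+1 (dec j m)); last first.
  by move=> x jx; rewrite ffunE mt.
by rewrite incC decK// -scalerDl add0n expr1; congr (_ *: _); gring.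
Qed.

Lemma conjV (x : C) : x^* = x -> (x^-1)^* = x^-1.
Proof. by move=> xr; apply: conj_Creal; rewrite realV; apply/CrealP. Qed.

Lemma conj_Fcoef j m : (Fcoef j m)^* = Fcoef j m.
Proof.
have Qr : Q \is Num.real by rewrite ger0_real// ltW// Q_gt0.
have hr : h \is Num.real by rewrite ger0_real// ltW// h_gt0.
apply: conj_Creal; rewrite /Fcoef /qnum.
by case: ifP => _; rewrite ?(rpredM, rpredB, rpredV, rpredX, rpred1).
Qed.

(** By the involution, E_j z^{*m} = Escoef j m z^{*(dn j m)}. *)
Definition Escoef j m : C := - (sg j * Q ^- 2) * Fcoef j m.

Lemma sgK j : sg j * sg j = 1.
Proof. by rewrite /sg; case: ifP => _; rewrite ?mulrNN mulr1. Qed.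

Lemma aE_star j f : aE j (star f) = - (sg j * Q ^- 2) *: star (aF j f).
Proof.
rewrite star_aF scalerA mulrNN mulrACA sgK mul1r mulVf ?expf_neq0 ?Q_neq0//.
by rewrite scale1r.
Qed.

Lemma aF_star j f : aF j (star f) = - (sg j * Q ^+ 2) *: star (aE j f).
Proof.
rewrite star_aE scalerA mulrNN mulrACA sgK mul1r mulfV ?expf_neq0 ?Q_neq0//.
by rewrite scale1r.
Qed.

Lemma aE_zsmon j m : aE j (zsmon m) = Escoef j m *: zsmon (dn j m).
Proof.
rewrite -star_zmon aE_star aF_zmon starZ conj_Fcoef star_zmon scalerA.
by [].
Qed.

Lemma aE_f0_last j : isLast j -> aE j f0 = cE *: (z j * f0).
Proof. exact: (act_Enf0 Hgen). Qed.

Lemma aE_f0 j : ~~ isLast j -> aE j f0 = 0.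
Proof. exact: (act_Ef0 Hgen). Qed.

(** On z^a f_0 the coefficient of E_n differs from the one on z^a, because
    E_n f_0 is a nonzero multiple of z_n f_0. *)
Definition Ecoef_fin j m : C := if isLast j then cE else Ecoef j m.

Lemma aK_munit j a b : aK j (munit q a b) = (chi j a / chi j b) *: munit q a b.
Proof.
by rewrite /munit !aK_mul aK_zmon aK_zsmon aK_f0 -FsAr -!FsAl scalerA mulrC.
Qed.

Lemma aE_munit j a b : aE j (munit q a b) =
  Ecoef_fin j a *: munit q (up j a) b + (chi j a * Escoef j b) *: munit q a (dn j b).
Proof.
rewrite /munit !aE_mul aE_zmon aE_zsmon aK_mul aK_f0 aK_zmon -!FsAl -!FsAr -!scalerA.
rewrite scalerA; congr (_ + _); rewrite mulrDl.
rewrite /Ecoef_fin; case: ifPn => jn; last first.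
  by rewrite aE_f0// mulr0 scaler0 mul0r addr0 -!FsAl.
rewrite aE_f0_last// -FsAr mulrA (zmon_z q a jn) -!FsAl up_last// scalerA scalerA -scalerDl.
congr (_ *: _); rewrite /Ecoef jn chi_last// /cE.
have am : (a j <= misize a)%N by rewrite /misize (bigD1 j)//= leq_addr.
have -> : Q ^+ 2 ^+ misize a = Q ^+ (misize a + a j) * Q ^+ (misize a - a j).
  by rewrite -exprM -exprD; congr (_ ^+ _); lia.
by move: (Q ^+ (_ + _)) (Q ^+ (_ - _)) h Q21; move: Q => y X Y x y1; field.
Qed.

(** * Weighted traces and integration by parts *)

Definition wy (x : C) (s : nat) : C := if s == 0%N then x else Q ^+ 2.

(** The weights of all the functionals in play: x^{|m|} q^{2(m_2+...+m_n)} ...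
    q^{2 m_n}.  The value x = q^{2 alpha + 2} gives dm_{alpha,q}, and
    x = q^{-2n} gives both nu_q and Tr_q. *)
Definition wx (x : C) m : C := \prod_(l < n) wy x l ^+ tailsum l m.

Lemma wx_inc x i m : wx x (inc i m) = x * Q ^+ 2 ^+ i * wx x m.
Proof.
rewrite /wx; under eq_bigr do rewrite tailsum_inc exprD.
rewrite big_split /= mulrC; congr (_ * _).
have -> : \prod_(l < n) wy x l ^+ (l <= i)%N = \prod_(l < n | (l < i.+1)%N) wy x l.
  rewrite [RHS]big_mkcond /=; apply: eq_bigr => l _.
  by rewrite ltnS; case: leqP; rewrite ?expr1 ?expr0.
rewrite -(big_mkord (fun s : nat => (s < i.+1)%N) (wy x)) -(big_nat_widen _ _ _ xpredT)//.
rewrite big_nat_recl//=; congr (_ * _).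
under eq_bigr do rewrite /wy /=.
by rewrite prodr_const_nat subn0.
Qed.

(** Up to normalization, the integral of a finite function with respect to
    nu_q or dm_{alpha,q}, seen as a weighted trace on H. *)
Definition wtrace (x : C) (f : A) : C := \sum_(m \in [set: mi]) ent f m m * wx x m.

Lemma Dfin_supp f : Dfin f -> exists r : seq mi, uniq r /\
  forall k m, (k \notin r) || (m \notin r) -> ent f k m = 0.
Proof.
elim/Dfin_ind => [|c a b {}f Df [r [ur r0]]].
  by exists [::]; split=> // k m _; exact: ent0.
exists (undup (a :: b :: r)); split; first exact: undup_uniq.
move=> k m; rewrite !mem_undup !inE !negb_or => km.
rewrite ent_lin ent_munit r0 ?addr0.
  case/orP: km => /and3P[k1 k2 _]; first by rewrite (negbTE k1) !mul0r mulr0.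
  by rewrite (negbTE k2) mulr0 mul0r mulr0.
by case/orP: km => /and3P[_ _ ->]; rewrite ?orbT.
Qed.

Lemma wtrace_lin x (c : C) f g : Dfin f -> Dfin g -> wtrace x (c *: f + g) = c * wtrace x f + wtrace x g.
Proof.
move=> /Dfin_supp[r [ur r0]] /Dfin_supp[s [us s0]].
set t := undup (r ++ s); have ut : uniq t := undup_uniq _.
have tr m : m \notin t -> m \notin r /\ m \notin s.
  by rewrite mem_undup mem_cat negb_or => /andP.
rewrite /wtrace !(fsumE ut).
- rewrite mulr_sumr -big_split /=; apply: eq_bigr => m _.
  by rewrite ent_lin; ring.
- by move=> m /tr[mr ms]; rewrite s0 ?ms// mul0r.
- by move=> m /tr[mr ms]; rewrite r0 ?mr// mul0r.
- by move=> m /tr[mr ms]; rewrite ent_lin r0 ?mr// s0 ?ms// mulr0 addr0 mul0r.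
Qed.

Lemma wtrace0 x : wtrace x 0 = 0.
Proof. by rewrite /wtrace fsbig1// => m _; rewrite ent0 mul0r. Qed.

Lemma wtrace_munit x a b : wtrace x (munit q a b) = (a == b)%:R * N0 q a * wx x a.
Proof.
rewrite /wtrace (@fsumE _ _ [:: a])// ?big_seq1 ?ent_munit ?eqxx ?mul1r.
  by case: eqP => [->|]; rewrite // !mul0r.
by move=> m; rewrite inE => /negbTE ma; rewrite ent_munit ma !mul0r.
Qed.

(** Linearity is required on finite functions only: [wtrace] and the forms
    below are sums over all multi-indices, equal to 0 when their support is
    infinite, hence not linear beyond D(U_n)_q. *)
Definition Dlin (phi : A -> C) :=
  forall (c : C) f g, Dfin f -> Dfin g -> phi (c *: f + g) = c * phi f + phi g.

Lemma Dlin0 phi : Dlin phi -> phi 0 = 0.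
Proof.
move=> Hp; have := Hp (-1) 0 0 (Dfin0 _ _) (Dfin0 _ _).
by rewrite scaler0 addr0 mulN1r addNr.
Qed.

Lemma Dlin_eq phi psi : Dlin phi -> Dlin psi ->
  (forall a b, phi (munit q a b) = psi (munit q a b)) -> forall f, Dfin f -> phi f = psi f.
Proof.
move=> Hp Hs He; apply: Dfin_ind; first by rewrite !Dlin0.
move=> c a b f Df IH.
by rewrite Hp ?Hs//; [rewrite He IH|exact: Dfin_munit|exact: Dfin_munit].
Qed.

Lemma Dlin_comp phi (T : A -> A) : (forall (c : C) f g, T (c *: f + g) = c *: T f + T g) ->
  (forall f, Dfin f -> Dfin (T f)) -> Dlin phi -> Dlin (phi \o T).
Proof. by move=> Tl TD Hp c f g Df Dg /=; rewrite Tl Hp//; exact: TD. Qed.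

Lemma DlinZ (d : C) phi : Dlin phi -> Dlin (fun f => d * phi f).
Proof. by move=> Hp c f g Df Dg; rewrite Hp//; ring. Qed.

Lemma Dfin_star f : Dfin f -> Dfin (star f).
Proof.
move=> [N [a [b ->]]]; exists N, (fun x => star (b x)), (fun x => star (a x)).
by rewrite star_sum; apply: eq_bigr => x _; rewrite !starM star_f0 mulrA.
Qed.

(** E_j and K_j map matrix units to combinations of matrix units, and F_j is
    conjugate to E_j under the involution. *)
Lemma Dfin_act t f : Dfin f -> Dfin (act (Ucls q t) f).
Proof.
elim: t f => [[j|j|j|j]|c|s Hs t Ht|s Hs t Ht] f Df.
- move: f Df; apply: Dfin_ind => [|c a b f _ IH]; first by rewrite act_lin0; exact: Dfin0.
  rewrite act_lin; apply: DfinD => //; apply: DfinZ; rewrite -/(aE _ _) aE_munit.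
  by apply: DfinD; apply: DfinZ; exact: Dfin_munit.
- have -> : f = star (star f) by rewrite starK.
  have Dsf := Dfin_star Df.
  rewrite -/(aF _ _) aF_star; apply: DfinZ.
  move: (star f) Dsf; apply: Dfin_ind => [|c a b {Df}f _ IH].
    by rewrite /aE act_lin0 star0; exact: Dfin0.
  rewrite /aE act_lin -/(aE _ _) starD starZ; apply: DfinD => //; apply: DfinZ.
  by rewrite aE_munit starD !starZ !star_munit; apply: DfinD; apply: DfinZ; exact: Dfin_munit.
- move: f Df; apply: Dfin_ind => [|c a b f _ IH]; first by rewrite act_lin0; exact: Dfin0.
  rewrite act_lin; apply: DfinD => //; apply: DfinZ; rewrite -/(aK _ _) aK_munit.
  by apply: DfinZ; exact: Dfin_munit.
- move: f Df; apply: Dfin_ind => [|c a b f _ IH]; first by rewrite act_lin0; exact: Dfin0.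
  rewrite act_lin; apply: DfinD => //; apply: DfinZ; rewrite -/(aKV _ _).
  rewrite -star_munit -star_aK aK_munit starZ star_munit; apply: DfinZ; exact: Dfin_munit.
- by rewrite act_cst; exact: DfinZ.
- by rewrite act_tD; apply: DfinD; [exact: Hs|exact: Ht].
- by rewrite act_tM; apply: Hs; exact: Ht.
Qed.

Lemma conj_N0 m : (N0 q m)^* = N0 q m.
Proof. by apply: conj_Creal; rewrite ger0_real// ltW// N0_gt0. Qed.

Lemma conj_wx x m : x^* = x -> (wx x m)^* = wx x m.
Proof.
move=> xr; apply: conj_Creal; rewrite /wx.
have xR : x \is Num.real by apply/CrealP.
apply: rpred_prod => i _; apply: rpredX; rewrite /wy; case: ifP => _ //.
by rewrite rpredX// ger0_real// ltW// Q_gt0.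
Qed.

Lemma wtrace_star x f : x^* = x -> Dfin f -> wtrace x (star f) = (wtrace x f)^*.
Proof.
move=> xr; rewrite -[LHS]conjCK => Df; congr (_^*).
move: f Df; apply: Dlin_eq.
- move=> c f g Df Dg; rewrite starD starZ wtrace_lin; [|exact: Dfin_star..].
  by rewrite rmorphD rmorphM /= conjCK.
- exact: wtrace_lin.
- move=> a b; rewrite star_munit !wtrace_munit !rmorphM /= conj_N0 conj_wx//.
  by rewrite (eq_sym b); case: eqP => [->|_]; rewrite ?rmorph1 ?rmorph0 ?mul0r.
Qed.

Lemma wtrace_aK x j f : Dfin f -> wtrace x (aK j f) = wtrace x f.
Proof.
move: f; apply: (@Dlin_eq (fun f => wtrace x (aK j f))); last 2 first.
- exact: wtrace_lin.
- move=> a b; rewrite aK_munit -[_ *: _]addr0 wtrace_lin ?wtrace0 ?addr0; first last.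
  + exact: Dfin0.
  + exact: Dfin_munit.
  by rewrite wtrace_munit; case: eqP => [->|_]; rewrite ?mul0r ?mulr0// divff ?chi_neq0// mul1r.
apply: (@Dlin_comp (wtrace x) (aK j)); [exact: act_lin|exact: Dfin_act|exact: wtrace_lin].
Qed.

Lemma hh : h * h = Q.
Proof. by rewrite /hq /cq -rmorphM /= -expr2 sqr_sqrtr// ltW. Qed.

(** For the last j, |m| grows by 1 together with all the tails; otherwise only
    the tail starting at j+1 changes, and it drops by 1. *)
Lemma wx_up x j m : can_up j m ->
  wx x (up j m) = (if isLast j then x * Q ^+ 2 ^+ j else Q ^- 2) * wx x m.
Proof.
rewrite /can_up; case: ifPn => [jn _|jn /=]; first by rewrite up_last// wx_inc.
have [l lj] := nlast_next jn.
rewrite (nxE _ lj) (up_next _ lj) => ml; rewrite -{2}(decK ml) !wx_inc lj (exprS _ j).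
by move: (Q ^+ 2 ^+ j) Q_neq0 (wx _ _); move: Q => Y y y0 X; field.
Qed.

Lemma chi_up j m : can_up j m -> chi j (up j m) = Q ^+ 2 * chi j m.
Proof.
rewrite /can_up; have [jn _|jn /=] := boolP (isLast j).
  by rewrite up_last// chi_inc /wt jn eqxx.
have [l lj] := nlast_next jn.
rewrite (nxE _ lj) (up_next _ lj) => ml; rewrite -{2}(decK ml) !chi_inc /wt (negbTE jn).
rewrite eqxx (nextF lj) lj eqxx.
by move: Q_neq0 (chi _ _); move: Q => y y0 X; field.
Qed.

Lemma qnumE (r : nat) : qnum r = - (1 - Q ^+ 2 ^+ r) * (Q ^- r / (Q - Q^-1)).
Proof.
rewrite /qnum exprAC; have := expf_neq0 r Q_neq0; move: (Q ^+ r) => X.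
by move: Q_neq0 QQ1; move: Q => y y0 y1 X0; field; rewrite y0 y1 X0.
Qed.

(** Raising and lowering operators are adjoint on H, up to weights: this is the
    recursion for the norms N0. *)
Lemma Ecoef_fin_N0 j m : can_up j m ->
  Ecoef_fin j m * N0 q (up j m) = - Q ^+ 2 * chi j m * Escoef j (up j m) * N0 q m.
Proof.
rewrite /can_up /Ecoef_fin /Escoef /sg; case: ifPn => [jn _|jn /=].
  rewrite up_last// N0_inc chi_last// /Fcoef jn misize_inc ffunE eqxx addn1 subSS.
  have jM : (m j <= misize m)%N by rewrite /misize (bigD1 j)//= leq_addr.
  rewrite -(subnKC jM); move: (misize m - m j)%N => s; rewrite addKn !exprD.
  rewrite [_ ^- 2 ^+ _]exprVn ![Q ^+ 2 ^+ _]exprAC !exprS.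
  have [Qs Qm] := (expf_neq0 s Q_neq0, expf_neq0 (m j) Q_neq0).
  have := Q21; rewrite /cE; move: Q_neq0 QQ1 (N0 q m) h Qs Qm.
  move: (Q ^+ s) (Q ^+ m j); move: Q => y X Y y0 y1 N x X0 Y0 y2.
  by field; rewrite y2 y1 y0 X0 Y0.
have [l lj] := nlast_next jn.
rewrite (nxE _ lj) (up_next _ lj) => ml; rewrite -(decK ml); move: (dec l m) => p.
rewrite incK /Ecoef /Fcoef (negbTE jn) (nxE _ lj) (chi_next _ lj).
rewrite !N0_inc !ffunE !eqxx [j == l]eq_sym (nextF lj) addn0 !addn1 !qnumE.
rewrite !(exprS Q (p _)).
move: (1 - Q ^+ 2 ^+ (p l).+1) (1 - Q ^+ 2 ^+ (p j).+1) => A' B'.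
have [Ql Qj] := (expf_neq0 (p l) Q_neq0, expf_neq0 (p j) Q_neq0).
move: (N0 q p) h_neq0 Q_neq0 Ql Qj hh QQ1; move: (Q ^+ p l) (Q ^+ p j) => X Y.
move: h Q => x y N x0 y0 X0 Y0 <- y1.
by field; rewrite x0 X0 Y0 y1.
Qed.

(** The factor that vanishes at x = q^{-2n}. *)
Definition stokes_coef (x : C) j : C :=
  if isLast j then cE * (x * Q ^+ 2 ^+ j - Q ^- 2) else 0.

Lemma wtrace_munit_z x j a b : wtrace x (munit q a b * z j) =
  (inc j a == b)%:R * N0 q b * wx x a * Q ^+ tailsum j.+1 a.
Proof.
have E m : ent (munit q a b * z j) m m = (m == a)%:R * (inc j a == b)%:R * N0 q b * Q ^+ tailsum j.+1 a.
  rewrite /ent rhoM rho_z_delta rhoZ -/(ent _ _ _) ent_munit.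
  by case: eqP => [->|_]; rewrite ?mul0r ?mulr0//; ring.
rewrite /wtrace (@fsumE _ _ [:: a])// ?big_seq1 ?E ?eqxx ?mul1r.
  by rewrite mulrAC.
by move=> m; rewrite inE E => /negbTE ->; rewrite !mul0r.
Qed.

(** Integration by parts.  On a matrix unit z^a f_0 z^{*b} both sides vanish
    unless b = a + e_j - e_{j+1}; then the two terms of E_j (z^a f_0 z^{*b}) contribute
    opposite multiples of N0, by [Ecoef_fin_N0], weighted by wx at up j a and at a.
    They cancel for j not last. *)
Lemma wtrace_aE x j f : Dfin f -> wtrace x (aE j f) = stokes_coef x j * wtrace x (f * z j).
Proof.
move: f; apply: (@Dlin_eq (fun f => wtrace x (aE j f)) (fun f => stokes_coef x j * wtrace x (f * z j))).
- apply: (@Dlin_comp (wtrace x) (aE j)); [exact: act_lin|exact: Dfin_act|exact: wtrace_lin].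
- apply: DlinZ; apply: (@Dlin_comp (wtrace x) (fun f => f * z j)).
  + by move=> c f g; rewrite mulrDl -FsAl.
  + by move=> f; exact: Dfin_mulr.
  + exact: wtrace_lin.
move=> a b; rewrite aE_munit wtrace_lin; [|exact: Dfin_munit|apply: DfinZ; exact: Dfin_munit].
rewrite -[X in _ + wtrace x X]addr0 wtrace_lin; [|exact: Dfin_munit|exact: Dfin0].
rewrite wtrace0 addr0 !wtrace_munit wtrace_munit_z.
case: (posnP (b j)) => [bj|bj].
  rewrite /Escoef Fcoef_eq0// !(mulr0, mul0r) addr0.
  have -> : (up j a == b) = false by apply/eqP => e; have := up_gt0 j a; rewrite e bj.
  have -> : (inc j a == b) = false.
    by apply/eqP => /ffunP/(_ j); rewrite ffunE bj eqxx addn1.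
  by rewrite !(mul0r, mulr0).
have [ab|ab] := eqVneq a (dn j b).
  have Pa : can_up j a by rewrite ab can_up_dn.
  have ub : up j a = b by rewrite ab updnK.
  rewrite ub eqxx !mul1r -ub.
  have H := Ecoef_fin_N0 Pa; rewrite mulrA H wx_up//.
  rewrite /stokes_coef; case: ifPn => jn; last first.
    move: (Escoef j _) (chi j a) (wx x a) (N0 q a) Q_neq0; move: Q => y X Y Z W y0.
    by rewrite mul0r; field.
  rewrite tailsum_last// expr0 mulr1 up_last// eqxx mul1r.
  move: H; rewrite /Ecoef_fin jn up_last//; move: (N0 q (inc j a)) (N0 q a) => N1 N2.
  move: (Escoef _ _) (chi j a) (wx x a) cE (Q ^+ 2 ^+ j) Q_neq0; move: Q => y X Y Z c W y0 H.
  have -> : c * (x * W - y ^- 2) * (N1 * Z) = (c * N1) * (x * W - y ^- 2) * Z by ring.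
  by rewrite H; field.
rewrite !mul0r mulr0 addr0.
have [Pa|Pa] := boolP (can_up j a); last first.
  have jn : isLast j = false by move: Pa; rewrite /can_up negb_or => /andP[/negbTE].
  by rewrite /Ecoef_fin jn Ecoef_eq0// mul0r /stokes_coef jn mul0r.
have -> : (up j a == b) = false.
  by apply/eqP => e; move: ab; rewrite -e dnupK ?eqxx.
rewrite !mul0r mulr0 /stokes_coef; case: ifPn => jn; last by rewrite mul0r.
have -> : (inc j a == b) = false.
  by apply/eqP => e; move: ab; rewrite -e dn_last// incK eqxx.
by rewrite !mul0r mulr0.
Qed.

(** The q-shifted factorial (x;q^2)_s. *)
Definition Dden (x : C) (s : nat) : C := \prod_(t < s) (1 - x * Q ^+ 2 ^+ t).
Lemma DdenS x (s : nat) : Dden x s.+1 = Dden x s * (1 - x * Q ^+ 2 ^+ s).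
Proof. by rewrite /Dden big_ord_recr. Qed.

(** For x = q^{2 alpha + 2} this is the squared norm of z^k in L^2(dm_{alpha,q}),
    up to a constant factor. *)
Definition Nx x k : C := N0 q k / Dden x (n + misize k).

(** The coefficient of E_n on z^k, corrected by the boundary term of the
    integration by parts: the coefficient with which E_n acts on
    Toeplitz coefficients. *)
Definition acoef (x : C) j k : C :=
  if isLast j then cE * (1 - x * Q ^+ 2 ^+ (n + misize k)) else Ecoef j k.

Lemma misize_up j m : ~~ isLast j -> can_up j m -> misize (up j m) = misize m.
Proof.
rewrite /can_up => jn; rewrite (negbTE jn) /=; have [l lj] := nlast_next jn.
rewrite (nxE _ lj) (up_next _ lj) => ml; rewrite -{2}(decK ml).
by rewrite !misize_inc.
Qed.

(** The analogue of [Ecoef_fin_N0] for the norms of L^2(dm_{alpha,q}); the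
    additional factor 1 - x q^{2(n+|m|)} of [acoef] is the ratio of the
    denominators. *)
Lemma Nx_rec x j m : (forall s, Dden x s != 0) -> can_up j m ->
  acoef x j m * Nx x (up j m) = - Q ^+ 2 * chi j m * Escoef j (up j m) * Nx x m.
Proof.
move=> Dden_neq0 Pm; rewrite /Nx /acoef; have := Ecoef_fin_N0 Pm; rewrite /Ecoef_fin.
move: (Escoef j _) => b.
case: ifPn => jn H; last by rewrite misize_up// !mulrA H.
rewrite up_last// misize_inc in H *; rewrite addnS.
have := Dden_neq0 (n + misize m).+1; rewrite DdenS.
move: (1 - x * _) (Dden _ _) (Dden_neq0 (n + misize m)%N) => u D D0'.
rewrite mulf_eq0 negb_or mulrA [RHS]mulrA -H => /andP[_ u0].
by field; rewrite D0' u0.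
Qed.

(** * The trace form of two Toeplitz operators *)

(** Up to the norm of z^m, the matrix entry (m, k) of the Toeplitz operator T_f:
    the scalar product of f z^k with z^m. *)
Definition tcoef (x : C) f k m : C := wtrace x (zsmon m * f * zmon k).

Lemma Dfin_mul3 f g g' : Dfin f -> Dfin (g * f * g').
Proof. by move=> Df; apply: Dfin_mulr; apply: Dfin_mull. Qed.

Lemma wtraceZ x (c : C) f : Dfin f -> wtrace x (c *: f) = c * wtrace x f.
Proof. by move=> Df; rewrite -[_ *: _]addr0 wtrace_lin ?wtrace0 ?addr0//; exact: Dfin0. Qed.

Lemma wtraceD x f g : Dfin f -> Dfin g -> wtrace x (f + g) = wtrace x f + wtrace x g.
Proof. by move=> Df Dg; rewrite -[f]scale1r wtrace_lin// mul1r scale1r. Qed.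

Lemma tcoef_aK x j f k m : Dfin f -> tcoef x (aK j f) k m = chi j m / chi j k * tcoef x f k m.
Proof.
move=> Df; have Dh := Dfin_mul3 (zsmon m) (zmon k) Df.
rewrite /tcoef -[in RHS](wtrace_aK x j Dh) !aK_mul aK_zmon aK_zsmon -!FsAl -!FsAr.
have DK : Dfin (zsmon m * aK j f * zmon k) by apply: Dfin_mul3; exact: Dfin_act.
rewrite !wtraceZ//; last exact: DfinZ.
by move: (chi_neq0 j m) (chi_neq0 j k) => *; field; apply/andP.
Qed.

Lemma tcoef_aKV x j f k m : Dfin f -> tcoef x (aKV j f) k m = chi j k / chi j m * tcoef x f k m.
Proof.
move=> Df; rewrite -[f in RHS](aKVK j) tcoef_aK; last exact: Dfin_act.
by move: (chi_neq0 j m) (chi_neq0 j k) => *; field; apply/andP.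
Qed.

Lemma Escoef_eq0 j m : m j = 0%N -> Escoef j m = 0.
Proof. by move=> mj; rewrite /Escoef Fcoef_eq0// mulr0. Qed.

(** Leibniz rule for E_j (z^{*m} f z^k), whose trace is a boundary term.  The
    boundary term contains z^k z_n, a multiple of z^{k + e_n}; this is why it only
    modifies the coefficient of the shift of k. *)
Lemma tcoef_aE x j f k m : Dfin f -> tcoef x (aE j f) k m =
  - (Q ^- 2 * chi j m / chi j k * acoef x j k) * tcoef x f (up j k) m
  - chi j m * Escoef j m * tcoef x f k (dn j m).
Proof.
move=> Df; have Dh := Dfin_mul3 (zsmon m) (zmon k) Df.
have DE : Dfin (aE j f) := Dfin_act _ Df.
have DK : Dfin (aK j f) := Dfin_act _ Df.
have := aE_zsmon j m; move: (Escoef j m) => b Ez.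
have := wtrace_aE x j Dh; rewrite -mulrA aE_mul aE_mul Ez aE_zmon aK_zsmon.
rewrite -!FsAl -!FsAr mulrDr scalerDr mulrA -FsAr scalerA.
rewrite !mulrA.
have D1 := Dfin_mul3 (zsmon (dn j m)) (zmon k) Df.
have D2 := Dfin_mul3 (zsmon m) (zmon k) DE.
have D3 := Dfin_mul3 (zsmon m) (zmon (up j k)) DK.
rewrite wtraceD; [|exact: DfinZ|by apply: DfinD; exact: DfinZ].
rewrite wtraceD; [|exact: DfinZ..].
rewrite !wtraceZ// -/(tcoef _ _ _ _) -/(tcoef _ _ _ _) -/(tcoef _ _ _ _) tcoef_aK//.
move=> H.
have [cm ck] := (chi_neq0 j m, chi_neq0 j k).
have cu := chi_neq0 j (up j k).
have -> : tcoef x (aE j f) k m = chi j m * (stokes_coef x j * wtrace x (zsmon m * f * zmon k * z j)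
    - b * tcoef x f k (dn j m)) - Ecoef j k * chi j m / chi j (up j k) * tcoef x f (up j k) m.
  by rewrite -H; field; rewrite cm cu.
rewrite /stokes_coef /acoef; case: ifPn => jn.
  have Pk : can_up j k by rewrite /can_up jn.
  rewrite -[zsmon m * f * zmon k * z j]mulrA (zmon_z q k jn) -FsAr wtraceZ; last exact: Dfin_mul3.
  rewrite -up_last// -/(tcoef _ _ _ _) (chi_up Pk) /Ecoef jn.
  have kM : (k j <= misize k)%N by rewrite /misize (bigD1 j)//= leq_addr.
  have jn' : j.+1 = n by apply/eqP.
  have -> : Q ^+ 2 ^+ (n + misize k) = Q ^+ 2 ^+ j * Q ^+ 2 * Q ^+ (misize k - k j) * chi j k.
    rewrite chi_last// -!exprM -exprD -mulrA -exprD -exprD; congr (_ ^+ _).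
    by rewrite -[X in (2 * (X + _))%N]jn'; lia.
  have -> : Q ^+ 2 ^+ misize k = Q ^+ (misize k - k j) * chi j k.
    by rewrite chi_last// -exprM -exprD; congr (_ ^+ _); lia.
  rewrite /cE; have := Q21; move: (Q ^+ 2 ^+ j) (Q ^+ (_ - _)) => X Y.
  move: (chi j m) (chi j k) (tcoef _ _ _ _) (tcoef _ _ _ _) h cm ck Q_neq0 QQ1; move: Q => y.
  move=> u v g g' t u0 v0 y0 y1 y2; field.
  by rewrite y0 v0 y2.
rewrite mul0r sub0r.
have [Pk|Pk] := boolP (can_up j k); last first.
  by rewrite Ecoef_eq0// !(mulr0, mul0r, oppr0, subr0, sub0r) mulrN mulrA.
rewrite (chi_up Pk); move: (Ecoef j k) (chi j m) (chi j k) (tcoef _ _ _ _) (tcoef _ _ _ _) cm ck Q_neq0.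
move: Q => y a u v g g' u0 v0 y0; field.
by rewrite v0 y0.
Qed.

Lemma ent_sandwich f k m p p' :
  ent (zsmon m * f * zmon k) p p' = Dcoef q m p * Ccoef q k p' * ent f (addm m p) (addm k p').
Proof.
rewrite /ent !rhoM rho_zmon_delta !rhoZ rho_zsmon.
by rewrite mulrA [Ccoef _ _ _ * _]mulrC.
Qed.

Lemma fsum_neq0 (V : nmodType) (I : choiceType) (F : I -> V) :
  \sum_(y \in [set: I]) F y != 0 -> exists y, F y != 0.
Proof.
move=> F0; apply: contrapT => /forallNP H; move/negP: F0; apply; apply/eqP.
by apply: fsbig1 => y _; apply: contra_notP (H y) => /eqP.
Qed.

(** The coefficient (k, m) is a combination of the matrix entries of f at the
    positions (m + p, k + p). *)
Lemma tcoef_supp x f : Dfin f -> exists N, forall k m,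
  (k \notin box n N) || (m \notin box n N) -> tcoef x f k m = 0.
Proof.
move=> /Dfin_supp[r [ur r0]]; exists (\sum_(a <- r) misize a)%N => k m.
have inbox u p : addm u p \in r -> u \in box n (\sum_(a <- r) misize a)%N.
  move=> upr; rewrite mem_box; apply/forallP => y.
  rewrite (big_rem _ upr) /= (leq_trans _ (leq_addr _ _))//.
  by rewrite /misize (bigD1 y)//= ffunE -addnA leq_addr.
apply: contraTeq => /fsum_neq0[p].
rewrite ent_sandwich !mulf_eq0 !negb_or => /andP[/andP[_ e0] _].
rewrite !negbK; apply/andP; split; [apply: (inbox k p)|apply: (inbox m p)].
  by apply: contraNT e0 => kp; rewrite r0 ?kp ?orbT.
by apply: contraNT e0 => kp; rewrite r0 ?kp.
Qed.

Lemma tcoef_lin x (c : C) f g k m : Dfin f -> Dfin g ->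
  tcoef x (c *: f + g) k m = c * tcoef x f k m + tcoef x g k m.
Proof.
move=> Df Dg; rewrite /tcoef mulrDr mulrDl -FsAr -FsAl wtrace_lin//; exact: Dfin_mul3.
Qed.

Lemma tcoef_star x f k m : x^* = x -> Dfin f -> tcoef x (star f) k m = (tcoef x f m k)^*.
Proof.
move=> xr Df; rewrite /tcoef -wtrace_star//; last exact: Dfin_mul3.
by rewrite !starM star_zmon star_zsmon mulrA.
Qed.

(** The value of x for nu_q and for Tr_q. *)
Definition xnu : C := Q ^- (2 * n).
Definition tform_weight x (km : mi * mi) : C := wx xnu km.2 / (Nx x km.1 * Nx x km.2).

(** Up to a constant, Tr_q(T_f T_g): each of the two Toeplitz matrix entries has one
    squared norm as denominator. *)
Definition tform x f g : C :=
  \sum_(km \in [set: mi * mi]) tform_weight x km * tcoef x f km.1 km.2 * tcoef x g km.2 km.1.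

Definition box2 (N : nat) : seq (mi * mi) := [seq (k, m) | k <- box n N, m <- box n N].

Lemma uniq_box2 N : uniq (box2 N).
Proof.
apply: allpairs_uniq; [exact: uniq_box|exact: uniq_box|].
by move=> [a b] [c d] _ _ /=.
Qed.

Lemma mem_box2 N k m : ((k, m) \in box2 N) = (k \in box n N) && (m \in box n N).
Proof.
apply/allpairsP/andP => [[[a b] /= [? ? [-> ->]]]//|[kN mN]].
by exists (k, m).
Qed.

Lemma box_le (N M : nat) m : (N <= M)%N -> m \in box n N -> m \in box n M.
Proof.
by rewrite !mem_box => NM /forallP mN; apply/forallP => y; exact: leq_trans (mN y) NM.
Qed.

Lemma tformE x f : Dfin f -> exists N, forall M g, (N <= M)%N ->
  tform x f g = \sum_(km <- box2 M) tform_weight x km * tcoef x f km.1 km.2 * tcoef x g km.2 km.1.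
Proof.
move=> /(tcoef_supp x)[N HN]; exists N => M g NM; apply: fsumE; first exact: uniq_box2.
move=> [k m]; rewrite mem_box2 negb_and => km.
rewrite HN ?mulr0 ?mul0r//=; case/orP: km => km; apply/orP; [left|right];
  by apply: contra km; apply: box_le.
Qed.

Lemma tformE' x g : Dfin g -> exists N, forall M f, (N <= M)%N ->
  tform x f g = \sum_(km <- box2 M) tform_weight x km * tcoef x f km.1 km.2 * tcoef x g km.2 km.1.
Proof.
move=> /(tcoef_supp x)[N HN]; exists N => M f NM; apply: fsumE; first exact: uniq_box2.
move=> [k m]; rewrite mem_box2 negb_and => km.
rewrite [tcoef x g _ _]HN ?mulr0//=; case/orP: km => km; apply/orP; [right|left];
  by apply: contra km; apply: box_le.
Qed.

Lemma tform_Dlinr x f : Dfin f -> Dlin (tform x f).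
Proof.
move=> /(tformE x)[N HN] c g g' Dg Dg'; rewrite !(HN N)// mulr_sumr -big_split /=.
by apply: eq_bigr => km _; rewrite tcoef_lin//; ring.
Qed.

Lemma tform_Dlinl x g : Dfin g -> Dlin (fun f => tform x f g).
Proof.
move=> /(tformE' x)[N HN] c f f' Df Df'; rewrite !(HN N)// mulr_sumr -big_split /=.
by apply: eq_bigr => km _; rewrite tcoef_lin//; ring.
Qed.

Lemma tform_aK x j f g : Dfin f -> Dfin g -> tform x (aK j f) (aK j g) = tform x f g.
Proof.
move=> Df Dg; apply: eq_fsbigr => -[k m] _ /=; rewrite !tcoef_aK//.
by move: (chi_neq0 j m) (chi_neq0 j k) => m0 k0; field; rewrite m0 k0.
Qed.

Lemma conj_N x k : x^* = x -> (Nx x k)^* = Nx x k.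
Proof.
move=> xr; have Nr : N0 q k \is Num.real by rewrite ger0_real// ltW// N0_gt0.
have Qr : Q \is Num.real by rewrite ger0_real// ltW// Q_gt0.
have xR : x \is Num.real by apply/CrealP.
apply: conj_Creal; rewrite /Nx rpred_div// /Dden; apply: rpred_prod => i _.
by rewrite ?(rpredB, rpredM, rpredX, rpred1).
Qed.

Lemma conj_xnu : xnu^* = xnu. Proof. exact: conjV (conj_QX _). Qed.

Lemma tform_star x f g : x^* = x -> Dfin f -> Dfin g -> tform x (star g) (star f) = (tform x f g)^*.
Proof.
move=> xr Df Dg; have [N HN] := tformE x Df; have [N' HN'] := tformE' x (Dfin_star Df).
rewrite (HN (maxn N N'))// ?leq_maxl// (HN' (maxn N N'))// ?leq_maxr//.
rewrite rmorph_sum /=; apply: eq_bigr => -[k m] _ /=.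
have {1}<- : (tform_weight x (k, m))^* = tform_weight x (k, m).
  by rewrite /tform_weight /= rmorphM /= conjV ?conj_wx ?conj_xnu// rmorphM /= !conj_N.
by rewrite !tcoef_star// -!rmorphM /= mulrAC.
Qed.

Lemma Nx_neq0 x k : (forall s, Dden x s != 0) -> Nx x k != 0.
Proof. by move=> Dden_neq0; rewrite mulf_neq0 ?N0_neq0 ?invr_neq0. Qed.

Lemma fsumB (I : choiceType) (F G : I -> C) (r : seq I) : uniq r ->
  (forall y, y \notin r -> F y = 0 /\ G y = 0) ->
  \sum_(y \in [set: I]) (F y - G y) =
  \sum_(y \in [set: I]) F y - \sum_(y \in [set: I]) G y.
Proof.
move=> ur r0; rewrite !(fsumE ur) ?sumrB//.
- by move=> y /r0[].
- by move=> y /r0[].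
- by move=> y /r0[-> ->]; rewrite subr0.
Qed.

Lemma acoef_eq0 x j m : ~~ can_up j m -> acoef x j m = 0.
Proof.
by move=> Pm; rewrite /acoef Ecoef_eq0//; move: Pm; rewrite /can_up negb_or => /andP[/negbTE ->].
Qed.

Lemma xnu_last j : isLast j -> xnu = (Q ^+ 2 * Q ^+ 2 ^+ j)^-1.
Proof. by move=> /eqP jn; rewrite /xnu -exprM -exprD; congr ((_ ^+ _)^-1); lia. Qed.

Lemma wx_xnu_up j m : can_up j m -> wx xnu (up j m) = Q ^- 2 * wx xnu m.
Proof.
move=> Pm; rewrite wx_up//; case: ifPn => // jn; congr (_ * _).
rewrite (xnu_last jn).
have X0 : Q ^+ 2 ^+ j != 0 by rewrite !expf_neq0 ?Q_neq0.
by move: X0 Q_neq0; move: (Q ^+ 2 ^+ j) Q => X y X0 y0; field; rewrite y0.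
Qed.

(** The left side is the sum of A1 - A2 and the right side that of B2 - B1, where
    A1, A2 come from the two shifts in E_j f and B1, B2 from those in
    K_j^{-1} E_j g.  Substituting k for up j k identifies A1 with B2, by the
    recursion of the norms; substituting m for up j m identifies A2 with B1, where
    the weight of Tr_q enters as well. *)
Lemma tform_aE x j f g : (forall s, Dden x s != 0) -> Dfin f -> Dfin g ->
  tform x (aE j f) g = - tform x f (aKV j (aE j g)).
Proof.
move=> Dden_neq0 Df Dg.
pose A1 km := tform_weight x km * tcoef x g km.2 km.1 *
  - (Q ^- 2 * chi j km.2 / chi j km.1 * acoef x j km.1) * tcoef x f (up j km.1) km.2.
pose A2 km := tform_weight x km * tcoef x g km.2 km.1 *
  (chi j km.2 * Escoef j km.2) * tcoef x f km.1 (dn j km.2).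
pose B1 km := tform_weight x km * tcoef x f km.1 km.2 *
  - (Q ^- 2 * acoef x j km.2) * tcoef x g (up j km.2) km.1.
pose B2 km := tform_weight x km * tcoef x f km.1 km.2 *
  (chi j km.2 * Escoef j km.1) * tcoef x g km.2 (dn j km.1).
have [Nf HNf] := tcoef_supp x Df; have [Ng HNg] := tcoef_supp x Dg.
have suppg km : km \notin box2 Ng -> A1 km = 0 /\ A2 km = 0.
  case: km => k m; rewrite mem_box2 negb_and orbC => km.
  by rewrite /A1 /A2 /= HNg// mulr0 !mul0r.
have suppf km : km \notin box2 Nf -> B1 km = 0 /\ B2 km = 0.
  case: km => k m; rewrite mem_box2 negb_and => km.
  by rewrite /B1 /B2 /= HNf// mulr0 !mul0r.
have -> : tform x (aE j f) g = \sum_(km \in [set: mi * mi]) (A1 km - A2 km).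
  apply: eq_fsbigr => -[k m] _; rewrite /A1 /A2 /= tcoef_aE//.
  by move: (Escoef j m) => b; ring.
have -> : tform x f (aKV j (aE j g)) = \sum_(km \in [set: mi * mi]) (B1 km - B2 km).
  apply: eq_fsbigr => -[k m] _; rewrite /B1 /B2 /= tcoef_aKV; last exact: Dfin_act.
  rewrite tcoef_aE//; move: (Escoef j k) (chi_neq0 j k) (chi_neq0 j m) Q_neq0 => b.
  move: (chi j k) (chi j m) (tform_weight _ _) (tcoef _ _ _ _) (tcoef _ _ _ _) (tcoef _ _ _ _) (acoef _ _ _).
  by move: Q => y u v B g1 g2 g3 a u0 v0 y0; field; rewrite y0 u0 v0.
rewrite (fsumB (uniq_box2 Ng) suppg) (fsumB (uniq_box2 Nf) suppf) opprB.
have N0' k := Nx_neq0 k Dden_neq0.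
congr (_ - _).
  rewrite (@fsum_reindex _ _ (fun km : mi * mi => (0 < km.1 j)%N)
    (fun km : mi * mi => can_up j km.1) (fun km => (dn j km.1, km.2))
    (fun km => (up j km.1, km.2))) => [|[k m] /= kj|[k m] /= kj|[k m] /= kj].
  - apply: eq_fsbigr => -[k m] _ /=; case: posnP => kj.
      by rewrite /B2 /= Escoef_eq0// !(mulr0, mul0r).
    rewrite /A1 /B2 /= updnK//; have := Nx_rec Dden_neq0 (can_up_dn j k); rewrite updnK//.
    rewrite /tform_weight /=; move: (Escoef j k) (N0' k) (N0' m) (N0' (dn j k)) => b.
    move: (chi_neq0 j (dn j k)) Q_neq0.
    move: (acoef _ _ _) (Nx _ k) (Nx _ m) (Nx _ (dn _ _)) (chi _ m) (chi _ (dn _ _)) (tcoef _ _ _ _).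
    move: (tcoef _ _ _ _) (wx _ _); move: Q => y g1 w a nk nm nd cm cd g2 cd0 y0 nk0 nm0 nd0 H.
    have -> : b = - (a * nk) / (y ^+ 2 * cd * nd) by rewrite H; field; rewrite y0 cd0 nd0.
    by field; rewrite y0 cd0 nk0 nm0 nd0.
  - by rewrite can_up_dn updnK.
  - by rewrite up_gt0 dnupK.
  - by rewrite /A1 /= acoef_eq0// !(mulr0, oppr0, mul0r).
rewrite [RHS](@fsum_reindex _ _ (fun km : mi * mi => (0 < km.2 j)%N)
  (fun km : mi * mi => can_up j km.2) (fun km => (km.1, dn j km.2))
  (fun km => (km.1, up j km.2))) => [|[k m] /= kj|[k m] /= kj|[k m] /= kj].
- apply: eq_fsbigr => -[k m] _ /=; case: posnP => kj.
    by rewrite /A2 /= Escoef_eq0// !(mulr0, mul0r).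
  rewrite /A2 /B1 /= updnK//; have := Nx_rec Dden_neq0 (can_up_dn j m); rewrite updnK//.
  have -> : chi j m = Q ^+ 2 * chi j (dn j m) by rewrite -chi_up ?can_up_dn// updnK.
  rewrite /tform_weight /=.
  have -> : wx xnu m = Q ^- 2 * wx xnu (dn j m) by rewrite -(wx_xnu_up (can_up_dn j m)) updnK.
  move: (Escoef j m) (N0' k) (N0' m) (N0' (dn j m)) => b.
  move: (chi_neq0 j (dn j m)) Q_neq0.
  move: (acoef _ _ _) (Nx _ k) (Nx _ m) (Nx _ (dn _ _)) (chi _ (dn _ _)) (tcoef _ _ _ _).
  move: (tcoef _ _ _ _) (wx _ _); move: Q => y g1 w a nk nm nd cd g2 cd0 y0 nk0 nm0 nd0 H.
  have -> : b = - (a * nm) / (y ^+ 2 * cd * nd) by rewrite H; field; rewrite y0 cd0 nd0.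
  by field; rewrite y0 cd0 nk0 nm0 nd0.
- by rewrite can_up_dn updnK.
- by rewrite up_gt0 dnupK.
- by rewrite /B1 /= acoef_eq0// !(mulr0, oppr0, mul0r).
Qed.

(** * Invariant hermitian forms *)

Section Invariance.
Context (b : A -> A -> C).
Hypothesis bl : forall g, Dfin g -> Dlin (fun f => b f g).
Hypothesis br : forall f, Dfin f -> Dlin (b f).
Hypothesis bK : forall j f g, Dfin f -> Dfin g -> b (aK j f) (aK j g) = b f g.

(** The antipode is S(E_j) = - K_j^{-1} E_j. *)
Hypothesis bE : forall j f g, Dfin f -> Dfin g -> b (aE j f) g = - b f (aKV j (aE j g)).
Hypothesis bstar : forall f g, Dfin f -> Dfin g -> b (star g) (star f) = (b f g)^*.

Lemma formZl (c : C) f g : Dfin f -> Dfin g -> b (c *: f) g = c * b f g.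
Proof.
move=> Df Dg; have := bl Dg c Df (Dfin0 n q); rewrite addr0 => ->.
by rewrite (Dlin0 (bl Dg)) addr0.
Qed.

Lemma formZr (c : C) f g : Dfin f -> Dfin g -> b f (c *: g) = c * b f g.
Proof.
move=> Df Dg; have := br Df c Dg (Dfin0 n q); rewrite addr0 => ->.
by rewrite (Dlin0 (br Df)) addr0.
Qed.

Lemma formDl f f' g : Dfin f -> Dfin f' -> Dfin g -> b (f + f') g = b f g + b f' g.
Proof. by move=> Df Df' Dg; have := bl Dg 1 Df Df'; rewrite scale1r mul1r. Qed.

Lemma formDr f g g' : Dfin f -> Dfin g -> Dfin g' -> b f (g + g') = b f g + b f g'.
Proof. by move=> Df Dg Dg'; have := br Df 1 Dg Dg'; rewrite scale1r mul1r. Qed.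

Lemma form_aKl j f g : Dfin f -> Dfin g -> b (aK j f) g = b f (aKV j g).
Proof. by move=> Df Dg; rewrite -(bK j Df)// ?aKVK//; exact: Dfin_act. Qed.

Lemma form_aKVl j f g : Dfin f -> Dfin g -> b (aKV j f) g = b f (aK j g).
Proof. by move=> Df Dg; rewrite -(bK j)// ?aKVK//; exact: Dfin_act. Qed.

Lemma form_aEr j f g : Dfin f -> Dfin g -> b f (aE j g) = - Q ^+ 2 * b (aKV j (aE j f)) g.
Proof.
move=> Df Dg.
have DKg : Dfin (aK j g) := Dfin_act _ Dg.
have DEf : Dfin (aE j f) := Dfin_act _ Df.
(* Conjugating E_j by K_j makes the pattern K_j^{-1} E_j of the hypothesis appear. *)
have -> : aE j g = Q ^+ 2 *: aKV j (aE j (aK j g)).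
  by rewrite -aKVZ -aKE aKK.
rewrite formZr//; last by apply: Dfin_act; apply: Dfin_act.
rewrite form_aKVl// mulNr -mulrN; congr (_ * _).
by apply: oppr_inj; rewrite opprK bE.
Qed.

(** F_j f is, up to a scalar, the adjoint of E_j applied to the adjoint of f, so
    the rule for F_j is the complex conjugate of the rule for E_j with the two
    arguments exchanged. *)
Lemma form_aFl j f g : Dfin f -> Dfin g -> b (aF j f) g = - b f (aF j (aK j g)).
Proof.
move=> Df Dg; rewrite -(starK f) -(starK g) aF_star.
have Df' := Dfin_star Df; have Dg' := Dfin_star Dg.
have DEf : Dfin (aE j (star f)) := Dfin_act _ Df'.
have DEg : Dfin (aE j (star g)) := Dfin_act _ Dg'.
have DKEg : Dfin (aKV j (aE j (star g))) := Dfin_act _ DEg.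
rewrite formZl; [|exact: Dfin_star..].
rewrite bstar// form_aEr// rmorphM /= -bstar// star_aKV star_aE.
rewrite rmorphN /= conj_QX !starK.
have DFg : Dfin (aF j g) := Dfin_act _ Dg.
have DKFg : Dfin (aK j (aF j g)) := Dfin_act _ DFg.
rewrite aKZ formZr//.
have -> : aF j (aK j g) = Q ^+ 2 *: aK j (aF j g).
  by rewrite aKF scalerA mulfV ?scale1r// expf_neq0// Q_neq0.
rewrite formZr//.
have := sgK j; move: (sg j) (b _ _) Q_neq0; move: Q => y s B y0 s2.
transitivity (- (s * s) * (y ^+ 2 * B)); last by rewrite s2 mulN1r.
by field.
Qed.

Theorem form_invariance t f g : Dfin f -> Dfin g ->
  b (act (Ucls q t) f) g = b f (act (Ucls q (antipode t)) g).
Proof.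
elim: t f g => [[j|j|j|j]|c|s Hs t Ht|s Hs t Ht] f g Df Dg.
- rewrite -/(aE j f) bE// /antipode /= act_tM act_cst act_tM -/(aE _ _) -/(aKV _ _).
  by rewrite formZr ?mulN1r//; apply: Dfin_act; exact: Dfin_act.
- rewrite -/(aF j f) form_aFl// /antipode /= act_tM act_cst act_tM -/(aF _ _) -/(aK _ _).
  by rewrite formZr ?mulN1r//; apply: Dfin_act; exact: Dfin_act.
- exact: form_aKl.
- exact: form_aKVl.
- by rewrite /antipode /= !act_cst formZl// formZr.
- rewrite /antipode /= -!/(antipode _) !act_tD formDl ?formDr ?Hs ?Ht//; exact: Dfin_act.
- rewrite /antipode /= -!/(antipode _) !act_tM Hs ?Ht//; exact: Dfin_act.
Qed.

End Invariance.

Definition wtrace_form f g : C := wtrace xnu (f * g).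

Lemma wtrace_form_Dlinl g : Dfin g -> Dlin (fun f => wtrace_form f g).
Proof.
move=> Dg c f f' Df Df'; rewrite /wtrace_form mulrDl -FsAl wtrace_lin//; exact: Dfin_mulr.
Qed.

Lemma wtrace_form_Dlinr f : Dfin f -> Dlin (wtrace_form f).
Proof.
move=> Df c g g' Dg Dg'; rewrite /wtrace_form mulrDr -FsAr wtrace_lin//; exact: Dfin_mull.
Qed.

(** The integral of E_j (f g) vanishes for nu_q, and the Leibniz rule moves E_j
    from f to g. *)
Lemma wtrace_form_invariance t f g : Dfin f -> Dfin g ->
  wtrace_form (act (Ucls q t) f) g = wtrace_form f (act (Ucls q (antipode t)) g).
Proof.
have aKf j u v : Dfin u -> Dfin v -> wtrace_form (aK j u) (aK j v) = wtrace_form u v.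
  by move=> Du Dv; rewrite /wtrace_form -aK_mul wtrace_aK//; exact: Dfin_mull.
apply: form_invariance => //.
- exact: wtrace_form_Dlinl.
- exact: wtrace_form_Dlinr.
- move=> j u v Du Dv.
  have E0 : wtrace xnu (aE j (u * v)) = 0.
    rewrite wtrace_aE; last exact: Dfin_mulr.
    rewrite /stokes_coef; case: ifPn => [jn|_]; last by rewrite mul0r.
    rewrite (xnu_last jn).
    have X0 : Q ^+ 2 ^+ j != 0 by rewrite !expf_neq0 ?Q_neq0.
    by rewrite invfM mulfVK// subrr mulr0 mul0r.
  rewrite -(aKf j _ (aKV j (aE j v)))//; last by apply: Dfin_act; exact: Dfin_act.
  rewrite aKVK; apply/eqP; rewrite -subr_eq0 opprK -E0 aE_mul wtraceD//.
    by apply: Dfin_mull.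
  by apply: Dfin_mull; exact: Dfin_act.
- move=> u v Du Dv; rewrite /wtrace_form -starM wtrace_star ?conj_xnu//.
  exact: Dfin_mull.
Qed.

End Action.

(** * Distributions as infinite matrices *)

Section Distributions.
Context (R : realType) (n : nat) (q : R).
Hypothesis (q_gt0 : 0 < q) (q_lt1 : q < 1).
Local Notation C := (R[i])%C.
Local Notation Q := (cq q).
Local Notation mi := (mi n).
Local Notation A := (FUn n q).
Local Notation zmon := (zmon q).
Local Notation zsmon := (zsmon q).
Local Notation H := (Hbasis q).
Local Notation D := (dist R n).
Implicit Types (m p k a b : mi) (i j l : 'I_n) (f g : A) (psi : D).

Definition minm k m : mi := [ffun x => minn (k x) (m x)].

Lemma lem_min_l k m : lemi (minm k m) k.
Proof. by apply/lemiP => x; rewrite ffunE geq_minl. Qed.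

Lemma lem_min_r k m : lemi (minm k m) m.
Proof. by apply/lemiP => x; rewrite ffunE geq_minr. Qed.

Lemma inP_tails p : inP (tails p).
Proof.
apply/forallP => x; apply/forallP => y; apply/implyP => xy.
rewrite !tailsE /tailsum [leqLHS]big_mkcond [leqRHS]big_mkcond /=; apply: leq_sum => s _.
by case: (leqP y s) => // ys; rewrite (leq_trans xy ys).
Qed.

Lemma disj_min k m : midisj (subm k (minm k m)) (subm m (minm k m)).
Proof.
apply/forallP => x; rewrite !ffunE muln_eq0 !subn_eq0.
by rewrite !leq_min !leqnn /= andbT; case: leqP => // /ltnW ->.
Qed.

Lemma idx_subproof k m :
  midisj (subm k (minm k m), subm m (minm k m), tails (minm k m)).1.1
    (subm k (minm k m), subm m (minm k m), tails (minm k m)).1.2 &&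
  inP (subm k (minm k m), subm m (minm k m), tails (minm k m)).2.
Proof. by rewrite /= disj_min inP_tails. Qed.

(** The place, in an expansion sum z^i f_{i,j}(y) z^{*j}, that controls the (k, m)
    matrix entry.  As z^i phi(y) z^{*j} maps z^{j+p} e_0 to a multiple of
    z^{i+p} e_0, with phi evaluated at the tails of p, the constraint i x j = 0
    forces p = min(k, m), i = k - p and j = m - p. *)
Definition idx k m : didx n :=
  exist (fun x : mi * mi * mi => midisj x.1.1 x.1.2 && inP x.2) _ (idx_subproof k m).

(** The entry k_t, with value 0 beyond the last index. *)
Definition vnext (t : nat) (k : mi) : nat := (\sum_(x < n | x == t :> nat) k x)%N.
Definition untails k : mi := [ffun x : 'I_n => (k x - vnext x.+1 k)%N].

Lemma vnext_ord l k : vnext l k = k l.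
Proof.
rewrite /vnext (bigD1 l)//= big1 ?addn0// => x /andP[/eqP xl].
by rewrite -val_eqE /= xl eqxx.
Qed.

Lemma vnext_ge t k : (n <= t)%N -> vnext t k = 0%N.
Proof.
move=> nt; rewrite /vnext big_pred0// => x; apply/eqP => e.
by have := ltn_ord x; rewrite e ltnNge nt.
Qed.

Lemma vnext_tails t p : vnext t (tails p) = tailsum t p.
Proof.
have [tn|nt] := ltnP t n; last by rewrite vnext_ge// tailsum_ge.
by rewrite -[vnext t _]/(vnext (Ordinal tn) _) vnext_ord tailsE.
Qed.

Lemma tailsK p : untails (tails p) = p.
Proof. by apply/ffunP => x; rewrite ffunE vnext_tails tailsE tailsumS addnK. Qed.

Lemma untailsK k : inP k -> tails (untails k) = k.
Proof.
move=> /forallP Pk; apply/ffunP => l; rewrite tailsE -vnext_ord.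
move: (l : nat) => t; have [s] := ubnP (n - t); elim: s t => // s IH t ts.
have [nt|tn] := leqP n t; first by rewrite tailsum_ge// vnext_ge.
rewrite (tailsumS (Ordinal tn)) ffunE IH /=; last by rewrite subnS -ltnS prednK ?subn_gt0.
rewrite -[vnext t k]/(vnext (Ordinal tn) k) vnext_ord subnK//.
have [tn'|nt'] := ltnP t.+1 n; last by rewrite vnext_ge.
rewrite -[vnext t.+1 k]/(vnext (Ordinal tn') k) vnext_ord.
have /forallP/(_ (Ordinal tn')) := Pk (Ordinal tn).
by rewrite /= leqnSn.
Qed.

Definition pidx (x : didx n) : mi * mi :=
  (addm (val x).1.1 (untails (val x).2), addm (val x).1.2 (untails (val x).2)).

Lemma min_disj k m p : midisj k m -> minm (addm k p) (addm m p) = p.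
Proof.
move=> /forallP km; apply/ffunP => x; rewrite !ffunE.
move: (km x); rewrite muln_eq0 => /orP[] /eqP ->; rewrite add0n.
  by apply/minn_idPl; rewrite leq_addl.
by apply/minn_idPr; rewrite leq_addl.
Qed.

Lemma pidxK x : idx (pidx x).1 (pidx x).2 = x.
Proof.
apply: val_inj; case: x => [[[k m] t]] /= kmt; rewrite /pidx /=.
case/andP: (kmt) => km Pt; rewrite min_disj// untailsK//; congr (_, _, _).
  by rewrite addmC addmK.
by rewrite addmC addmK.
Qed.

Lemma idxK k m : pidx (idx k m) = (k, m).
Proof.
rewrite /pidx /= tailsK; congr (_, _); rewrite addmC submK//.
  exact: lem_min_l.
exact: lem_min_r.
Qed.

(** The entry (k, m) of the operator sum z^i psi_{i,j}(y) z^{*j} is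
    mcst k m * psi (idx k m), so that [mat psi] is its matrix, and [unmat] the
    inverse correspondence. *)
Definition mcst k m : C :=
  Ccoef q (subm k (minm k m)) (minm k m) * Dcoef q (subm m (minm k m)) (minm k m).
Definition mat psi k m : C := mcst k m * psi (idx k m).
Definition unmat (M : mi -> mi -> C) : D :=
  fun x => M (pidx x).1 (pidx x).2 / mcst (pidx x).1 (pidx x).2.

Lemma mcst_neq0 k m : mcst k m != 0.
Proof. by rewrite mulf_neq0 ?Ccoef_neq0 ?Dcoef_neq0. Qed.

Lemma unmatK M k m : mat (unmat M) k m = M k m.
Proof. by rewrite /mat /unmat idxK /= mulrC divfK ?mcst_neq0. Qed.

Lemma mat_inj psi psi' : (forall k m, mat psi k m = mat psi' k m) -> psi = psi'.
Proof.
move=> H; apply/funext => x; have := H (pidx x).1 (pidx x).2.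
by rewrite /mat pidxK => /mulfI; apply; exact: mcst_neq0.
Qed.

Lemma dcoef_out psi (u v k : mi) : ~~ (midisj u v && inP k) -> dcoef psi u v k = 0.
Proof. by move=> P; rewrite /dcoef insubN. Qed.

Lemma dcoef_idx psi (u v p : mi) : midisj u v ->
  dcoef psi u v (tails p) = psi (idx (addm u p) (addm v p)).
Proof.
move=> uv; rewrite /dcoef; case: insubP => [x _ xE|]; last by rewrite /= uv inP_tails.
congr psi; apply: val_inj; rewrite xE /= min_disj//; congr (_, _, _).
  by rewrite addmC addmK.
by rewrite addmC addmK.
Qed.

Lemma dcoef_idx_min psi k m :
  dcoef psi (subm k (minm k m)) (subm m (minm k m)) (tails (minm k m)) = psi (idx k m).
Proof.
rewrite dcoef_idx ?disj_min//; congr (psi (idx _ _)); rewrite addmC submK//.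
  exact: lem_min_l.
exact: lem_min_r.
Qed.

Definition dsupp psi : set (mi * mi) :=
  [set ij : mi * mi | exists k, dcoef psi ij.1 ij.2 k != 0].

Definition dterm psi m (ij : mi * mi) : A :=
  zmon ij.1 * fun_y (dcoef psi ij.1 ij.2) (zsmon ij.2 * H m).

Lemma zsmon_H k m : zsmon k * H m =
  if lemi k m then Dcoef q k (subm m k) *: H (subm m k) else 0.
Proof.
apply: (@H_eq R n q).
- apply: lspan_H_mul; exact: (lspan_gen H).
- case: ifP => _; last exact: lspan0.
  by apply: lspanZ; exact: (lspan_gen H).
move=> p; rewrite co_mulH /ent rho_zsmon /delta.
case: ifPn => km; last first.
  rewrite /co ent0; case: eqP => [e|]; last by rewrite mulr0.
  by move: km; rewrite -e lem_addm.
rewrite /co entZ -/(co _ _) co_H /delta.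
have [->|pm] := eqVneq p (subm m k); first by rewrite submK// eqxx.
case: eqP => [e|_]; last by rewrite !mulr0.
by move: pm; rewrite -e addmK eqxx.
Qed.

Lemma fun_yE phi (c : C) p : fun_y phi (c *: H p) = (phi (tails p) * c) *: H p.
Proof.
rewrite /fun_y.
have -> : coord_in H (c *: H p) = fun m => c * delta R p m.
  rewrite (@coord_inE R n q H); [|by move=> k m; exact: co_H|].
    by apply/funext => m; rewrite /co entZ -/(co _ _) co_H.
  by apply: lspanZ; exact: (lspan_gen H).
rewrite (@fsumE _ _ [:: p])// ?big_seq1 /delta ?eqxx ?mulr1//.
by move=> m; rewrite inE => /negbTE ->; rewrite !mulr0 scale0r.
Qed.

Lemma fun_y0 phi : fun_y phi 0 = 0 :> A.
Proof. by rewrite -(scale0r (H (mi0 n))) fun_yE mulr0. Qed.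

Lemma zmon_H k p : zmon k * H p = Ccoef q k p *: H (addm k p).
Proof.
apply: (@H_eq R n q).
- apply: lspan_H_mul; exact: (lspan_gen H).
- by apply: lspanZ; exact: (lspan_gen H).
by move=> m; rewrite co_mulH /ent rho_zmon_delta /co entZ -/(co _ _) co_H.
Qed.

Lemma dtermE psi m ij : dterm psi m ij = if lemi ij.2 m then
  (dcoef psi ij.1 ij.2 (tails (subm m ij.2)) * Dcoef q ij.2 (subm m ij.2) *
   Ccoef q ij.1 (subm m ij.2)) *: H (addm ij.1 (subm m ij.2)) else 0.
Proof.
rewrite /dterm zsmon_H; case: ifP => _; last by rewrite fun_y0 mulr0.
by rewrite fun_yE -FsAr zmon_H scalerA.
Qed.

(** Among the terms z^i psi_{i,j}(y) z^{*j}, exactly one can contribute to a given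
    matrix entry. *)
Lemma dterm_sum psi m : finite_set (dsupp psi) ->
  lspan H (\sum_(ij \in setT) dterm psi m ij) /\
  forall k, co (\sum_(ij \in setT) dterm psi m ij) k = mat psi k m.
Proof.
move=> /finite_seqP[s sE].
have us := undup_uniq s.
have s0 ij : ij \notin undup s -> forall k, dcoef psi ij.1 ij.2 k = 0.
  rewrite mem_undup => ijs k; apply/eqP; apply: contraNT ijs => d0.
  have : dsupp psi ij by exists k.
  by rewrite sE.
rewrite (fsumE us); last first.
  by move=> ij /s0 ij0; rewrite dtermE ij0 !mul0r scale0r if_same.
split=> [|k].
  apply: lspan_sum => ij _; rewrite dtermE; case: ifP => _; last exact: lspan0.
  by apply: lspanZ; exact: (lspan_gen H).
rewrite /co ent_sum.
set ij0 := (subm k (minm k m), subm m (minm k m)).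
have E ij : ent (dterm psi m ij) k (mi0 n) = if ij == ij0 then mat psi k m else 0.
  rewrite dtermE; have [ijE|ijn] := eqVneq ij ij0.
    rewrite ijE /= ifT; last by apply/lemiP => x; rewrite !ffunE leq_subr.
    have -> : subm m (subm m (minm k m)) = minm k m.
      by apply/ffunP => x; rewrite !ffunE subKn// geq_minr.
    rewrite entZ -/(co _ _) co_H /delta addmC submK ?lem_min_l// eqxx mulr1.
    by rewrite dcoef_idx_min /mat /mcst; move: (psi _) (Dcoef _ _ _) (Ccoef _ _ _) => *; ring.
  case: ifP => [jm|_]; last by rewrite ent0.
  rewrite entZ -/(co _ _) co_H /delta; case: eqP => [kE|_]; last by rewrite mulr0.
  rewrite dcoef_out ?mul0r//; apply: contra ijn => /andP[dj _]; apply/eqP.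
  have mE : m = addm ij.2 (subm m ij.2) by rewrite submK.
  have pE : minm k m = subm m ij.2 by rewrite kE {2}mE min_disj.
  rewrite /ij0 pE [ij]surjective_pairing /=; congr (_, _).
    by rewrite {1}kE addmC addmK.
  by rewrite {1}mE addmC addmK.
have [ijs|ijs] := boolP (ij0 \in undup s).
  rewrite (bigD1_seq ij0)//= E eqxx big1 ?addr0// => ij ijn.
  by rewrite E (negbTE ijn).
rewrite big1_seq => [|ij /= ijs']; last first.
  by rewrite E; case: eqP ijs' ijs => [->->|].
by rewrite /mat -dcoef_idx_min (s0 ij0)// mulr0.
Qed.

Lemma expansionP f psi :
  is_expansion f psi <-> finite_set (dsupp psi) /\ forall k m, mat psi k m = ent f k m.
Proof.
split=> -[fin Hm]; split=> //; [move=> k m|move=> m].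
  by have [_ <-] := dterm_sum m fin; rewrite -co_mulH Hm.
have [ls cs] := dterm_sum m fin; apply: (@H_eq R n q) => // [|k].
  apply: lspan_H_mul; exact: (lspan_gen H).
by rewrite co_mulH cs Hm.
Qed.

(** The matrix of g has finitely supported columns, so matrices can be
    multiplied. *)
Lemma ent_mul g m : exists r : seq mi, [/\ uniq r,
  forall p, p \notin r -> ent g p m = 0 &
  forall f k, ent (f * g) k m = \sum_(p <- r) ent g p m * ent f k p].
Proof.
have gH : lspan H (g * H m) by apply: lspan_H_mul; exact: (lspan_gen H).
have [r [ur r0 gE]] := @lspanE _ _ _ _ _ (@co_lin R n q) (@co_H R n q) _ gH.
exists r; split=> // [p npr|f k]; first by rewrite -co_mulH r0.
rewrite -co_mulH -mulrA gE mulr_sumr /co ent_sum; apply: eq_bigr => p _.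
by rewrite -FsAr entZ -!/(co _ _) !co_mulH.
Qed.

(** Each generator has its nonzero matrix entries on finitely many diagonals, and
    this property is stable under sums and products.  It is what makes the expansion
    of every element of F(U_n)_q finite in (i, j). *)
Lemma band f : exists N : nat, forall k m, ent f k m != 0 ->
  forall x, ((k x <= m x + N) && (m x <= k x + N))%N.
Proof.
elim/FUn_ind: f => [i|i|||c f [N HN]|f g [N HN] [M HM]|f g [N HN] [M HM]].
- exists 1%N => k m; rewrite /ent rho_z_delta mulf_eq0 negb_or => /andP[_].
  rewrite /delta; case: (k =P inc i m) => [-> _ x|]; last by rewrite eqxx.
  by rewrite ffunE; case: (x == i); lia.
- exists 1%N => k m; rewrite /ent rho_zs /fock_zs mulf_eq0 negb_or => /andP[_].
  rewrite /delta; case: (inc i k =P m) => [<- _ x|]; last by rewrite eqxx.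
  by rewrite ffunE; case: (x == i); lia.
- exists 0%N => k m; rewrite /ent rho_f0 /fock_f0 mulf_eq0 negb_or /delta.
  case: (k =P mi0 n) => [->|]; last by rewrite eqxx.
  case: (mi0 n =P m) => [<- _ x|]; last by rewrite eqxx andbF.
  by rewrite addn0 leqnn.
- exists 0%N => k m; rewrite /ent rho1 /delta.
  by case: (k =P m) => [-> _ x|]; rewrite ?eqxx// addn0 leqnn.
- by exists N => k m; rewrite entZ mulf_eq0 negb_or => /andP[_ /HN].
- exists (maxn N M) => k m; rewrite -[f]scale1r ent_lin mul1r => fg x.
  have [f0|/HN/(_ x)] := eqVneq (ent f k m) 0; last by lia.
  by move: fg; rewrite f0 add0r => /HM/(_ x); lia.
- exists (N + M)%N => k m; have [r [ur r0 ->]] := ent_mul g m => s0 x.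
  have [p /andP[gp fp]] : exists p, (ent g p m != 0) && (ent f k p != 0).
    apply: contrapT => /forallNP Hp; move/negP: s0; apply; apply/eqP.
    apply: big1_seq => p _; apply/eqP; rewrite mulf_eq0 -[_ || _]negbK negb_or.
    exact/negP/Hp.
  by have := HM _ _ gp x; have := HN _ _ fp x; lia.
Qed.

Lemma expansion_exists f : is_expansion f (unmat (ent f)).
Proof.
apply/expansionP; split; last by move=> k m; rewrite unmatK.
have [N HN] := band f.
apply: (@sub_finite_set _ _ [set` [seq (u, v) | u <- box n N, v <- box n N]]); last exact: finite_seq.
move=> [u v] [k] /= d0; apply: contrapT => uv; move/eqP: d0; apply.
have [/andP[dj Pk]|] := boolP (midisj u v && inP k); last exact: dcoef_out.
rewrite -(untailsK Pk) dcoef_idx// /unmat idxK /=.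
have [->|e0] := eqVneq (ent f (addm u (untails k)) (addm v (untails k))) 0; first by rewrite mul0r.
have H' := HN _ _ e0.
exfalso; apply: uv; apply/allpairsP; exists (u, v) => /=; rewrite !mem_box; split=> //.
  apply/forallP => x; move: (H' x) (forallP dj x); rewrite !ffunE muln_eq0; lia.
apply/forallP => x; move: (H' x) (forallP dj x); rewrite !ffunE muln_eq0; lia.
Qed.

(** An element acts on H by the matrix of its expansion. *)
Lemma mat_expansion f k m : mat (expansion f) k m = ent f k m.
Proof.
have : is_expansion f (expansion f).
  rewrite /expansion; apply: (@xgetPex _ 0 [set psi | is_expansion f psi]).
  by exists (unmat (ent f)); exact: expansion_exists.
by move=> /expansionP[_].
Qed.

Lemma expansionE f : expansion f = unmat (ent f).
Proof. by apply: mat_inj => k m; rewrite mat_expansion unmatK. Qed.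

Local Notation CF := (R[i] : numFieldType).

Lemma dist_cvgP (F : set_system D) {FF : Filter F} psi :
  F --> psi <-> forall x, (fun g : D => (g x : CF)) @ F --> (psi x : CF).
Proof.
have surj x : (fun g : didx n -> CF => g x) @` setT = setT.
  by rewrite eqEsubset; split=> v // _; exists (cst v).
split=> [Fpsi x W /=|H].
  have /cvg_sup/(_ x)/cvg_image := Fpsi => /(_ (surj x)) H /H [B FB BW].
  by rewrite nbhs_simpl /=; apply: filterS FB => g Bg; rewrite -BW; exists g.
apply/cvg_sup => x; apply/cvg_image => //.
move=> W /= /H; rewrite ?nbhs_simpl /fmap /= => FW.
exists ((fun g : D => g x) @^-1` W) => //.
by rewrite eqEsubset; split => [y [? + <-//]|y Wy]; exists (cst y).
Qed.

Lemma dist_cvg_unique (F : set_system D) {FF : ProperFilter F} psi psi' :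
  F --> psi -> F --> psi' -> psi = psi'.
Proof.
move=> /dist_cvgP H /dist_cvgP H'; apply/funext => x.
exact: (@cvg_unique CF (@norm_hausdorff _ CF) _ _ _ _ (H x) (H' x)).
Qed.

(** Truncations are finite functions that converge to psi, whence the density
    of D(U_n)_q in D(U_n)'_q. *)
Definition trunc psi (N : nat) : A :=
  \sum_(ab <- box2 n N) (mat psi ab.1 ab.2 / N0 q ab.2) *: munit q ab.1 ab.2.

Lemma Dfin_sum (J : Type) (r : seq J) (c : J -> C) (F : J -> A) :
  (forall x, Dfin (F x)) -> Dfin (\sum_(x <- r) c x *: F x).
Proof.
move=> H; elim: r => [|x r IH]; first by rewrite big_nil; exact: Dfin0.
by rewrite big_cons; apply: DfinD => //; apply: DfinZ.
Qed.

Lemma Dfin_trunc psi N : Dfin (trunc psi N).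
Proof. by apply: Dfin_sum => x; exact: Dfin_munit. Qed.

Lemma ent_trunc psi N k m : (k, m) \in box2 n N -> ent (trunc psi N) k m = mat psi k m.
Proof.
move=> km; rewrite /trunc ent_sum (bigD1_seq (k, m)) ?uniq_box2//= entZ ent_munit !eqxx.
rewrite !mul1r divfK ?N0_neq0// big1 ?addr0// => -[a b] /= ab.
rewrite entZ ent_munit; have [ka|] := eqVneq k a; last by rewrite !mul0r mulr0.
have [mb|] := eqVneq m b; last by rewrite mulr0 mul0r mulr0.
by move: ab; rewrite ka mb eqxx.
Qed.

Lemma trunc_cvg psi : expansion (trunc psi N) @[N --> \oo] --> psi.
Proof.
apply/dist_cvgP => x; apply: cvg_near_cst.
pose M := (misize (pidx x).1 + misize (pidx x).2)%N.
exists M => // N /= MN; rewrite expansionE /unmat ent_trunc.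
  by rewrite /mat pidxK mulrC mulKf// mcst_neq0.
rewrite mem_box2 !mem_box; apply/andP; split; apply/forallP => y; apply: leq_trans MN.
  by rewrite /M /misize (bigD1 y)//= -addnA leq_addr.
by rewrite /M addnC {1}/misize (bigD1 y)//= -addnA leq_addr.
Qed.

Definition germ psi : set_system A :=
  filter_from (nbhs psi) (fun B => @Dfin R n q `&` @expansion R n q @^-1` B).

Lemma germ_proper psi : ProperFilter (germ psi).
Proof.
apply: filter_from_proper; first last.
  move=> B Bpsi; have /(_ B Bpsi) := @trunc_cvg psi.
  rewrite nbhs_simpl /= => -[N _ HN]; exists (trunc psi N); split.
    exact: Dfin_trunc.
  by apply: HN => /=.
apply: filter_from_filter; first by exists setT; exact: filterT.
move=> B B' HB HB'; exists (B `&` B'); first exact: filterI.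
by move=> f [Df [fB fB']]; split.
Qed.

(** Coordinates converge pointwise along the dense set of finite functions, and a
    finite linear combination of them commutes with the limit: such maps extend
    by continuity, by the same formula. *)
Lemma extend_local (g : A -> D) (T : D -> D) :
  (forall x, exists s : seq (C * didx n),
    (forall f, Dfin f -> g f x = \sum_(p <- s) p.1 * expansion f p.2) /\
    (forall psi, T psi x = \sum_(p <- s) p.1 * psi p.2)) ->
  forall psi, extend g psi = T psi.
Proof.
move=> H psi; have PF := germ_proper psi.
have HT : g @ germ psi --> T psi.
  apply/dist_cvgP => x; have [s [gs ->]] := H x.
  rewrite -[X in X --> _]/((fun f => g f x : CF) @ germ psi).
  have E : expansion f @[f --> germ psi] --> psi.
    by move=> B HB; exists B => // f [].
  have near_g : \forall f \near germ psi, (\sum_(p <- s) p.1 * expansion f p.2 : CF) = g f x.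
    by exists setT; [exact: filterT|move=> f [Df _]; rewrite gs].
  apply: cvg_trans (near_eq_cvg near_g) _.
  elim: s {gs near_g} => [|p s IH].
    rewrite big_nil (_ : (fun _ => _) = cst (0 : CF)); first exact: (@cvg_cst CF).
    by apply/funext => f; rewrite big_nil.
  rewrite big_cons.
  rewrite (_ : (fun _ => _) = (fun f => p.1 * expansion f p.2 : CF) \+
    (fun f => \sum_(p <- s) p.1 * expansion f p.2 : CF)); last first.
    by apply/funext => f; rewrite big_cons.
  apply: cvgD; last exact: IH.
  apply: cvgMl_tmp; exact: (proj1 (@dist_cvgP _ _ psi) E p.2).
exact: (dist_cvg_unique (cvgP _ HT) HT).
Qed.

Lemma ent_mulE f g k m : ent (f * g) k m = \sum_(p \in [set: mi]) ent f k p * ent g p m.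
Proof.
have [r [ur r0 ->]] := ent_mul g m.
rewrite (fsumE ur) => [|p /r0 ->]; last by rewrite mulr0.
by apply: eq_bigr => p _; rewrite mulrC.
Qed.

Lemma int_nuE psi : int_nu q psi =
  qpoch2 q (Q ^+ 2) n * \sum_(m \in [set: mi]) mat psi m m * wx q (xnu n q) m.
Proof.
rewrite /int_nu; congr (_ * _).
transitivity (\sum_(k \in [set k : mi | inP k])
  dcoef psi (mi0 n) (mi0 n) k * \prod_(l < n) (if l == 0%N :> nat
    then Q ^- (2 * n * k l) else Q ^+ (2 * k l))).
  symmetry; apply: fsbig_widen => // k [_ /= /negP Pk].
  by rewrite dcoef_out ?mul0r// negb_and Pk orbT.
rewrite (@reindex_fsbig _ _ _ _ _ (@tails n) setT); last first.
  split.
  - by move=> m _; exact: inP_tails.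
  - by move=> m m' _ _ mm'; rewrite -(tailsK m) mm' tailsK.
  - by move=> k Pk; exists (untails k) => //; rewrite untailsK.
apply: eq_fsbigr => m _; congr (_ * _).
  rewrite dcoef_idx; last by apply/forallP => x; rewrite ffunE.
  rewrite /mat /mcst addmC addm0.
  have -> : minm m m = m by apply/ffunP => x; rewrite ffunE minnn.
  have -> : subm m m = mi0 n by apply/ffunP => x; rewrite !ffunE subnn.
  by rewrite Ccoef0 Dcoef0 !mul1r.
rewrite /wx; apply: eq_bigr => l _; rewrite tailsE /wy /xnu.
by case: eqP => l0; rewrite -?exprVn -?exprM.
Qed.

(** The trace of the product of the two matrices, with the weight of nu_q; by
    [pairingE] this is the pairing up to a constant. *)
Definition mpair psi f : C := \sum_(km \in [set: mi * mi])
  mat psi km.1 km.2 * ent f km.2 km.1 * wx q (xnu n q) km.1.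

Definition square (r : seq mi) : seq (mi * mi) := [seq (k, m) | k <- r, m <- r].

Lemma uniq_square r : uniq r -> uniq (square r).
Proof. by move=> ur; apply: allpairs_uniq => // -[a b] [c d] _ _ /=. Qed.

Lemma mem_square r k m : ((k, m) \in square r) = (k \in r) && (m \in r).
Proof.
apply/allpairsP/andP => [[[a b] /= [? ? [-> ->]]]//|[kN mN]].
by exists (k, m).
Qed.

Lemma mpairE f : Dfin f -> exists r : seq mi, uniq r /\ forall s, uniq s -> {subset r <= s} ->
  forall psi, mpair psi f = \sum_(km <- square s) mat psi km.1 km.2 * ent f km.2 km.1 * wx q (xnu n q) km.1.
Proof.
move=> /Dfin_supp[r [ur r0]]; exists r; split=> // s us rs psi.
apply: fsumE; first exact: uniq_square.
move=> [k m]; rewrite mem_square negb_and => km /=; rewrite r0 ?mulr0 ?mul0r//.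
by rewrite orbC; case/orP: km => km; rewrite (contra (rs _) km) ?orbT.
Qed.

Lemma mpair_Dlin psi : Dlin (mpair psi).
Proof.
move=> c f g Df Dg; have [r [ur Hr]] := mpairE Df; have [s [us Hs]] := mpairE Dg.
have [t [ut Ht]] := mpairE (DfinD (DfinZ c Df) Dg).
pose u := undup (r ++ s ++ t); have uu : uniq u := undup_uniq _.
have su v : {subset v <= r ++ s ++ t} -> {subset v <= u}.
  by move=> H x /H; rewrite mem_undup.
rewrite (Hr u)// ?(Hs u)// ?(Ht u)//; last first.
- by apply: su => x; rewrite !mem_cat => ->.
- by apply: su => x; rewrite !mem_cat => ->; rewrite orbT.
- by apply: su => x; rewrite !mem_cat => ->; rewrite !orbT.
rewrite mulr_sumr -big_split /=; apply: eq_bigr => km _.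
by rewrite ent_lin; ring.
Qed.

Lemma mat_lin (c : C) psi psi' k m : mat (c *: psi + psi') k m = c * mat psi k m + mat psi' k m.
Proof.
rewrite /mat; have -> : (c *: psi + psi') (idx k m) = c * psi (idx k m) + psi' (idx k m) by [].
by ring.
Qed.

Lemma mpair_linl (c : C) psi psi' f : Dfin f -> mpair (c *: psi + psi') f = c * mpair psi f + mpair psi' f.
Proof.
move=> Df; have [r [ur Hr]] := mpairE Df; rewrite !(Hr r)// mulr_sumr -big_split /=.
by apply: eq_bigr => km _; rewrite mat_lin; ring.
Qed.

Lemma mpair_munit psi a b : mpair psi (munit q a b) = mat psi b a * (N0 q b * wx q (xnu n q) b).
Proof.
rewrite /mpair (@fsumE _ _ [:: (b, a)])// ?big_seq1/= ?ent_munit ?eqxx ?mul1r ?mulrA//.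
move=> [k m]; rewrite inE => km /=; rewrite ent_munit.
have [ma|] := eqVneq m a; last by rewrite !(mul0r, mulr0).
have [kb|] := eqVneq k b; last by rewrite !(mul0r, mulr0).
by move: km; rewrite ma kb eqxx.
Qed.

Lemma dmulrE psi (phi : A) k m : Dfin phi ->
  mat (dmulr psi phi) k m = \sum_(p \in [set: mi]) mat psi k p * ent phi p m.
Proof.
move=> Dphi; have [r [ur r0]] := Dfin_supp Dphi.
pose T (chi : D) : D := unmat (fun k m => \sum_(p <- r) mat chi k p * ent phi p m).
have TE chi k' m' : mat (T chi) k' m' = \sum_(p \in [set: mi]) mat chi k' p * ent phi p m'.
  rewrite unmatK; symmetry; apply: fsumE => // p npr; rewrite r0 ?mulr0// npr//.
rewrite -TE; congr (mat _ k m); apply: extend_local => x.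
set u := (pidx x).1; set v := (pidx x).2.
exists [seq (mcst u p * ent phi p v / mcst u v, idx u p) | p <- r]; split.
  move=> f Df; rewrite big_map expansionE /unmat -/u -/v ent_mulE.
  rewrite (fsumE ur) => [|p npr]; last by rewrite r0 ?npr// mulr0.
  rewrite mulr_suml; apply: eq_bigr => p _ /=; rewrite -mat_expansion /mat.
  by move: (expansion _ _) => y; ring.
move=> chi; rewrite big_map /T /unmat -/u -/v mulr_suml; apply: eq_bigr => p _ /=.
by rewrite /mat; ring.
Qed.

Lemma pairingE psi (phi : A) : Dfin phi -> pairing psi phi = qpoch2 q (Q ^+ 2) n * mpair psi phi.
Proof.
move=> Dphi; rewrite /pairing int_nuE; congr (_ * _).
have [r [ur r0]] := Dfin_supp Dphi.
rewrite /mpair (fsumE (uniq_square ur)); last first.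
  move=> [k m]; rewrite mem_square negb_and => km /=.
  by rewrite r0 ?mulr0 ?mul0r// orbC.
rewrite (fsumE ur); last first.
  move=> m mr; rewrite dmulrE// fsbig1 ?mul0r// => p _.
  by rewrite r0 ?mr ?orbT// mulr0.
rewrite big_allpairs; apply: eq_bigr => k _; rewrite dmulrE// (fsumE ur).
  by rewrite mulr_suml.
by move=> p npr; rewrite r0 ?npr// mulr0.
Qed.

Lemma mpair_expansion g (phi : A) : Dfin phi -> mpair (expansion g) phi = wtrace (xnu n q) (g * phi).
Proof.
move=> Dphi; have [r [ur r0]] := Dfin_supp Dphi.
rewrite /mpair (fsumE (uniq_square ur)); last first.
  move=> [k m]; rewrite mem_square negb_and => km /=.
  by rewrite r0 ?mulr0 ?mul0r// orbC.
rewrite /wtrace (fsumE ur); last first.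
  move=> m mr; rewrite ent_mulE fsbig1 ?mul0r// => p _.
  by rewrite r0 ?mr ?orbT// mulr0.
rewrite big_allpairs; apply: eq_bigr => k _; rewrite ent_mulE (fsumE ur).
  by rewrite mulr_suml; apply: eq_bigr => p _; rewrite mat_expansion.
by move=> p npr; rewrite r0 ?npr// mulr0.
Qed.

Lemma qpoch_neq0 : qpoch2 q (Q ^+ 2) n != 0.
Proof.
by apply/prodf_neq0 => i _; rewrite -exprS subQ2_neq0.
Qed.

Lemma xnu_neq0 : xnu n q != 0.
Proof. by rewrite invr_neq0// expf_neq0// Q_neq0. Qed.

Lemma wxnu_neq0 m : wx q (xnu n q) m != 0.
Proof.
apply/prodf_neq0 => i _; rewrite expf_neq0// /wy; case: ifP => _; first exact: xnu_neq0.
by rewrite expf_neq0// Q_neq0.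
Qed.

Lemma mpair_inj psi psi' : (forall f, Dfin f -> mpair psi f = mpair psi' f) -> psi = psi'.
Proof.
move=> H; apply: mat_inj => k m; have := H _ (Dfin_munit q m k); rewrite !mpair_munit.
by move/mulIf; apply; rewrite mulf_neq0 ?N0_neq0 ?wxnu_neq0.
Qed.

(** Every linear functional on finite functions is a distribution, because
    distributions are arbitrary matrices and finite functions have the basis of
    matrix units. *)
Lemma mpair_exists (phi : A -> C) : Dlin phi -> exists psi, forall f, Dfin f -> mpair psi f = phi f.
Proof.
move=> Hphi; exists (unmat (fun k m => phi (munit q m k) / (N0 q k * wx q (xnu n q) k))).
apply: Dlin_eq => //; first exact: mpair_Dlin.
move=> a b; rewrite mpair_munit unmatK divfK// mulf_neq0 ?N0_neq0 ?wxnu_neq0//.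
Qed.

End Distributions.

(** * Duality for the action on distributions *)

Section Dact.
Context (R : realType) (n : nat) (q : R).
Hypothesis (q_gt0 : 0 < q) (q_lt1 : q < 1).
Context (act : Uq n q -> FUn n q -> FUn n q).
Hypothesis (Hact : module_algebra act) (Hgen : module_generators act).
Local Notation C := (R[i])%C.
Local Notation Q := (cq q).
Local Notation D := (dist R n).
Implicit Types (k m : mi n) (f g : FUn n q) (psi : D).

(** The coordinate of xi f at a matrix unit is the pairing of xi f with the opposite
    unit, that is, of f with S(xi) applied to it, since nu_q is invariant.  This is
    a finite combination of coordinates of f, so the same duality holds after
    extension to distributions. *)
Lemma mpair_dact t psi f : Dfin f ->
  mpair (dact act (Ucls q t) psi) f = mpair psi (act (Ucls q (antipode t)) f).
Proof.
pose w k : C := N0 q k * wx q (xnu n q) k.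
have w0 k : w k != 0 by rewrite mulf_neq0 ?N0_neq0 ?wxnu_neq0.
(* w k and h k m give the entry (k, m) of xi psi as the pairing of psi with
   h k m, divided by w k. *)
pose h k m := act (Ucls q (antipode t)) (munit q m k).
have Dh k m : Dfin (h k m) by apply: Dfin_act => //; exact: Dfin_munit.
pose T psi : D := unmat q (fun k m => mpair psi (h k m) / w k).
have -> : dact act (Ucls q t) psi = T psi.
  apply: (extend_local q_gt0 q_lt1) => x.
  set u := (pidx x).1; set v := (pidx x).2.
  have [r [ur Hr]] := mpairE (Dh u v).
  exists [seq (mcst q km.1 km.2 * ent (h u v) km.2 km.1 * wx q (xnu n q) km.1 / w u /
    mcst q u v, idx km.1 km.2) | km <- square r]; split=> [g Dg|chi]; last first.
    rewrite big_map /T /unmat -/u -/v (Hr r)// !mulr_suml; apply: eq_bigr => km _ /=.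
    by rewrite /mat; ring.
  rewrite big_map.
  have -> : expansion (act (Ucls q t) g) x = mpair (expansion g) (h u v) / w u / mcst q u v.
    rewrite expansionE// /unmat -/u -/v; congr (_ / _).
    have <- : mpair (expansion (act (Ucls q t) g)) (munit q v u) = mpair (expansion g) (h u v).
      rewrite !mpair_expansion//; last exact: Dfin_munit.
      exact: (wtrace_form_invariance q_gt0 q_lt1 Hact Hgen t Dg (Dfin_munit q v u)).
    by rewrite mpair_munit mat_expansion// -/(w u) mulfK.
  rewrite (Hr r)// !mulr_suml; apply: eq_bigr => km _ /=.
  by rewrite /mat; ring.
move: f; apply: Dlin_eq; first exact: mpair_Dlin.
  apply: (@Dlin_comp _ _ _ (mpair psi)); [exact: act_lin|exact: Dfin_act|exact: mpair_Dlin].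
by move=> a b; rewrite mpair_munit unmatK// divfK.
Qed.

End Dact.

(** * Norms of monomials *)

Section Series.
Context (R : realType) (n : nat) (q : R).
Hypothesis (q_gt0 : 0 < q) (q_lt1 : q < 1).
Local Notation C := (R[i])%C.
Local Notation CF := (R[i] : numFieldType).
Local Notation Q := (cq q).
Local Notation mi := (mi n).
Implicit Types (k m p : mi) (i j l : 'I_n).

Lemma cvg_geo (y : C) : 0 <= y -> y < 1 -> (fun N : nat => y ^+ N : CF) @ \oo --> (0 : CF).
Proof.
move=> y0 y1; apply/cvgrPdist_lt => e; rewrite ltcE => /andP[/eqP /= e1 e0].
move: (y0) (y1); rewrite lecE ltcE /= => /andP[/eqP i0 r0] /andP[_ r1].
have yE : y = ((complex.Re y)%:C)%C by move: i0; case: (y) => a b /= ->.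
have eE : e = ((complex.Re e)%:C)%C by move: e1; case: (e) => a b /= ->.
have : (GRing.exp (complex.Re y) : nat -> R) @ \oo --> (0 : R).
  by apply: cvg_expr; rewrite ger0_norm.
move=> /cvgrPdist_lt/(_ _ e0) [N _ HN]; exists N => // M /HN.
rewrite /= !sub0r !normrN => H.
rewrite ger0_norm ?exprn_ge0// yE eE -rmorphXn /= ltcR.
by apply: le_lt_trans H; exact: ler_norm.
Qed.

(** The q-binomial series sum_a (q^{2(a+1)};q^2)_k y^a = (q^2;q^2)_k / (y;q^2)_{k+1},
    by induction on k: its left side G_k satisfies
    G_{k+1}(y) = G_k(y) - q^{2(k+1)} G_k(q^2 y), as the last factor of the
    coefficient of G_{k+1} is 1 - q^{2(a+k+1)}. *)
Lemma cvg_series1 (k : nat) (y : C) : 0 <= y -> y < 1 ->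
  (fun N : nat => \sum_(a < N) qrise q a k * y ^+ a : CF) @ \oo -->
    (qrise q 0 k / Dden q y k.+1 : CF).
Proof.
elim: k y => [|k IH] y y0 y1.
  have y1' : 1 - y != 0 by rewrite subr_eq0 eq_sym lt_eqF.
  have -> : qrise q 0 0 / Dden q y 1 = (1 - 0) * (1 - y)^-1.
    by rewrite /qrise /Dden big_ord0 big_ord_recl big_ord0 expr0 !mulr1 subr0.
  rewrite (_ : (fun _ => _) = (fun N : nat => (1 - y ^+ N) * (1 - y)^-1 : CF)); last first.
    apply/funext => N; rewrite -[1 - y ^+ N]opprB subrX1 -mulNr opprB mulrAC divff ?mul1r//.
    by apply: eq_bigr => a _; rewrite /qrise big_ord0 mul1r.
  apply: cvgM; last exact: cvg_cst.
  by apply: cvgB; [exact: cvg_cst|exact: cvg_geo].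
have Q20 : 0 <= Q ^+ 2 by rewrite exprn_ge0// ltW// Q_gt0.
have Qy0 : 0 <= Q ^+ 2 * y by rewrite mulr_ge0.
have Qy1 : Q ^+ 2 * y < 1.
  apply: le_lt_trans y1; rewrite ler_piMl// -[Q ^+ 2]expr1 ltW//.
  exact: Q2_lt1.
rewrite (_ : (fun _ => _) = (fun N : nat => (\sum_(a < N) qrise q a k * y ^+ a) -
    Q ^+ 2 ^+ k.+1 * (\sum_(a < N) qrise q a k * (Q ^+ 2 * y) ^+ a) : CF)); last first.
  apply/funext => N; rewrite mulr_sumr -sumrB; apply: eq_bigr => a _.
  rewrite qriseS -addnS exprD [(Q ^+ 2 * y) ^+ a]exprMn; move: (Q ^+ 2 ^+ k.+1) (Q ^+ 2 ^+ a) => u v.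
  by ring.
have Dden_neq0 x s : 0 <= x -> x < 1 -> Dden q x s != 0.
  move=> x0 x1; apply/prodf_neq0 => t _; rewrite gt_eqF// subr_gt0.
  apply: le_lt_trans x1; rewrite ler_piMr// exprn_ile1//.
  by rewrite -[Q ^+ 2]expr1 ltW// Q2_lt1.
have -> : qrise q 0 k.+1 / Dden q y k.+2 = qrise q 0 k / Dden q y k.+1 -
    Q ^+ 2 ^+ k.+1 * (qrise q 0 k / Dden q (Q ^+ 2 * y) k.+1).
  have DL s : Dden q y s.+1 = (1 - y) * Dden q (Q ^+ 2 * y) s.
    rewrite /Dden big_ord_recl /= expr0 mulr1; congr (_ * _); apply: eq_bigr => t _.
    by rewrite /bump /= add1n exprS mulrCA mulrA.
  have := Dden_neq0 _ k.+2 y0 y1; rewrite qriseS add0n [Dden q y k.+2]DdenS !DL DdenS.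
  have -> : Q ^+ 2 * y * Q ^+ 2 ^+ k = y * Q ^+ 2 ^+ k.+1.
    by rewrite (exprS _ k) mulrCA mulrA.
  move: (Q ^+ 2 ^+ k.+1) (qrise q 0 k) (Dden q (Q ^+ 2 * y) k) => u r D'.
  rewrite !mulf_eq0 !negb_or => /andP[/andP[a0 b0] c0].
  by field; rewrite a0 b0 c0.
apply: cvgB; first exact: IH.
apply: cvgMl_tmp; exact: IH.
Qed.

Lemma cvg_bigprod (I : Type) (r : seq I) (u : I -> nat -> CF) (s : I -> CF) :
  (forall x, u x @ \oo --> s x) ->
  (fun N : nat => \prod_(x <- r) u x N : CF) @ \oo --> (\prod_(x <- r) s x : CF).
Proof.
move=> us; elim: r => [|x r IH].
  rewrite big_nil (_ : (fun _ => _) = cst (1 : CF)); first exact: (@cvg_cst CF).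
  by apply/funext => N; rewrite big_nil.
rewrite big_cons (_ : (fun _ => _) = (u x) \* (fun N => \prod_(y <- r) u y N : CF)); last first.
  by apply/funext => N; rewrite big_cons.
exact: (cvgM (us x) IH).
Qed.

Lemma sum_box (F : 'I_n -> nat -> C) N :
  \sum_(m <- box n N) \prod_(x < n) F x (m x) = \prod_(x < n) \sum_(a < N.+1) F x a.
Proof.
rewrite bigA_distr_bigA /=.
rewrite /box undup_id; last first.
  rewrite map_inj_uniq ?enum_uniq// => g h /ffunP gh; apply/ffunP => x.
  by apply: val_inj; have := gh x; rewrite !ffunE.
rewrite big_image /=; apply: eq_bigr => g _; apply: eq_bigr => x _.
by rewrite ffunE.
Qed.

Lemma DdenD x (s t : nat) : Dden q x (s + t) = Dden q x s * Dden q (x * Q ^+ 2 ^+ s) t.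
Proof.
rewrite /Dden big_split_ord /=; congr (_ * _).
by apply: eq_bigr => y _; rewrite exprD mulrA.
Qed.

(** The factors (x q^{2(y + k_1 + ... + k_{y-1})};q^2)_{k_y + 1} are consecutive
    pieces of a single q-shifted factorial. *)
Lemma Dden_telescope x N (kk : 'I_N -> nat) :
  \prod_(y < N) Dden q (x * Q ^+ 2 ^+ (y + \sum_(l < N | (l < y)%N) kk l)) (kk y).+1 =
  Dden q x (N + \sum_(l < N) kk l).
Proof.
elim: N kk => [|N IH] kk; first by rewrite !big_ord0 /Dden big_ord0.
rewrite big_ord_recr /= [in RHS]big_ord_recr /=.
have -> : (N.+1 + (\sum_(l < N) kk (widen_ord (leqnSn N) l) + kk ord_max) =
  (N + \sum_(l < N) kk (widen_ord (leqnSn N) l)) + (kk ord_max).+1)%N by lia.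
rewrite DdenD -IH; congr (_ * _).
  apply: eq_bigr => y _; congr (Dden _ (_ * _ ^+ (_ + _)) _).
  rewrite [LHS]big_mkcond big_ord_recr /= ltnNge (ltnW (ltn_ord y)) /= addn0.
  by rewrite [RHS]big_mkcond.
congr (Dden _ (_ * _ ^+ (_ + _)) _).
rewrite big_mkcond big_ord_recr /= ltnn addn0; apply: eq_bigr => y _.
by rewrite /= ltn_ord.
Qed.

Definition headsum (t : nat) k : nat := (\sum_(l < n | (l < t)%N) k l)%N.

Lemma wx_prod x m : wx q x m = \prod_(y < n) (x * Q ^+ 2 ^+ y) ^+ m y.
Proof.
elim/mi_ind: m => [|i m mi IH].
  rewrite /wx !big1// => l _; rewrite ?ffunE ?tailsum0//.
rewrite wx_inc IH; symmetry.
exact: (@prod_inc R n (fun y s => (x * Q ^+ 2 ^+ y) ^+ s) i m _ (exprS _ _)).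
Qed.

Lemma cexp_prod k m : Q ^+ 2 ^+ cexp k m = \prod_(y < n) (Q ^+ 2 ^+ headsum y k) ^+ m y.
Proof.
elim/mi_ind: m => [|i m mi IH].
  by rewrite cexp_0 expr0 big1// => l _; rewrite ffunE.
have -> : cexp k (inc i m) = (headsum i k + cexp k m)%N.
  rewrite /cexp /headsum [X in (X + _)%N]big_mkcond /= -big_split /=; apply: eq_bigr => l _.
  by rewrite tailsum_inc mulnDr addnC; case: (l < i)%N; rewrite ?muln1 ?muln0.
rewrite exprD IH; symmetry.
exact: (@prod_inc R n (fun y s => (Q ^+ 2 ^+ headsum y k) ^+ s) i m _ (exprS _ _)).
Qed.

(** The exponents that couple the m_y turn into a shift of the variable of the y-th
    factor, by the sum of the k_l with l < y. *)
Lemma norm_term x k m : Ccoef q k m * Dcoef q k m * wx q x m =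
  \prod_(y < n) (qrise q (m y) (k y) * (x * Q ^+ 2 ^+ (y + headsum y k)) ^+ m y).
Proof.
rewrite big_split /= /Dcoef mulrA -expr2 exprAC cexp_prod wx_prod -mulrA mulrC -mulrA.
congr (_ * _); rewrite -big_split /=; apply: eq_bigr => y _.
by rewrite exprD mulrA -exprMn.
Qed.

(** Over a box the sum is a product of n one-dimensional sums. *)
Lemma norm_sum x k : 0 < x -> x < 1 ->
  (fun N : nat => \sum_(m <- box n N) (Ccoef q k m * Dcoef q k m * wx q x m) : CF) @ \oo -->
  (N0 q k / Dden q x (n + misize k) : CF).
Proof.
move=> x0 x1.
have -> : N0 q k / Dden q x (n + misize k) = \prod_(y < n)
    (qrise q 0 (k y) / Dden q (x * Q ^+ 2 ^+ (y + headsum y k)) (k y).+1).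
  by rewrite prodf_div; congr (_ / _); rewrite -Dden_telescope.
rewrite (_ : (fun _ => _) = (fun N => \prod_(y < n) (\sum_(a < N.+1)
    qrise q a (k y) * (x * Q ^+ 2 ^+ (y + headsum y k)) ^+ a) : CF)); last first.
  apply/funext => N.
  rewrite -(sum_box (fun y a => qrise q a (k y) * (x * Q ^+ 2 ^+ (y + headsum y k)) ^+ a)).
  by apply: eq_bigr => m _; exact: norm_term.
apply: (@cvg_bigprod _ _ (fun y N => \sum_(a < N.+1)
  qrise q a (k y) * (x * Q ^+ 2 ^+ (y + headsum y k)) ^+ a)) => y.
set w := x * _.
have Q20 : 0 <= Q ^+ 2 ^+ (y + headsum y k) by rewrite !exprn_ge0// ltW// Q_gt0.
have w0 : 0 <= w by rewrite mulr_ge0// ltW.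
have w1 : w < 1.
  apply: le_lt_trans x1; rewrite ler_piMr ?(ltW x0)// exprn_ile1//.
    by rewrite exprn_ge0// ltW// Q_gt0.
  by rewrite -[Q ^+ 2]expr1 ltW// Q2_lt1.
have := @cvg_series1 (k y) w w0 w1.
by rewrite -(cvg_shiftS (fun N : nat => \sum_(a < N) qrise q a (k y) * w ^+ a : CF)).
Qed.

Lemma ler_sum_sub (I : eqType) (r s : seq I) (G : I -> C) :
  uniq r -> uniq s -> (forall x, x \in r -> x \notin s -> G x = 0) ->
  (forall x, 0 <= G x) -> \sum_(x <- r) G x <= \sum_(x <- s) G x.
Proof.
move=> ur us rs G0; rewrite (bigID [in s]) /= [X in _ + X <= _]big1_seq; last first.
  by move=> x /andP[xs xr]; exact: rs.
rewrite addr0 [leRHS](bigID [in r]) /= -[X in X <= _]big_filter -[X in _ <= X + _]big_filter.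
rewrite (perm_big [seq x <- s | x \in r]); last first.
  apply: uniq_perm; rewrite ?filter_uniq// => x.
  by rewrite !mem_filter andbC.
by rewrite lerDl sumr_ge0.
Qed.

(** Every finite set is eventually contained in r N, up to zero terms.  By
    positivity its sum is at most s, while the sums over r N tend to s, so the
    net of all finite sums has the same limit. *)
Lemma sum_cvg (I : choiceType) (G : I -> C) (s : C) (r : nat -> seq I) :
  (forall N, uniq (r N)) ->
  (forall x, 0 <= G x) -> s \is Num.real ->
  (forall A : seq I, exists M, forall N, (M <= N)%N ->
     forall x, x \in A -> x \notin r N -> G x = 0) ->
  (fun N : nat => \sum_(x <- r N) G x : CF) @ \oo --> (s : CF) ->
  @sum I C C^o G = s.
Proof.
move=> ur G0 sR cof /cvgrPdist_lt rs.
have GR (t : seq I) : \sum_(x <- t) G x \is Num.real by rewrite ger0_real// sumr_ge0.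
have ub (t : seq I) : uniq t -> \sum_(x <- t) G x <= s.
  move=> ut; rewrite real_leNgt//; apply/negP => ts.
  have [N _ HN] := rs _ (eq_rect_r (fun b => is_true b) ts (subr_gt0 s (\sum_(x <- t) G x))).
  have [M HM] := cof t.
  have := HN (maxn N M) (leq_maxl _ _); rewrite /= => H.
  have tr : \sum_(x <- t) G x <= \sum_(x <- r (maxn N M)) G x.
    by apply: ler_sum_sub => //; apply: HM; rewrite leq_maxr.
  have := lt_le_trans ts tr; rewrite -subr_lt0 => sr.
  move: H; rewrite ltr0_norm// opprB ltrD2r => /(le_lt_trans tr).
  by rewrite ltxx.
have PF := @totally_filter I.
apply: (@cvg_lim C^o (@norm_hausdorff _ C^o)); apply/cvgrPdist_lt => e e0.
have [N _ HN] := rs e e0; have := HN N (leqnn N) => /= H.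
exists [fset x in r N]%fset => // A /= rA.
have SA : partial_sum G A = \sum_(x <- A) G x by rewrite [RHS]big_seq_fsetE.
rewrite SA; have uA : uniq A := fset_uniq A.
have rAs : \sum_(x <- r N) G x <= \sum_(x <- A) G x.
  apply: ler_sum_sub => // x xr; rewrite (fsubsetP rA)// inE//.
rewrite ger0_norm ?subr_ge0 ?ub//; apply: le_lt_trans H.
by rewrite ger0_norm ?subr_ge0 ?ub// lerD2l lerN2.
Qed.

Lemma sum_finite (I : choiceType) (G : I -> C) (r : seq I) : uniq r ->
  (forall x, x \notin r -> G x = 0) -> @sum I C C^o G = \sum_(x <- r) G x.
Proof.
move=> ur G0; have PF := @totally_filter I.
apply: (@cvg_lim C^o (@norm_hausdorff _ C^o)).
apply: cvg_near_cst; exists [fset x in r]%fset => // A /= rA.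
have -> : partial_sum G A = \sum_(x <- A) G x by rewrite [RHS]big_seq_fsetE.
rewrite -(fsumE (fset_uniq A)); last first.
  by move=> x xA; apply: G0; apply: contra xA => xr; apply: (fsubsetP rA); rewrite inE.
by rewrite (fsumE ur).
Qed.

Section Integral.
Context (alpha : R).
Hypothesis alpha_gt0 : 0 < alpha.

(** The value of x for dm_{alpha,q}. *)
Definition xal : C := rq q (2 * alpha + 2).

Lemma xal_gt0 : 0 < xal. Proof. by rewrite /xal /rq ltcR powR_gt0. Qed.

Lemma xal_lt1 : xal < 1.
Proof.
rewrite /xal /rq (ltcR _ 1); apply: le_lt_trans q_lt1.
apply: ge1r_powR; first by rewrite q_gt0 ltW.
by rewrite -[leLHS]add0r lerD ?mulr_ge0 ?ler1n ?(ltW alpha_gt0).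
Qed.

Lemma rq_weight (N : nat) : rq q (2 * N%:R * (alpha + 1)) = xal ^+ N.
Proof.
rewrite /xal /rq -rmorphXn /=; congr ((_)%:C)%C.
rewrite -powR_mulrn ?powR_ge0// -powRrM; congr (_ `^ _); ring.
Qed.

Definition mconst : C := Dden q xal n.

Definition mterm (f : FUn n q) (k : mi) : C := if inP k then
  ent f (untails k) (untails k) * wx q xal (untails k) else 0.

Lemma mterm_tails (f : FUn n q) m : mterm f (tails m) = ent f m m * wx q xal m.
Proof. by rewrite /mterm inP_tails tailsK. Qed.

(** The sum over k in P(n) is a sum over all multi-indices m, with k the sequence of
    tails of m: the integral of any f is its weighted trace. *)
Lemma int_mE (f : FUn n q) : int_m alpha f = mconst * @sum mi C C^o (mterm f).
Proof.
rewrite /int_m; congr (_ * (@sum _ C C^o _)); apply/funext => k; rewrite /mterm.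
case: ifPn => Pk; last by rewrite dcoef_out ?mul0r// negb_and Pk orbT.
rewrite -{1 2 3}(untailsK Pk) dcoef_idx; last by apply/forallP => x; rewrite ffunE.
move: (untails k) => m; congr (_ * _).
  have <- := mat_expansion q_gt0 q_lt1 f m m.
  rewrite /mat /mcst addmC addm0.
  have -> : minm m m = m by apply/ffunP => x; rewrite ffunE minnn.
  have -> : subm m m = mi0 n by apply/ffunP => x; rewrite !ffunE subnn.
  by rewrite Ccoef0 Dcoef0 !mul1r.
rewrite /wx; apply: eq_bigr => l _; rewrite !tailsE /wy.
by case: eqP => l0; [rewrite rq_weight|rewrite exprM].
Qed.

Lemma int_m_Dfin (f : FUn n q) : Dfin f -> int_m alpha f = mconst * wtrace xal f.
Proof.
move=> Df; have [r [ur r0]] := Dfin_supp Df.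
rewrite int_mE; congr (_ * _).
have ur' : uniq [seq tails m | m <- r].
  by rewrite map_inj_uniq// => m m' mm'; rewrite -(tailsK m) mm' tailsK.
rewrite (sum_finite ur') => [|k kr]; last first.
  rewrite /mterm; case: ifP => // Pk; rewrite r0 ?mul0r//.
  rewrite orbb; apply: contra kr => kr; apply/mapP; exists (untails k) => //.
  by rewrite untailsK.
rewrite big_map /wtrace (fsumE ur) => [|m mr]; last by rewrite r0 ?mr// mul0r.
by apply: eq_bigr => m _; exact: mterm_tails.
Qed.

Lemma ent_1 k m : ent (1 : FUn n q) k m = (k == m)%:R.
Proof. by rewrite /ent rho1. Qed.

Lemma ent_zz k m p : ent (zsmon q k * zmon q m) p p =
  (k == m)%:R * (Ccoef q k p * Dcoef q k p).
Proof.
have := ent_sandwich (1 : FUn n q) m k p p; rewrite mulr1 => ->; rewrite ent_1.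
have -> : (addm k p == addm m p) = (k == m).
  apply/eqP/eqP => [/ffunP H|->//]; apply/ffunP => x.
  by have := H x; rewrite !ffunE => /addIn.
by case: (k =P m) => [->|_]; rewrite ?mulr0 ?mul0r// mulr1 mul1r mulrC.
Qed.

Lemma int_m_off k m : k != m -> int_m alpha (zsmon q k * zmon q m) = 0.
Proof.
move=> km; rewrite int_mE (@sum_finite _ _ [::])// ?big_nil ?mulr0// => p _.
by rewrite /mterm; case: ifP => // _; rewrite ent_zz (negbTE km) !mul0r.
Qed.

Lemma Ccoef_ge0 k p : 0 <= Ccoef q k p.
Proof. by rewrite exprn_ge0// ltW// Q_gt0. Qed.

Lemma Dcoef_ge0 k p : 0 <= Dcoef q k p.
Proof.
rewrite mulr_ge0 ?Ccoef_ge0// prodr_ge0// => y _.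
by rewrite ltW// qrise_gt0.
Qed.

Lemma wx_ge0 x m : 0 <= x -> 0 <= wx q x m.
Proof.
move=> x0; apply: prodr_ge0 => y _; rewrite exprn_ge0// /wy; case: ifP => // _.
by rewrite exprn_ge0// ltW// Q_gt0.
Qed.

Lemma Dden_gt0 x s : 0 <= x -> x < 1 -> 0 < Dden q x s.
Proof.
move=> x0 x1; apply: prodr_gt0 => t _; rewrite subr_gt0.
apply: le_lt_trans x1; rewrite ler_piMr// exprn_ile1//.
  by rewrite exprn_ge0// ltW// Q_gt0.
by rewrite -[Q ^+ 2]expr1 ltW// Q2_lt1.
Qed.

Lemma int_m_norm k :
  int_m alpha (zsmon q k * zmon q k) = mconst * Nx q xal k.
Proof.
have x1 := xal_lt1; have x0 := xal_gt0.
have Et m : mterm (zsmon q k * zmon q k) (tails m) = Ccoef q k m * Dcoef q k m * wx q xal m.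
  by rewrite mterm_tails ent_zz eqxx mul1r.
rewrite int_mE; congr (_ * _).
apply: (@sum_cvg _ _ _ (fun N => [seq tails m | m <- box n N])).
- move=> N; rewrite map_inj_uniq ?uniq_box// => m m' mm'.
  by rewrite -(tailsK m) mm' tailsK.
- move=> p; have [Pp|Pp] := boolP (inP p); last by rewrite /mterm (negbTE Pp).
  rewrite -(untailsK Pp) Et; apply: mulr_ge0; last by apply: wx_ge0; exact: ltW.
  by apply: mulr_ge0; [exact: Ccoef_ge0|exact: Dcoef_ge0].
- rewrite ger0_real// /Nx divr_ge0// ltW ?N0_gt0// Dden_gt0// ltW//.
- move=> A; exists (\sum_(p <- A) misize p)%N => N AN p pA.
  apply: contraNeq; rewrite /mterm; case: ifPn; rewrite ?eqxx// => Pp _.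
  apply/mapP; exists (untails p); last by rewrite untailsK.
  rewrite mem_box; apply/forallP => y; apply: leq_trans AN.
  rewrite (big_rem _ pA) /= (leq_trans _ (leq_addr _ _))//.
  by rewrite ffunE (leq_trans (leq_subr _ _))// /misize (bigD1 y)//= leq_addr.
rewrite (_ : (fun _ => _) = (fun N : nat => \sum_(m <- box n N)
    (Ccoef q k m * Dcoef q k m * wx q xal m) : CF)); first exact: norm_sum.
by apply/funext => N; rewrite big_map; apply: eq_bigr => m _; exact: Et.
Qed.

End Integral.

End Series.

(** * Toeplitz operators and the Berezin transform *)

Section Toeplitz.
Context (R : realType) (n : nat) (q alpha : R).
Hypothesis (n_gt0 : (0 < n)%N) (q_gt0 : 0 < q) (q_lt1 : q < 1) (alpha_gt0 : 0 < alpha).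
Context (L : L2space n q alpha).
Local Notation C := (R[i])%C.
Local Notation Q := (cq q).
Local Notation mi := (mi n).
Local Notation A := (FUn n q).
Local Notation zmon := (zmon q).
Local Notation zsmon := (zsmon q).
Local Notation X := (xal q alpha).
Local Notation K := (mconst n q alpha).
Local Notation emb := (@emb R n q alpha L).
Implicit Types (k m p : mi) (f g : A) (x y u v : L).

Lemma dotDl x y v : dot (x + y) v = dot x v + dot y v.
Proof. by have := dot_linear 1 x y v; rewrite scale1r mul1r. Qed.

Lemma dot0l v : dot (0 : L) v = 0.
Proof.
have := dot_linear (-1) (0 : L) 0 v; rewrite scaler0 addr0 mulN1r => H.
by rewrite -[LHS]/(dot 0 v) H addNr.
Qed.

Lemma dotZl (c : C) x v : dot (c *: x) v = c * dot x v.
Proof. by have := dot_linear c x 0 v; rewrite dot0l !addr0. Qed.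

Lemma dotBl x y v : dot (x - y) v = dot x v - dot y v.
Proof. by rewrite dotDl -scaleN1r dotZl mulN1r. Qed.

Lemma dotDr x y v : dot v (x + y) = dot v x + dot v y.
Proof. by rewrite dot_conj dotDl rmorphD /= -!dot_conj. Qed.

Lemma dotZr (c : C) x v : dot v (c *: x) = c^* * dot v x.
Proof. by rewrite dot_conj dotZl rmorphM /= -dot_conj. Qed.

Lemma dotBr x y v : dot v (x - y) = dot v x - dot v y.
Proof. by rewrite dot_conj dotBl rmorphB /= -!dot_conj. Qed.

Lemma dot_ge0 x : 0 <= dot x x. Proof. by rewrite -dot_norm exprn_ge0. Qed.

Lemma dot_eq0 x : dot x x = 0 -> x = 0.
Proof. by rewrite -dot_norm => /eqP; rewrite expf_eq0 /= normr_eq0 => /eqP. Qed.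

Lemma cauchy_schwarz y u : dot u y * (dot u y)^* <= dot y y * dot u u.
Proof.
have [->|y0] := eqVneq y 0; first by rewrite [dot u 0]dot_conj !dot0l rmorph0 !mul0r.
have Y0 : 0 < dot y y.
  by rewrite lt_def dot_ge0 andbT; apply: contra_neq y0 => /dot_eq0.
have Yr : (dot y y)^* = dot y y by rewrite -dot_conj.
have := dot_ge0 (dot y y *: u - dot u y *: y).
rewrite dotBl !dotZl !dotBr !dotZr Yr.
rewrite [dot y u]dot_conj.
set b := dot u y; set Y := dot y y; set U := dot u u.
have -> : Y * (Y * U - b^* * b) - b * (Y * b^* - b^* * Y) = Y * (Y * U - b * b^*) by ring.
by rewrite pmulr_rge0// subr_ge0.
Qed.

(** Orthogonality to a set passes to its closure, by the Cauchy-Schwarz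
    inequality. *)
Lemma dot_closure (S : set L) y : (forall v, S v -> dot y v = 0) ->
  forall v, closure S v -> dot y v = 0.
Proof.
move=> yS v Sv; apply/eqP; apply: contrapT => /negP a0.
have y0 : y != 0 by apply: contraNneq a0 => ->; rewrite dot0l.
have ny : 0 < `|y| by rewrite normr_gt0.
have na : 0 < `|dot y v| by rewrite normr_gt0.
have e0 : 0 < `|dot y v| / (2 * `|y|) by rewrite divr_gt0// mulr_gt0.
have [w [Sw]] := Sv _ (nbhsx_ballx v _ e0).
rewrite -ball_normE /= => vw.
have := cauchy_schwarz y (v - w).
have -> : dot (v - w) y = (dot y v)^* by rewrite dot_conj dotBr (yS w)// subr0.
rewrite conjCK [_ * dot y v]mulrC -normCK -!dot_norm -exprMn.
rewrite ler_pXn2r ?nnegrE ?mulr_ge0// => H.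
have : `|y| * `|v - w| < `|dot y v|.
  rewrite mulrC -ltr_pdivlMr//; apply: lt_le_trans vw _.
  rewrite ler_pM2l// lef_pV2 ?posrE ?mulr_gt0//.
  by rewrite ler_peMl ?ler1n// ltW.
by move=> /(le_lt_trans H); rewrite ltxx.
Qed.

Definition holoL : set L := emb @` @holo R n q.

Lemma P_alphaE x (p : L) : closure holoL p -> (forall v, holoL v -> dot (x - p) v = 0) ->
  P_alpha x = p.
Proof.
move=> Sp Hp; apply: xget_unique => /=; first by split=> //; exact: dot_closure.
move=> p' [Sp' Hp'].
have E v : closure holoL v -> dot (p' - p) v = 0.
  move=> Sv; have -> : p' - p = (x - p) - (x - p') by rewrite opprB [RHS]addrC addrA subrK.
  by rewrite dotBl Hp' // (dot_closure Hp) // subrr.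
by apply/eqP; rewrite -subr_eq0; apply/eqP/dot_eq0; rewrite dotBr !E// subrr.
Qed.

Lemma emb0 : emb 0 = 0.
Proof.
have := emb_linear L (-1) 0 0; rewrite scaler0 addr0 scaleN1r => ->.
by rewrite addNr.
Qed.

Lemma K_neq0 : K != 0.
Proof. by rewrite gt_eqF// Dden_gt0// ?xal_lt1// ltW// xal_gt0. Qed.

Lemma Dden_neq0 s : Dden q X s != 0.
Proof. by rewrite gt_eqF// Dden_gt0// ?xal_lt1// ltW// xal_gt0. Qed.

Lemma N_neq0 k : Nx q X k != 0. Proof. exact: (Nx_neq0 q_gt0 q_lt1 k Dden_neq0). Qed.

Lemma dot_zmon k m : dot (emb (zmon k)) (emb (zmon m)) = (k == m)%:R * (K * Nx q X k).
Proof.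
rewrite emb_dot /ip_m star_zmon; case: (eqVneq k m) => [->|km].
  by rewrite int_m_norm// mul1r.
by rewrite int_m_off ?mul0r// eq_sym.
Qed.

Lemma dot_Dfin f m : Dfin f -> dot (emb f) (emb (zmon m)) = K * wtrace X (zsmon m * f).
Proof. by move=> Df; rewrite emb_dot /ip_m star_zmon int_m_Dfin//; exact: Dfin_mull. Qed.

Lemma dot_holo h m : holo h -> dot (emb h) (emb (zmon m)) = co h m * (K * Nx q X m).
Proof.
move/holo_lspan; move: h; apply: lspan_ind.
  by rewrite emb0 dot0l /co ent0 mul0r.
move=> c k h IH; rewrite emb_linear dot_linear IH co_lin co_zmon dot_zmon /delta.
by rewrite mulrDl mulrA (eq_sym m); case: eqP => [->|_]; rewrite ?mulr0 ?mul0r.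
Qed.

Lemma emb_holo_inj h h' : holo h -> holo h' -> emb h = emb h' -> h = h'.
Proof.
move=> Hh Hh' hh'; apply: (@zmon_eq R n q); [exact/holo_lspan|exact/holo_lspan|].
move=> m; have := dot_holo m Hh; rewrite hh' dot_holo// => /mulIf E; apply/esym/E.
by rewrite mulf_neq0 ?K_neq0 ?N_neq0.
Qed.

Lemma holo_sum (J : Type) (r : seq J) (c : J -> C) (F : J -> mi) :
  holo (\sum_(x <- r) c x *: zmon (F x)).
Proof.
apply/holo_lspan; apply: lspan_sum => x _; apply: lspanZ; exact: (lspan_gen zmon).
Qed.

(** For f finite, only finitely many scalar products of f psi with monomials are
    nonzero, so the projection of f psi is a polynomial, given by its Fourier
    coefficients. *)
Lemma toeplitzP f psi : Dfin f -> holo (toeplitz L f psi) /\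
  forall k, co (toeplitz L f psi) k = wtrace X (zsmon k * (f * psi)) / Nx q X k.
Proof.
move=> Df; have Dg : Dfin (f * psi) by exact: Dfin_mulr.
set g := f * psi in Dg *.
have [N HN] := tcoef_supp X Dg.
have supp k : k \notin box n N -> wtrace X (zsmon k * g) = 0.
  move=> kN; have := HN (mi0 n) k; rewrite /tcoef zmon0 mulr1 => -> //.
  by rewrite kN orbT.
pose t := \sum_(k <- box n N) (wtrace X (zsmon k * g) / Nx q X k) *: zmon k.
have ht : holo t by exact: holo_sum.
have cot k : co t k = wtrace X (zsmon k * g) / Nx q X k.
  rewrite /co ent_sum.
  have E i : ent ((wtrace X (zsmon i * g) / Nx q X i) *: zmon i) k (mi0 n) =
      wtrace X (zsmon i * g) / Nx q X i * (k == i)%:R.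
    by rewrite entZ -/(co _ _) co_zmon.
  under eq_bigr do rewrite E.
  have [kN|kN] := boolP (k \in box n N).
    rewrite (bigD1_seq k) ?uniq_box//= eqxx mulr1 big1 ?addr0// => i ik.
    by rewrite eq_sym (negbTE ik) mulr0.
  rewrite supp// mul0r big1_seq// => i /= iN.
  by case: eqP => [e|_]; rewrite ?mulr0//; rewrite e iN in kN.
have Pt : P_alpha (emb g) = emb t.
  apply: P_alphaE; first by apply: subset_closure; exists t.
  move=> _ [h Hh <-]; move/holo_lspan: Hh; move: h; apply: lspan_ind.
    by rewrite emb0 dot_conj dot0l rmorph0.
  move=> c m h IH; rewrite emb_linear dotDr IH addr0 dotZr dotBl dot_Dfin// dot_holo// cot.
  by rewrite mulrCA divfK ?N_neq0// subrr mulr0.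
suff -> : toeplitz L f psi = t by [].
apply: xget_unique => /= [|h [Hh hE]]; first by split.
by apply: emb_holo_inj => //; rewrite hE Pt.
Qed.

Lemma entryE (T : A -> A) m k : holo (T (zmon m)) -> entry T m k = co (T (zmon m)) k.
Proof.
move=> HT; rewrite /entry (coord_inE (u := zmon))//; first exact: co_zmon.
exact/holo_lspan.
Qed.

Lemma entry_toeplitz2 f g m : Dfin f -> Dfin g ->
  entry (toeplitz L g \o toeplitz L f) m m =
  \sum_(k \in [set: mi]) tcoef X f m k / Nx q X k * (tcoef X g k m / Nx q X m).
Proof.
move=> Df Dg; have [hT cT] := toeplitzP (zmon m) Df.
have [hT2 cT2] := toeplitzP (toeplitz L f (zmon m)) Dg.
rewrite entryE//= cT2.
have [r [ur r0 TE]] := lspanE (@co_lin R n q) (@co_zmon R n q) ((holo_lspan _).1 hT).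
rewrite {1}TE mulrA mulr_sumr.
rewrite (fsumE ur) => [|k /r0]; last by rewrite cT mulrA /tcoef => ->; rewrite mul0r.
have Dk k : Dfin (zsmon m * g * zmon k) by exact: Dfin_mul3.
have -> : wtrace X (\sum_(k <- r) zsmon m * g * (co (toeplitz L f (zmon m)) k *: zmon k)) =
    \sum_(k <- r) co (toeplitz L f (zmon m)) k * tcoef X g k m.
  elim: r {ur r0 TE} => [|k r IH]; first by rewrite !big_nil wtrace0.
  rewrite !big_cons -FsAr wtrace_lin ?IH//.
  by elim/big_ind: _ => [||i _]; [exact: Dfin0|exact: DfinD|rewrite -FsAr; apply: DfinZ].
rewrite mulr_suml; apply: eq_bigr => k _; rewrite cT mulrA.
by rewrite -mulrA.
Qed.

Definition Tconst : C := qpoch2 q (Q ^+ 2) n / qpoch2 q (rq q (2 + 2 * alpha)) n.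

Lemma Trq_weight m : Q ^- (2 * n * misize m) *
  \prod_(l < n | (0 < l)%N) Q ^+ (2 * tails m l) = wx q (xnu n q) m.
Proof.
rewrite /wx [RHS](bigD1 (Ordinal n_gt0))//= misize_tailsum /wy /= /xnu.
congr (_ * _); first by rewrite exprVn -exprM.
apply: eq_big => l; first by rewrite -val_eqE /= lt0n.
by rewrite lt0n => /negbTE ->; rewrite tailsE exprM.
Qed.

(** Expanding the diagonal entries of T_g T_f.  The coefficients of f restrict the
    double sum to a finite box. *)
Lemma Trq_toeplitz f g : Dfin f -> Dfin g ->
  Trq alpha (toeplitz L g \o toeplitz L f) = Tconst * tform X g f.
Proof.
move=> Df Dg; rewrite /Trq; congr (_ * _).
have [N HN] := tcoef_supp X Df; have [N' HN'] := tformE' X Df.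
have [M [NM N'M]] : exists M, (N <= M)%N /\ (N' <= M)%N.
  by exists (maxn N N'); rewrite leq_maxl leq_maxr.
have f0 k m : (k \notin box n M) || (m \notin box n M) -> tcoef X f k m = 0.
  move=> km; apply: HN; case/orP: km => km; apply/orP; [left|right];
    by apply: contra km; apply: box_le.
rewrite (HN' M)// big_allpairs exchange_big /=.
rewrite (fsumE (uniq_box n M)) => [|m mM]; last first.
  rewrite entry_toeplitz2// fsbig1 ?mul0r// => k _.
  by rewrite f0 ?mM// !mul0r.
apply: eq_bigr => m _; rewrite -mulrA Trq_weight entry_toeplitz2//.
rewrite (fsumE (uniq_box n M)) => [|k kM]; last by rewrite f0 ?kM ?orbT// !mul0r.
rewrite mulr_suml; apply: eq_bigr => k _; rewrite /tform_weight /=.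
by move: (N_neq0 k) (N_neq0 m) => k0 m0; field; rewrite k0 m0.
Qed.

(** The covariant symbol exists since every linear functional on finite functions is
    given by a distribution. *)
Lemma berezinP g : Dfin g -> forall f, Dfin f -> pairing (berezin L g) f = Tconst * tform X g f.
Proof.
move=> Dg f Df; rewrite -Trq_toeplitz//.
have H : exists s : dist R n, forall f, Dfin f ->
    pairing s f = Trq alpha (toeplitz L g \o toeplitz L f).
  have Dl : Dlin (fun f => Tconst / qpoch2 q (Q ^+ 2) n * tform X g f).
    by apply: DlinZ; exact: tform_Dlinr.
  have [s Hs] := mpair_exists q_gt0 q_lt1 Dl.
  exists s => h Dh; rewrite pairingE// Hs// Trq_toeplitz//.
  by rewrite mulrA [X in X * _]mulrC divfK// qpoch_neq0.
exact: (xgetPex 0 H f Df).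
Qed.

Lemma pairing_inj s s' : (forall f : A, Dfin f -> pairing s f = pairing s' f) -> s = s'.
Proof.
move=> H; apply: (mpair_inj q_gt0 q_lt1) => f Df; have := H f Df; rewrite !pairingE//.
by move/mulfI; apply; exact: qpoch_neq0.
Qed.

Lemma berezin_linear (c : C) f g : Dfin f -> Dfin g ->
  berezin L (c *: f + g) = c *: berezin L f + berezin L g.
Proof.
move=> Df Dg; apply: pairing_inj => h Dh.
have Dfg : Dfin (c *: f + g) by apply: DfinD => //; exact: DfinZ.
rewrite berezinP// (tform_Dlinl X Dh)//.
rewrite [RHS]pairingE// mpair_linl//.
have := berezinP Df Dh; have := berezinP Dg Dh; rewrite !pairingE// => Eg Ef.
by rewrite [RHS]mulrDr [in RHS]mulrCA Ef Eg mulrDr mulrCA.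
Qed.

(** The chain of equalities <B(xi f), g> = beta(xi f, g) = beta(f, S(xi) g)
    = <B f, S(xi) g> = <xi (B f), g>. *)
Lemma berezin_act (act : Uq n q -> A -> A) (Hact : module_algebra act)
    (Hgen : module_generators act) (u : Uq n q) f :
  Dfin f -> berezin L (act u f) = dact act u (berezin L f).
Proof.
have Xr : X^* = X by apply: conj_Creal; rewrite ger0_real// ltW// xal_gt0.
elim/presAlg_ind: u => t Df; apply: pairing_inj => g Dg.
have Dt h : Dfin h -> Dfin (act (Ucls q t) h) by exact: Dfin_act.
have Dt' h : Dfin h -> Dfin (act (Ucls q (antipode t)) h) by exact: Dfin_act.
rewrite berezinP//; last exact: Dt.
rewrite pairingE// mpair_dact// -pairingE//; last exact: Dt'.
rewrite berezinP//; last exact: Dt'.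
congr (_ * _); apply: (form_invariance q_gt0 q_lt1 Hact Hgen) => //.
- by move=> h Dh; exact: tform_Dlinl.
- by move=> h Dh; exact: tform_Dlinr.
- by move=> j h h' Dh Dh'; exact: tform_aK.
- by move=> j h h' Dh Dh'; apply: tform_aE => //; exact: Dden_neq0.
- by move=> h h' Dh Dh'; exact: tform_star.
Qed.

End Toeplitz.

Theorem proposition3p8 (R : realType) (n : nat) (q alpha : R)
  (n_gt0 : (0 < n)%N) (q_gt0 : 0 < q) (q_lt1 : q < 1) (alpha_gt0 : 0 < alpha)
  (act : Uq n q -> FUn n q -> FUn n q)
  (act_alg : module_algebra act) (act_gen : module_generators act)
  (L : L2space n q alpha) :
  (forall c f g, Dfin f -> Dfin g ->
     berezin L (c *: f + g) = c *: berezin L f + berezin L g) /\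
  (forall u f, Dfin f -> berezin L (act u f) = dact act u (berezin L f)).
Proof.
split; first by move=> c f g Df Dg; exact: berezin_linear.
by move=> u f Df; exact: berezin_act.
Qed.
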